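(* Let $N\geq 1$ and let $\dot{\phi}:\mathbb{N}\to\mathbb{C}$ be a bounded function. Then: (1) $\dot{\phi}\in\mathcal{A}_N$ if and only if the analytic function $(z^2-1)^N\sum_{n\geq 0}\dot{\phi}(n)z^n$ belongs to $B_1^N(\mathbb{T})$; (2) $\dot{\phi}\in\mathcal{B}_N$ if and only if the analytic function $(z-1)^N\sum_{n\geq 0}\dot{\phi}(n)z^n$ belongs to $B_1^N(\mathbb{T})$; (3) $\dot{\phi}\in\mathcal{C}_N$ if and only if the analytic function $(z^2-1)\sum_{n\geq 0}\dot{\phi}(n)z^n$ belongs to $B_1^N(\mathbb{T})$.
   Context: $\mathbb{N}=\{0,1,2,\dots\}$. For $\dot{\phi}:\mathbb{N}\to\mathbb{C}$ and $j\in\{1,2\}$, $\mathfrak{d}_j\dot{\phi}(n)=\dot{\phi}(n)-\dot{\phi}(n+j)$ and $\mathfrak{d}_j^{m+1}\dot{\phi}=\mathfrak{d}_j(\mathfrak{d}_j^m\dot{\phi})$. $S_1(\ell_2(\mathbb{N}))$ is the space of trace class operators on $\ell_2(\mathbb{N})$; an infinite matrix belongs to it if it is the matrix, in the canonical basis, of a trace class operator. Define $\mathcal{A}_N$, $\mathcal{B}_N$, $\mathcal{C}_N$ as the sets of $\dot{\phi}\in\ell_\infty(\mathbb{N})$ such that, respectively, the matrices $\left((1+i+j)^{N-1}\mathfrak{d}_2^N\dot{\phi}(i+j)\right)_{i,j}$, $\left((1+i+j)^{N-1}\mathfrak{d}_1^N\dot{\phi}(i+j)\right)_{i,j}$, $\left((1+i+j)^{N-1}\mathfrak{d}_2\dot{\phi}(i+j)\right)_{i,j}$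 ($i,j\in\mathbb{N}$) belong to $S_1(\ell_2(\mathbb{N}))$. Besov spaces of analytic functions on the torus $\mathbb{T}$: for $n\geq 1$ let $W_n:\mathbb{T}\to\mathbb{C}$ be the polynomial with Fourier coefficients $\hat{W}_n(k)=2^{-n+1}(k-2^{n-1})$ if $k\in[2^{n-1},2^n]$, $\hat{W}_n(k)=2^{-n}(2^{n+1}-k)$ if $k\in[2^n,2^{n+1}]$, and $\hat{W}_n(k)=0$ otherwise; and put $W_0(z)=1+z$. For $s\in\mathbb{R}$, $B_1^s(\mathbb{T})$ is the space of all series $\varphi(z)=\sum_{n\geq 0}a_nz^n$ such that $\|\varphi\|_{B_1^s}=\sum_{n\geq 0}2^{ns}\|W_n\ast\varphi\|_{L_1(\mathbb{T})}<\infty$, where $W_n\ast\varphi=\sum_k\hat{W}_n(k)a_kz^k$. *)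

(* Defs.v *)
From Stdlib Require Import Reals Arith.
From Coquelicot Require Import Coquelicot.

Open Scope R_scope.

(** ** Operators on [l2(N)]

    Vectors are sequences [nat -> C].  An operator is a function on all
    sequences, of which only the restriction to square-summable ones matters. *)

Definition l2 (x : nat -> C) : Prop := ex_series (fun n => Cmod (x n) ^ 2).

Definition l2_norm (x : nat -> C) : R := sqrt (Series (fun n => Cmod (x n) ^ 2)).

(* Coquelicot's total sum [Series] is real-valued only. *)
Definition CSeries (u : nat -> C) : C :=
  (Series (fun n => Re (u n)), Series (fun n => Im (u n))).

(* Linear in the first argument; the series converges absolutely on [l2]. *)
Definition inner (x y : nat -> C) : C := CSeries (fun n => x n * Cconj (y n))%C.

Definition basis (n : nat) : nat -> C :=
  fun k => if Nat.eqb k n then RtoC 1 else RtoC 0.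

Definition bounded_operator (T : (nat -> C) -> nat -> C) : Prop :=
  (forall x, l2 x -> l2 (T x)) /\
  (forall (a b : C) (x y : nat -> C), l2 x -> l2 y -> forall n,
     T (fun k => a * x k + b * y k)%C n = (a * T x n + b * T y n)%C) /\
  (exists M : R, forall x, l2 x -> l2_norm (T x) <= M * l2_norm x).

Definition is_adjoint (T S : (nat -> C) -> nat -> C) : Prop :=
  bounded_operator S /\
  forall x y, l2 x -> l2 y -> inner (T x) y = inner x (S y).

Definition positive_operator (P : (nat -> C) -> nat -> C) : Prop :=
  bounded_operator P /\
  forall x, l2 x -> Im (inner (P x) x) = 0 /\ 0 <= Re (inner (P x) x).

(* [P = |T|], the unique positive operator with [P^2 = T^* T]. *)
Definition is_abs_operator (T P : (nat -> C) -> nat -> C) : Prop :=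
  positive_operator P /\
  exists S, is_adjoint T S /\ forall x, l2 x -> forall n, P (P x) n = S (T x) n.

(* The trace of [|T|] is finite; its diagonal coefficients are real and >= 0. *)
Definition trace_class (T : (nat -> C) -> nat -> C) : Prop :=
  bounded_operator T /\
  exists P, is_abs_operator T P /\
            ex_series (fun n => Re (inner (P (basis n)) (basis n))).

Definition S1_matrix (A : nat -> nat -> C) : Prop :=
  exists T, trace_class T /\ forall i j, A i j = inner (T (basis j)) (basis i).

(** ** The classes of bounded functions on [N] *)

Definition bounded_seq (phi : nat -> C) : Prop :=
  exists M : R, forall n, Cmod (phi n) <= M.

Definition diff (j : nat) (phi : nat -> C) : nat -> C :=
  fun n => (phi n - phi (n + j)%nat)%C.

Definition diff_iter (j m : nat) (phi : nat -> C) : nat -> C :=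
  Nat.iter m (diff j) phi.

(* The exponent is a truncated subtraction: meaningful for [1 <= N]. *)
Definition weighted_hankel (N : nat) (f : nat -> C) (i j : nat) : C :=
  (RtoC (INR (1 + i + j) ^ (N - 1)) * f (i + j)%nat)%C.

Definition class_A (N : nat) (phi : nat -> C) : Prop :=
  bounded_seq phi /\ S1_matrix (weighted_hankel N (diff_iter 2 N phi)).

Definition class_B (N : nat) (phi : nat -> C) : Prop :=
  bounded_seq phi /\ S1_matrix (weighted_hankel N (diff_iter 1 N phi)).

Definition class_C (N : nat) (phi : nat -> C) : Prop :=
  bounded_seq phi /\ S1_matrix (weighted_hankel N (diff 2 phi)).

(** ** Power series, given by their coefficients *)

Definition fps_one : nat -> C := fun n => if Nat.eqb n 0 then RtoC 1 else RtoC 0.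

Definition fps_X : nat -> C := fun n => if Nat.eqb n 1 then RtoC 1 else RtoC 0.

Definition fps_sub (a b : nat -> C) : nat -> C := fun n => (a n - b n)%C.

Definition fps_mul (a b : nat -> C) : nat -> C :=
  fun n => sum_n (fun k => a k * b (n - k)%nat)%C n.

Definition fps_pow (a : nat -> C) (m : nat) : nat -> C :=
  Nat.iter m (fps_mul a) fps_one.

(** ** Besov spaces of analytic functions on the torus *)

(* Fourier coefficients of [W_n]; the two nonzero branches agree (both are 1)
   at [k = 2 ^ n]. *)
Definition W_coeff (n k : nat) : R :=
  match n with
  | O => if Nat.leb k 1 then 1 else 0
  | S m =>
      if (Nat.leb (2 ^ m) k && Nat.leb k (2 ^ n))%bool then
        (INR k - 2 ^ m) / 2 ^ m
      else if (Nat.leb (2 ^ n) k && Nat.leb k (2 ^ (n + 1)))%bool then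
        (2 ^ (n + 1) - INR k) / 2 ^ n
      else 0
  end.

(* The polynomial [W_n * phi] for [phi = sum_k a_k z^k]; [W_coeff n] vanishes
   beyond [2 ^ (n + 1)]. *)
Definition W_conv (n : nat) (a : nat -> C) (z : C) : C :=
  sum_n (fun k => RtoC (W_coeff n k) * a k * Cpow z k)%C (2 ^ (n + 1))%nat.

(* For continuous [f], with the normalized Haar measure on the torus. *)
Definition L1_torus_norm (f : C -> C) : R :=
  / (2 * PI) * RInt (fun t => Cmod (f (cos t, sin t))) 0 (2 * PI).

Definition besov (s : R) (a : nat -> C) : Prop :=
  ex_series (fun n => Rpower 2 (INR n * s) * L1_torus_norm (W_conv n a)).

(* Main.v *)
Require Import Defs.
From Stdlib Require Import Reals Arith Lra Lia Psatz.
From Stdlib Require Import FunctionalExtensionality ProofIrrelevance ClassicalEpsilon.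
From Coquelicot Require Import Coquelicot.

(** This is Peller's characterization of the trace class Hankel operators,
    with polynomial weights. Multiplying a power series by [z^d - 1] takes
    differences of the coefficients and shifts them by [d], so each of the
    three equivalences is an instance of one statement about a series [F], a
    shift [K] and an exponent [p = N - 1] ([S1_weighted_hankel_iff_besov]):
    the matrix [(1 + i + j)^p F (i + j + K)] is trace class if and only if [F]
    lies in the Besov space of order [p + 1].

    The operator theory is confined to [S1_matrix_iff_dual]: a matrix [A] is
    trace class if and only if the pairings [sum A_ij G_ij] with the finite
    matrices [G] of operator norm at most [1] are bounded. Given the bound,
    [A] defines a bounded operator [T], the absolute value [P] is obtained as
    the square root of [T^* T] ([pos_op_sqrt]), and its trace is a limit of
    pairings of [A] with the contractions [U_n] of an approximate polar
    decomposition ([polar_approx]). Conversely, the pairing of a trace class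
    operator is controlled, again with the help of [U_n], by the
    Hilbert-Schmidt norm of the square root of [P].

    If [F] is in the Besov space, write [F] as the sum of the polynomials
    [W_n * F]. The Hankel matrix of a polynomial is an average, over rotated roots
    of unity [z], of the rank one matrices [z^(-i) z^(-j)], weighted by the
    values of the polynomial at [z]; up to constants, the weight [(1 + i +
    j)^p] costs [2^(n p)] and the rank one matrices cost [2^n]
    ([poly_trace_bound]). Passing between integrals and finite averages is
    harmless: some rotation does at least as well as the mean ([average_le],
    [average_ge]).

    If the matrix has a finite dual norm, it is tested against a sum of
    blocks with few overlaps. The [n]-th block is a Hankel matrix of discrete
    Fourier coefficients of phases, chosen to reveal an [L^1] norm
    ([single_block]), divided by [(1 + i + j)^p]; this division is harmless,
    because on indices [i >= a], [j >= b] the Schur multiplier [(1 + a + b) /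
    (1 + i + j)] is contractive ([schur_contraction]). Summing a Hankel matrix
    over a square block weights the coefficients by a triangle, and [W_n] is
    the combination of two such triangles ([W_hats]). *)

Open Scope R_scope.

(** * Finite sums *)

Fixpoint rsum (n : nat) (f : nat -> R) : R :=
  match n with O => 0 | S m => rsum m f + f m end.

Fixpoint csum (n : nat) (f : nat -> C) : C :=
  match n with O => RtoC 0 | S m => (csum m f + f m)%C end.

Lemma rsum_ext n f g : (forall k, (k < n)%nat -> f k = g k) -> rsum n f = rsum n g.
Proof. induction n; intros H; simpl; auto. rewrite IHn, H; auto. Qed.

Lemma csum_ext n f g : (forall k, (k < n)%nat -> f k = g k) -> csum n f = csum n g.
Proof. induction n; intros H; simpl; auto. rewrite IHn, H; auto. Qed.

Lemma rsum_plus n f g : rsum n (fun k => f k + g k) = rsum n f + rsum n g.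
Proof. induction n; simpl; [ring|rewrite IHn; ring]. Qed.

Lemma csum_plus n f g : csum n (fun k => f k + g k)%C = (csum n f + csum n g)%C.
Proof. induction n; simpl; [ring|rewrite IHn; ring]. Qed.

Lemma rsum_scal n c f : rsum n (fun k => c * f k) = c * rsum n f.
Proof. induction n; simpl; [ring|rewrite IHn; ring]. Qed.

Lemma csum_scal n c f : csum n (fun k => c * f k)%C = (c * csum n f)%C.
Proof. induction n; simpl; [ring|rewrite IHn; ring]. Qed.

Lemma csum_scal_r n c f : csum n (fun k => f k * c)%C = (csum n f * c)%C.
Proof. induction n; simpl; [ring|rewrite IHn; ring]. Qed.

Lemma rsum_const n c : rsum n (fun _ => c) = INR n * c.
Proof. induction n; [simpl; ring|]. rewrite S_INR; simpl rsum; rewrite IHn; ring. Qed.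

Lemma rsum_0 n f : (forall k, (k < n)%nat -> f k = 0) -> rsum n f = 0.
Proof. induction n; intros H; simpl; auto. rewrite IHn, H by auto. ring. Qed.

Lemma csum_0 n f : (forall k, (k < n)%nat -> f k = RtoC 0) -> csum n f = RtoC 0.
Proof. induction n; intros H; simpl; auto. rewrite IHn, H by auto. ring. Qed.

Lemma rsum_swap m n (f : nat -> nat -> R) :
  rsum m (fun i => rsum n (f i)) = rsum n (fun j => rsum m (fun i => f i j)).
Proof.
  induction m; simpl.
  - symmetry; apply rsum_0; auto.
  - rewrite IHm, rsum_plus; ring.
Qed.

Lemma csum_swap m n (f : nat -> nat -> C) :
  csum m (fun i => csum n (f i)) = csum n (fun j => csum m (fun i => f i j)).
Proof.
  induction m; simpl.
  - symmetry; apply csum_0; auto.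
  - rewrite IHm, csum_plus; ring.
Qed.

Lemma rsum_le n f g : (forall k, (k < n)%nat -> f k <= g k) -> rsum n f <= rsum n g.
Proof.
  induction n; intros H; simpl; [lra|].
  apply Rplus_le_compat; auto.
Qed.

Lemma rsum_nonneg n f : (forall k, (k < n)%nat -> 0 <= f k) -> 0 <= rsum n f.
Proof.
  induction n; intros H; simpl; [lra|].
  apply Rplus_le_le_0_compat; auto.
Qed.

Lemma rsum_split m n f : rsum (m + n) f = rsum m f + rsum n (fun k => f (m + k)%nat).
Proof.
  induction n; simpl.
  - rewrite Nat.add_0_r; ring.
  - rewrite Nat.add_succ_r; simpl; rewrite IHn; ring.
Qed.

Lemma csum_split m n f : csum (m + n) f = (csum m f + csum n (fun k => f (m + k)%nat))%C.
Proof.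
  induction n; simpl.
  - rewrite Nat.add_0_r; ring.
  - rewrite Nat.add_succ_r; simpl; rewrite IHn; ring.
Qed.

Lemma rsum_mono m n f : (forall k, 0 <= f k) -> (m <= n)%nat -> rsum m f <= rsum n f.
Proof.
  intros H L. replace n with (m + (n - m))%nat by lia.
  rewrite rsum_split.
  assert (0 <= rsum (n - m) (fun k => f (m + k)%nat)) by (apply rsum_nonneg; auto). lra.
Qed.

Lemma csum_Cmod n f : Cmod (csum n f) <= rsum n (fun k => Cmod (f k)).
Proof.
  induction n; simpl.
  - rewrite Cmod_0; lra.
  - eapply Rle_trans; [apply Cmod_triangle|]; lra.
Qed.

Lemma csum_conj n f : Cconj (csum n f) = csum n (fun k => Cconj (f k)).
Proof.
  induction n; simpl.
  - unfold Cconj; simpl. apply injective_projections; simpl; ring.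
  - rewrite Cplus_conj, IHn; auto.
Qed.

Lemma csum_RtoC n f : csum n (fun k => RtoC (f k)) = RtoC (rsum n f).
Proof. induction n; simpl; auto. rewrite IHn, RtoC_plus; auto. Qed.

Lemma Re_csum n f : Re (csum n f) = rsum n (fun k => Re (f k)).
Proof. induction n; simpl; auto. rewrite <- IHn; auto. Qed.

Lemma Im_csum n f : Im (csum n f) = rsum n (fun k => Im (f k)).
Proof. induction n; simpl; auto. rewrite <- IHn; auto. Qed.

Lemma sum_n_csum (f : nat -> C) n : sum_n f n = csum (S n) f.
Proof.
  induction n.
  - rewrite sum_O; simpl; ring.
  - rewrite sum_Sn, IHn; reflexivity.
Qed.

Lemma sum_n_rsum (f : nat -> R) n : sum_n f n = rsum (S n) f.
Proof.
  induction n.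
  - rewrite sum_O; simpl; ring.
  - rewrite sum_Sn, IHn; reflexivity.
Qed.

(** The indicator of the window [[a, a + L)]. *)
Definition win (a L i : nat) : R :=
  if (Nat.leb a i && Nat.ltb i (a + L))%bool then 1 else 0.

Lemma csum_win J a L (h : nat -> C) : (a + L <= J)%nat ->
  csum J (fun i => RtoC (win a L i) * h i)%C = csum L (fun i => h (a + i)%nat).
Proof.
  intros HJ. replace J with (a + (L + (J - a - L)))%nat by lia.
  rewrite !csum_split.
  rewrite (csum_0 a), (csum_0 (J - a - L)).
  - rewrite Cplus_0_l, Cplus_0_r. apply csum_ext; intros k Hk.
    unfold win. rewrite (proj2 (Nat.leb_le _ _)), (proj2 (Nat.ltb_lt _ _)) by lia. simpl; ring.
  - intros k Hk. unfold win. rewrite (proj2 (Nat.ltb_nlt (a + (L + k)) (a + L))) by lia.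
    rewrite Bool.andb_false_r; ring.
  - intros k Hk. unfold win. rewrite (proj2 (Nat.leb_nle a k)) by lia. simpl; ring.
Qed.

Lemma rsum_CS n u v : rsum n (fun k => u k * v k) <=
  sqrt (rsum n (fun k => u k ^ 2)) * sqrt (rsum n (fun k => v k ^ 2)).
Proof.
  induction n; cbn [rsum].
  - rewrite sqrt_0; lra.
  - set (A := rsum n (fun k => u k ^ 2)) in *. set (B := rsum n (fun k => v k ^ 2)) in *.
    assert (HA : 0 <= A) by (apply rsum_nonneg; intros; apply pow2_ge_0).
    assert (HB : 0 <= B) by (apply rsum_nonneg; intros; apply pow2_ge_0).
    apply Rle_trans with (sqrt A * sqrt B + u n * v n); [lra|].
    pose proof (pow2_ge_0 (u n)). pose proof (pow2_ge_0 (v n)).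
    rewrite <- (sqrt_mult (A + _) (B + _)) by lra.
    pose proof (sqrt_pos A); pose proof (sqrt_pos B).
    pose proof (sqrt_sqrt A HA); pose proof (sqrt_sqrt B HB).
    destruct (Rle_dec 0 (sqrt A * sqrt B + u n * v n)).
    + apply Rsqr_incr_0_var; [|apply sqrt_pos].
      rewrite Rsqr_sqrt by (apply Rmult_le_pos; lra).
      unfold Rsqr.
      pose proof (pow2_ge_0 (sqrt A * v n - sqrt B * u n)).
      set (a := sqrt A) in *; set (b := sqrt B) in *. rewrite <- H3, <- H4. nra.
    + pose proof (sqrt_pos ((A + u n ^ 2) * (B + v n ^ 2))); lra.
Qed.

Definition sqs (n : nat) (x : nat -> C) : R := rsum n (fun k => Cmod (x k) ^ 2).
Definition nrm (n : nat) (x : nat -> C) : R := sqrt (sqs n x).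

Lemma sqs_nonneg n x : 0 <= sqs n x.
Proof. apply rsum_nonneg; intros; apply pow2_ge_0. Qed.

Lemma nrm_pos n x : 0 <= nrm n x.
Proof. apply sqrt_pos. Qed.

Lemma nrm_sqr n x : nrm n x ^ 2 = sqs n x.
Proof. unfold nrm; rewrite <- Rsqr_pow2, Rsqr_sqrt; auto using sqs_nonneg. Qed.

Lemma csum_CS n x y : Cmod (csum n (fun k => x k * y k)%C) <= nrm n x * nrm n y.
Proof.
  eapply Rle_trans; [apply csum_Cmod|].
  erewrite rsum_ext; [|intros; apply Cmod_mult].
  apply (rsum_CS n (fun k => Cmod (x k)) (fun k => Cmod (y k))).
Qed.

Lemma rsum_CS_le n u v A B : (forall k, (k < n)%nat -> 0 <= u k) -> (forall k, (k < n)%nat -> 0 <= v k) ->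
  rsum n (fun k => u k ^ 2) <= A ^ 2 -> rsum n (fun k => v k ^ 2) <= B ^ 2 -> 0 <= A -> 0 <= B ->
  rsum n (fun k => u k * v k) <= A * B.
Proof.
  intros Hu Hv H1 H2 HA HB. eapply Rle_trans; [apply rsum_CS|].
  apply Rmult_le_compat; try apply sqrt_pos.
  - rewrite <- (sqrt_pow2 A) by auto. apply sqrt_le_1_alt; auto.
  - rewrite <- (sqrt_pow2 B) by auto. apply sqrt_le_1_alt; auto.
Qed.

Lemma sqs_scal n c x : sqs n (fun k => c * x k)%C = Cmod c ^ 2 * sqs n x.
Proof.
  unfold sqs. rewrite <- rsum_scal. apply rsum_ext; intros. rewrite Cmod_mult; ring.
Qed.

Lemma nrm_scal n c x : nrm n (fun k => c * x k)%C = Cmod c * nrm n x.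
Proof.
  unfold nrm. rewrite sqs_scal, sqrt_mult by (try apply pow2_ge_0; apply sqs_nonneg).
  rewrite sqrt_pow2; auto using Cmod_ge_0.
Qed.

Lemma nrm_le n x y : (forall k, (k < n)%nat -> Cmod (x k) <= Cmod (y k)) -> nrm n x <= nrm n y.
Proof.
  intros H. apply sqrt_le_1_alt, rsum_le; intros.
  apply pow_incr; split; auto using Cmod_ge_0.
Qed.

Lemma nrm_ext n x y : (forall k, (k < n)%nat -> x k = y k) -> nrm n x = nrm n y.
Proof. intros H; unfold nrm, sqs; f_equal; apply rsum_ext; intros; rewrite H; auto. Qed.

Lemma nrm_conj n x : nrm n (fun k => Cconj (x k)) = nrm n x.
Proof. unfold nrm, sqs; f_equal; apply rsum_ext; intros; rewrite Cmod_conj; auto. Qed.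

Lemma csum_self n x : csum n (fun k => x k * Cconj (x k))%C = RtoC (sqs n x).
Proof.
  unfold sqs. rewrite <- csum_RtoC. apply csum_ext; intros.
  rewrite <- Cmod2_conj. reflexivity.
Qed.

(** Test against the conjugate of [z] itself. *)
Lemma nrm_dual n z c : 0 <= c ->
  (forall y, Cmod (csum n (fun k => z k * y k)%C) <= c * nrm n y) -> nrm n z <= c.
Proof.
  intros Hc H. specialize (H (fun k => Cconj (z k))).
  rewrite csum_self, nrm_conj, Cmod_R, Rabs_pos_eq in H by apply sqs_nonneg.
  rewrite <- nrm_sqr in H. pose proof (nrm_pos n z).
  destruct (Req_dec (nrm n z) 0); [lra|]. nra.
Qed.

Definition pairing (J : nat) (A G : nat -> nat -> C) : C :=
  csum J (fun i => csum J (fun j => A i j * G i j)%C).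

(** * Contractive matrices and the dual of the operator norm *)

(** An operator norm bound for the corner of size [J].  The form is bilinear
    rather than sesquilinear: conjugating [y] preserves its norm. *)
Definition opbound (J : nat) (G : nat -> nat -> C) (c : R) : Prop :=
  forall x y, Cmod (pairing J G (fun i j => x i * y j)%C) <= c * (nrm J x * nrm J y).

(** The trace norm of [A], described through its duality with the operator
    norm.  Only finite matrices are tested, so that no operator has to be
    constructed before one can speak of it. *)
Definition dual_trace_bound (A : nat -> nat -> C) (kappa : R) : Prop :=
  forall J G, opbound J G 1 -> Cmod (pairing J A G) <= kappa.

Lemma pairing_ext J A G A' G' :
  (forall i j, (i < J)%nat -> (j < J)%nat -> (A i j * G i j = A' i j * G' i j)%C) ->
  pairing J A G = pairing J A' G'.
Proof. intros H; apply csum_ext; intros; apply csum_ext; intros; auto. Qed.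

Lemma pairing_plus_r J A G H : pairing J A (fun i j => G i j + H i j)%C = (pairing J A G + pairing J A H)%C.
Proof.
  unfold pairing. rewrite <- csum_plus. apply csum_ext; intros. rewrite <- csum_plus.
  apply csum_ext; intros; ring.
Qed.

Lemma pairing_plus_l J A G H : pairing J (fun i j => G i j + H i j)%C A = (pairing J G A + pairing J H A)%C.
Proof.
  unfold pairing. rewrite <- csum_plus. apply csum_ext; intros. rewrite <- csum_plus.
  apply csum_ext; intros; ring.
Qed.

Lemma pairing_scal_r J c A G : pairing J A (fun i j => c * G i j)%C = (c * pairing J A G)%C.
Proof.
  unfold pairing. rewrite <- csum_scal. apply csum_ext; intros. rewrite <- csum_scal.
  apply csum_ext; intros; ring.
Qed.

Lemma pairing_scal_l J c A G : pairing J (fun i j => c * A i j)%C G = (c * pairing J A G)%C.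
Proof.
  unfold pairing. rewrite <- csum_scal. apply csum_ext; intros. rewrite <- csum_scal.
  apply csum_ext; intros; ring.
Qed.

Lemma pairing_csum_l J n (A : nat -> nat -> nat -> C) G :
  pairing J (fun i j => csum n (fun m => A m i j)) G = csum n (fun m => pairing J (A m) G).
Proof.
  unfold pairing. rewrite (csum_swap n J). apply csum_ext; intros i _.
  rewrite (csum_swap n J). apply csum_ext; intros j _. rewrite <- csum_scal_r; auto.
Qed.

Lemma opbound_ext J G H c : (forall i j, (i < J)%nat -> (j < J)%nat -> G i j = H i j) ->
  opbound J G c -> opbound J H c.
Proof.
  intros E HG x y. erewrite pairing_ext; [apply HG|]. intros; simpl; rewrite E; auto.
Qed.

Lemma opbound_scal J G c d : opbound J G c -> opbound J (fun i j => d * G i j)%C (Cmod d * c).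
Proof.
  intros HG x y. rewrite pairing_scal_l, Cmod_mult.
  rewrite Rmult_assoc. apply Rmult_le_compat_l; auto using Cmod_ge_0.
Qed.

Lemma opbound_mono J G c d : c <= d -> opbound J G c -> opbound J G d.
Proof.
  intros Hcd HG x y. eapply Rle_trans; [apply HG|]. apply Rmult_le_compat_r; auto.
  apply Rmult_le_pos; apply nrm_pos.
Qed.

Lemma dual_trace_bound_scaled_pos A kappa J G c : dual_trace_bound A kappa -> 0 < c ->
  opbound J G c -> Cmod (pairing J A G) <= c * kappa.
Proof.
  intros HA Hc HG.
  assert (H : opbound J (fun i j => RtoC (/ c) * G i j)%C 1).
  { replace 1 with (Cmod (RtoC (/ c)) * c). apply opbound_scal; auto.
    rewrite Cmod_R, Rabs_pos_eq. field; lra. apply Rlt_le, Rinv_0_lt_compat; auto. }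
  apply HA in H. rewrite pairing_scal_r, Cmod_mult, Cmod_R, Rabs_pos_eq in H
    by (apply Rlt_le, Rinv_0_lt_compat; auto).
  apply Rmult_le_compat_l with (r := c) in H; [|lra].
  rewrite <- Rmult_assoc, Rinv_r, Rmult_1_l in H by lra. auto.
Qed.

Lemma dual_trace_bound_pos A kappa : dual_trace_bound A kappa -> 0 <= kappa.
Proof.
  intros H. specialize (H O (fun _ _ => RtoC 0)).
  eapply Rle_trans; [|apply H]. apply Cmod_ge_0.
  intros x y. unfold pairing; simpl. rewrite Cmod_0. unfold nrm, sqs; simpl; rewrite sqrt_0; lra.
Qed.

(** * Limits of real and complex sequences *)

(** Stated through the modulus, so that one squeeze argument serves for all
    the operations on limits. *)
Definition clim (u : nat -> C) (l : C) : Prop := is_lim_seq (fun n => Cmod (u n - l)%C) 0.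

Lemma lim_squeeze0 (u v : nat -> R) : (forall n, 0 <= u n <= v n) -> is_lim_seq v 0 -> is_lim_seq u 0.
Proof.
  intros H Hv. apply is_lim_seq_le_le with (fun _ => 0) v; auto. apply is_lim_seq_const.
Qed.

Lemma is_lim_seq_plus_fin u v (a b : R) : is_lim_seq u a -> is_lim_seq v b -> is_lim_seq (fun n => u n + v n) (a + b).
Proof. intros; apply is_lim_seq_plus'; auto. Qed.

Lemma is_lim_seq_scal_fin u c (a : R) : is_lim_seq u a -> is_lim_seq (fun n => c * u n) (c * a).
Proof. intros H; apply (is_lim_seq_scal_l u c a H). Qed.

Lemma lim0_plus u v : is_lim_seq u 0 -> is_lim_seq v 0 -> is_lim_seq (fun n => u n + v n) 0.
Proof. intros H1 H2. replace 0 with (0 + 0) by ring. apply is_lim_seq_plus_fin; auto. Qed.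

Lemma lim0_scal c u : is_lim_seq u 0 -> is_lim_seq (fun n => c * u n) 0.
Proof. intros H1. replace 0 with (c * 0) by ring. apply is_lim_seq_scal_fin; auto. Qed.

Lemma lim_le_const u (a b : R) : (forall n, u n <= b) -> is_lim_seq u a -> a <= b.
Proof. intros H Hu. apply (is_lim_seq_le u (fun _ => b) a b H Hu (is_lim_seq_const b)). Qed.

(** An inequality up to an error that tends to zero: this is how traces and
    norms are estimated through approximations. *)
Lemma le_plus_lim0 (a b : R) u : (forall n, a <= b + u n) -> is_lim_seq u 0 -> a <= b.
Proof.
  intros H Hu.
  apply (is_lim_seq_le (fun _ => a) (fun n => b + u n) a b H (is_lim_seq_const a)).
  replace b with (b + 0) at 1 by ring. apply is_lim_seq_plus_fin; auto. apply is_lim_seq_const.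
Qed.

Lemma clim_ext u v l : (forall n, u n = v n) -> clim u l -> clim v l.
Proof. intros H Hu. apply is_lim_seq_ext with (2 := Hu). intros; rewrite H; auto. Qed.

Lemma clim_const l : clim (fun _ => l) l.
Proof.
  unfold clim. apply is_lim_seq_ext with (fun _ => 0); [|apply is_lim_seq_const].
  intros. replace (l - l)%C with (RtoC 0) by ring. rewrite Cmod_0; auto.
Qed.

Lemma clim_plus u v a b : clim u a -> clim v b -> clim (fun n => u n + v n)%C (a + b)%C.
Proof.
  intros Hu Hv. apply lim_squeeze0 with (2 := lim0_plus _ _ Hu Hv).
  intros n; split; [apply Cmod_ge_0|].
  replace (u n + v n - (a + b))%C with ((u n - a) + (v n - b))%C by ring. apply Cmod_triangle.
Qed.

Lemma clim_scal c u a : clim u a -> clim (fun n => c * u n)%C (c * a)%C.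
Proof.
  intros Hu. apply lim_squeeze0 with (2 := lim0_scal (Cmod c) _ Hu).
  intros n; split; [apply Cmod_ge_0|].
  replace (c * u n - c * a)%C with (c * (u n - a))%C by ring. rewrite Cmod_mult; lra.
Qed.

Lemma clim_conj u a : clim u a -> clim (fun n => Cconj (u n)) (Cconj a).
Proof.
  intros Hu. apply is_lim_seq_ext with (2 := Hu). intros n.
  rewrite <- Cminus_conj, Cmod_conj; auto.
Qed.

Lemma clim_Cmod_le_lim u l (v : nat -> R) (b : R) : clim u l -> is_lim_seq v b ->
  (forall n, Cmod (u n) <= v n) -> Cmod l <= b.
Proof.
  intros Hu Hv H.
  apply (is_lim_seq_le (fun _ => Cmod l) (fun n => v n + Cmod (u n - l)%C) (Cmod l) b).
  - intros n. replace l with (u n + - (u n - l))%C at 1 by ring.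
    eapply Rle_trans; [apply Cmod_triangle|]. rewrite Cmod_opp. specialize (H n); lra.
  - apply is_lim_seq_const.
  - replace b with (b + 0) by ring. apply is_lim_seq_plus_fin; auto.
Qed.

Lemma clim_Cmod_le u l b : clim u l -> (forall n, Cmod (u n) <= b) -> Cmod l <= b.
Proof. intros Hu. apply clim_Cmod_le_lim with (1 := Hu). apply is_lim_seq_const. Qed.

Lemma Cminus_eq_0 (a b : C) : Cmod (a - b)%C = 0 -> a = b.
Proof.
  intros H. apply Cmod_eq_0 in H. replace a with ((a - b) + b)%C by ring. rewrite H; ring.
Qed.

Lemma clim_unique u a b : clim u a -> clim u b -> a = b.
Proof.
  intros Ha Hb. apply Cminus_eq_0. apply Rle_antisym; [|apply Cmod_ge_0].
  apply clim_Cmod_le_lim with (fun n => u n - u n)%C (fun _ => 0).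
  - replace (a - b)%C with (a + (-(1)) * b)%C by ring.
    apply clim_ext with (fun n => u n + (-(1)) * u n)%C. intros; ring.
    apply clim_plus; auto. apply clim_scal; auto.
  - apply is_lim_seq_const.
  - intros n. replace (u n - u n)%C with (RtoC 0) by ring. rewrite Cmod_0; lra.
Qed.

Lemma clim_Re_Im u l : is_lim_seq (fun n => Re (u n)) (Re l) -> is_lim_seq (fun n => Im (u n)) (Im l) ->
  clim u l.
Proof.
  intros H1 H2.
  assert (A : forall v (a : R), is_lim_seq v a -> is_lim_seq (fun n => Rabs (v n - a)) 0).
  { intros v a Hv. replace 0 with (Rabs (a - a)) by (rewrite Rminus_diag, Rabs_R0; auto).
    apply (is_lim_seq_abs (fun n => v n - a) (a - a)).
    apply is_lim_seq_minus'; auto. apply is_lim_seq_const. }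
  apply lim_squeeze0 with (2 := lim0_plus _ _ (A _ _ H1) (A _ _ H2)).
  intros n; split; [apply Cmod_ge_0|].
  replace (u n - l)%C with (RtoC (Re (u n) - Re l) + Ci * RtoC (Im (u n) - Im l))%C.
  - eapply Rle_trans; [apply Cmod_triangle|]. rewrite Cmod_mult, Cmod_Ci, !Cmod_R; lra.
  - destruct (u n), l; unfold Ci; apply injective_projections; simpl; ring.
Qed.

Lemma rsum_S_lim (f : nat -> R) (l : R) : is_series f l -> is_lim_seq (fun n => rsum n f) l.
Proof.
  intros H. apply is_lim_seq_incr_1.
  apply is_lim_seq_ext with (sum_n f); auto. intros; apply sum_n_rsum.
Qed.

Lemma rsum_lim_series f (l : R) : is_lim_seq (fun n => rsum n f) l -> is_series f l.
Proof.
  intros H. apply is_lim_seq_incr_1 in H.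
  apply is_lim_seq_ext with (v := sum_n f) in H; auto. intros; symmetry; apply sum_n_rsum.
Qed.

Lemma ex_series_bounded (f : nat -> R) B : (forall n, 0 <= f n) -> (forall n, rsum n f <= B) -> ex_series f.
Proof.
  intros H0 HB.
  destruct (ex_finite_lim_seq_incr (fun n => rsum n f) B) as [l Hl]; auto.
  - intros n; simpl. specialize (H0 n); lra.
  - exists l. apply rsum_lim_series; auto.
Qed.

Lemma rsum_le_Series f n : (forall n, 0 <= f n) -> ex_series f -> rsum n f <= Series f.
Proof.
  intros H0 H. apply Series_correct, rsum_S_lim in H.
  apply (is_lim_seq_le_loc (fun _ => rsum n f) (fun m => rsum m f) (rsum n f) (Series f)).
  - exists n; intros; apply rsum_mono; auto.
  - apply is_lim_seq_const.
  - auto.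
Qed.

Lemma l2_of_bound x B : (forall n, sqs n x <= B) -> l2 x.
Proof. intros H. apply ex_series_bounded with B; auto. intros; apply pow2_ge_0. Qed.

Lemma l2_norm_pos x : 0 <= l2_norm x.
Proof. apply sqrt_pos. Qed.

Lemma l2_norm_sqr x : l2 x -> l2_norm x ^ 2 = Series (fun n => Cmod (x n) ^ 2).
Proof.
  intros H. unfold l2_norm. rewrite <- Rsqr_pow2, Rsqr_sqrt; auto.
  eapply Rle_trans; [|apply rsum_le_Series with (n := O)]; simpl; auto; try lra.
  intros; apply (pow2_ge_0 (Cmod (x n))).
Qed.

Lemma sqs_lim x : l2 x -> is_lim_seq (fun n => sqs n x) (l2_norm x ^ 2).
Proof. intros H. rewrite l2_norm_sqr by auto. apply rsum_S_lim, Series_correct, H. Qed.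

Lemma sqs_le_norm x n : l2 x -> sqs n x <= l2_norm x ^ 2.
Proof.
  intros H. rewrite l2_norm_sqr by auto. apply rsum_le_Series; auto. intros; apply pow2_ge_0.
Qed.

Lemma nrm_le_norm x n : l2 x -> nrm n x <= l2_norm x.
Proof.
  intros H. rewrite <- (sqrt_pow2 (l2_norm x)) by apply l2_norm_pos.
  apply sqrt_le_1_alt, sqs_le_norm; auto.
Qed.

Lemma norm_le_of_nrm x B : l2 x -> 0 <= B -> (forall n, nrm n x <= B) -> l2_norm x <= B.
Proof.
  intros H HB Hn. apply Rsqr_incr_0_var; auto. rewrite !Rsqr_pow2.
  apply lim_le_const with (2 := sqs_lim x H).
  intros n. rewrite <- nrm_sqr. apply pow_incr; split; auto using nrm_pos.
Qed.

Lemma l2_of_nrm x B : (forall n, nrm n x <= B) -> l2 x.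
Proof.
  intros H. apply l2_of_bound with (B ^ 2). intros n. rewrite <- nrm_sqr.
  apply pow_incr; split; auto using nrm_pos.
Qed.

(** By duality, from the Cauchy-Schwarz inequality. *)
Lemma nrm_triangle n x y : nrm n (fun k => x k + y k)%C <= nrm n x + nrm n y.
Proof.
  assert (0 <= nrm n x + nrm n y) by (pose proof (nrm_pos n x); pose proof (nrm_pos n y); lra).
  apply nrm_dual; auto. intros z.
  replace (csum n (fun k => (x k + y k) * z k)%C) with
    (csum n (fun k => x k * z k)%C + csum n (fun k => y k * z k)%C)%C.
  - eapply Rle_trans; [apply Cmod_triangle|].
    pose proof (csum_CS n x z). pose proof (csum_CS n y z). lra.
  - rewrite <- csum_plus. apply csum_ext; intros; ring.
Qed.

(** * The Hilbert space of square-summable sequences *)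

(** Square-summable sequences are packed with the proof of summability, so
    that equality of vectors is Leibniz equality ([hvec_ext]) and operators
    can be rewritten with. *)
Record hvec := Hvec { coef :> nat -> C; coef_l2 : l2 coef }.

Lemma hvec_ext (x y : hvec) : (forall n, x n = y n) -> x = y.
Proof.
  destruct x as [x hx], y as [y hy]; simpl; intros H.
  assert (x = y) by (apply functional_extensionality; auto). subst.
  f_equal; apply proof_irrelevance.
Qed.

Lemma l2_add x y : l2 x -> l2 y -> l2 (fun k => x k + y k)%C.
Proof.
  intros Hx Hy. apply l2_of_nrm with (l2_norm x + l2_norm y). intros n.
  eapply Rle_trans; [apply nrm_triangle|]. apply Rplus_le_compat; apply nrm_le_norm; auto.
Qed.

Lemma l2_scal c x : l2 x -> l2 (fun k => c * x k)%C.
Proof.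
  intros Hx. apply l2_of_nrm with (Cmod c * l2_norm x). intros n.
  rewrite nrm_scal. apply Rmult_le_compat_l; auto using Cmod_ge_0, nrm_le_norm.
Qed.

Definition hadd (x y : hvec) : hvec := Hvec _ (l2_add x y (coef_l2 x) (coef_l2 y)).
Definition hscal (c : C) (x : hvec) : hvec := Hvec _ (l2_scal c x (coef_l2 x)).
Definition hsub (x y : hvec) : hvec := hadd x (hscal (-(1))%C y).

Lemma l2_zero : l2 (fun _ => RtoC 0).
Proof.
  apply l2_of_bound with 0. intros n. unfold sqs. rewrite rsum_0; try lra.
  intros. rewrite Cmod_0; ring.
Qed.

Definition hzero : hvec := Hvec _ l2_zero.

(** Vector identities are ring identities in each coordinate. *)
Ltac hring := apply hvec_ext; intro; cbn [coef hadd hscal hsub hzero]; ring.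

Definition ip (x y : hvec) : C := inner x y.
Definition hnorm (x : hvec) : R := l2_norm x.

Lemma hnorm_pos x : 0 <= hnorm x.
Proof. apply l2_norm_pos. Qed.

Lemma ip_lim (x y : hvec) : clim (fun n => csum n (fun k => x k * Cconj (y k))%C) (ip x y).
Proof.
  assert (D : ex_series (fun n => Cmod (x n) ^ 2 + Cmod (y n) ^ 2)).
  { apply (ex_series_plus (fun n => Cmod (x n) ^ 2) (fun n => Cmod (y n) ^ 2)); apply coef_l2. }
  assert (B : forall n, Cmod (x n * Cconj (y n))%C <= Cmod (x n) ^ 2 + Cmod (y n) ^ 2).
  { intros n. rewrite Cmod_mult, Cmod_conj. pose proof (Cmod_ge_0 (x n)). pose proof (Cmod_ge_0 (y n)). nra. }
  apply clim_Re_Im.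
  - apply is_lim_seq_ext with (fun n => rsum n (fun k => Re (x k * Cconj (y k))%C)).
    intros; rewrite Re_csum; auto.
    apply rsum_S_lim, Series_correct.
    apply (ex_series_le (K := R_AbsRing) (V := R_CompleteNormedModule)) with (2 := D).
    intros n. eapply Rle_trans; [|apply B]. apply re_le_Cmod.
  - apply is_lim_seq_ext with (fun n => rsum n (fun k => Im (x k * Cconj (y k))%C)).
    intros; rewrite Im_csum; auto.
    apply rsum_S_lim, Series_correct.
    apply (ex_series_le (K := R_AbsRing) (V := R_CompleteNormedModule)) with (2 := D).
    intros n. eapply Rle_trans; [|apply B].
    eapply Rle_trans; [|apply Rmax_Cmod]. apply Rmax_r.
Qed.

Lemma ip_add_l x y z : ip (hadd x y) z = (ip x z + ip y z)%C.
Proof.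
  apply clim_unique with (1 := ip_lim _ _).
  apply clim_ext with (2 := clim_plus _ _ _ _ (ip_lim x z) (ip_lim y z)).
  intros n. rewrite <- csum_plus. apply csum_ext; intros; simpl; ring.
Qed.

Lemma ip_scal_l c x z : ip (hscal c x) z = (c * ip x z)%C.
Proof.
  apply clim_unique with (1 := ip_lim _ _).
  apply clim_ext with (2 := clim_scal c _ _ (ip_lim x z)).
  intros n. rewrite <- csum_scal. apply csum_ext; intros; simpl; ring.
Qed.

Lemma ip_conj x y : Cconj (ip x y) = ip y x.
Proof.
  apply clim_unique with (2 := ip_lim _ _).
  apply clim_ext with (2 := clim_conj _ _ (ip_lim x y)).
  intros n. rewrite csum_conj. apply csum_ext; intros. rewrite Cmult_conj, Cconj_conj; ring.
Qed.

Lemma ip_add_r x y z : ip z (hadd x y) = (ip z x + ip z y)%C.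
Proof. rewrite <- ip_conj, ip_add_l, Cplus_conj, !ip_conj; auto. Qed.

Lemma ip_scal_r c x z : ip z (hscal c x) = (Cconj c * ip z x)%C.
Proof. rewrite <- ip_conj, ip_scal_l, Cmult_conj, !ip_conj; auto. Qed.

Lemma ip_sub_l x y z : ip (hsub x y) z = (ip x z - ip y z)%C.
Proof. unfold hsub. rewrite ip_add_l, ip_scal_l; ring. Qed.

Lemma Cconj_R (r : R) : Cconj (RtoC r) = RtoC r.
Proof. unfold Cconj; apply injective_projections; simpl; ring. Qed.

Lemma ip_sub_r x y z : ip z (hsub x y) = (ip z x - ip z y)%C.
Proof. rewrite <- ip_conj, ip_sub_l, Cminus_conj, !ip_conj; auto. Qed.

Lemma ip_self x : ip x x = RtoC (hnorm x ^ 2).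
Proof.
  apply clim_unique with (1 := ip_lim _ _).
  apply clim_ext with (fun n => RtoC (sqs n x)).
  - intros; rewrite csum_self; auto.
  - apply clim_Re_Im; simpl; [apply (sqs_lim x (coef_l2 x))|apply is_lim_seq_const].
Qed.

Lemma ip_CS x y : Cmod (ip x y) <= hnorm x * hnorm y.
Proof.
  apply clim_Cmod_le with (1 := ip_lim x y). intros n.
  eapply Rle_trans; [apply csum_CS|]. rewrite nrm_conj.
  apply Rmult_le_compat; auto using nrm_pos; apply nrm_le_norm, coef_l2.
Qed.

Lemma ip_Re_sym x y : Re (ip x y) = Re (ip y x).
Proof. rewrite <- ip_conj, re_conj; auto. Qed.

Lemma hnorm_scal c x : hnorm (hscal c x) = Cmod c * hnorm x.
Proof.
  assert (H : hnorm (hscal c x) ^ 2 = (Cmod c * hnorm x) ^ 2).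
  { apply RtoC_inj. rewrite <- ip_self, ip_scal_l, ip_scal_r, ip_self.
    rewrite Rpow_mult_distr, RtoC_mult.
    replace (RtoC (Cmod c ^ 2)) with (c * Cconj c)%C by (rewrite <- Cmod2_conj; auto). ring. }
  apply Rsqr_inj; [apply hnorm_pos| |rewrite !Rsqr_pow2; auto].
  apply Rmult_le_pos; [apply Cmod_ge_0|apply hnorm_pos].
Qed.

Lemma hnorm_add x y : hnorm (hadd x y) <= hnorm x + hnorm y.
Proof.
  apply norm_le_of_nrm; [apply coef_l2| |].
  - pose proof (hnorm_pos x); pose proof (hnorm_pos y); lra.
  - intros n. eapply Rle_trans; [apply nrm_triangle|].
    apply Rplus_le_compat; apply nrm_le_norm, coef_l2.
Qed.

Lemma hnorm_sub x y : hnorm (hsub x y) <= hnorm x + hnorm y.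
Proof.
  unfold hsub. eapply Rle_trans; [apply hnorm_add|]. rewrite hnorm_scal, Cmod_m1; lra.
Qed.

Lemma hnorm_zero : hnorm hzero = 0.
Proof.
  replace hzero with (hscal (RtoC 0) hzero) by hring.
  rewrite hnorm_scal, Cmod_0; ring.
Qed.

Lemma hnorm_eq0 x : hnorm x = 0 -> x = hzero.
Proof.
  intros H. apply hvec_ext; intros n; simpl. apply Cmod_eq_0.
  assert (sqs (S n) x <= 0).
  { eapply Rle_trans; [apply sqs_le_norm, coef_l2|]. change (l2_norm x) with (hnorm x). rewrite H; lra. }
  unfold sqs in H0; simpl in H0. pose proof (sqs_nonneg n x). unfold sqs in H1; simpl in H1.
  pose proof (Cmod_ge_0 (x n)). nra.
Qed.

Lemma coord_le (x : hvec) n : Cmod (x n) <= hnorm x.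
Proof.
  assert (H : sqs (S n) x <= hnorm x ^ 2) by apply sqs_le_norm, coef_l2.
  unfold sqs in H; cbn [rsum] in H. pose proof (sqs_nonneg n x). unfold sqs in H0.
  apply Rsqr_incr_0_var; [|apply hnorm_pos]. rewrite !Rsqr_pow2. lra.
Qed.

Lemma nrm_trunc_basis n k : nrm n (basis k) <= 1.
Proof.
  unfold nrm. rewrite <- sqrt_1. apply sqrt_le_1_alt.
  assert (H : forall m, (m <= k)%nat -> sqs m (basis k) = 0).
  { intros m Hm. apply rsum_0. intros i Hi. unfold basis.
    rewrite (proj2 (Nat.eqb_neq i k)) by lia. rewrite Cmod_0; ring. }
  assert (H' : forall m, sqs (k + S m) (basis k) = 1).
  { induction m.
    - rewrite Nat.add_1_r. unfold sqs; cbn [rsum]. fold (sqs k (basis k)). rewrite H by lia.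
      unfold basis; rewrite Nat.eqb_refl, Cmod_1; ring.
    - rewrite Nat.add_succ_r. unfold sqs; cbn [rsum]. fold (sqs (k + S m) (basis k)). rewrite IHm.
      unfold basis. rewrite (proj2 (Nat.eqb_neq (k + S m) k)) by lia. rewrite Cmod_0; ring. }
  destruct (Nat.le_gt_cases n k).
  - rewrite H; auto; lra.
  - replace n with (k + S (n - k - 1))%nat by lia. rewrite H'; lra.
Qed.

Definition hbasis (n : nat) : hvec := Hvec (basis n) (l2_of_nrm _ 1 (fun m => nrm_trunc_basis m n)).

Lemma csum_basis J i (f : nat -> C) : (i < J)%nat -> csum J (fun k => f k * basis i k)%C = f i.
Proof.
  intros H. replace J with (i + S (J - S i))%nat by lia. rewrite csum_split.
  rewrite csum_0.
  - rewrite Cplus_0_l. replace (S (J - S i)) with (1 + (J - S i))%nat by lia. rewrite csum_split.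
    rewrite (csum_0 (J - S i)).
    + simpl. rewrite Nat.add_0_r. unfold basis; rewrite Nat.eqb_refl. ring.
    + intros k Hk. unfold basis. rewrite (proj2 (Nat.eqb_neq _ i)) by lia. ring.
  - intros k Hk. unfold basis. rewrite (proj2 (Nat.eqb_neq k i)) by lia. ring.
Qed.

Lemma basis_conj i k : Cconj (basis i k) = basis i k.
Proof. unfold basis. destruct (Nat.eqb k i); apply Cconj_R. Qed.

Lemma clim_loc u v l : (exists N, forall n, (N <= n)%nat -> u n = v n) -> clim u l -> clim v l.
Proof.
  intros [N H] Hu. apply is_lim_seq_ext_loc with (2 := Hu). exists N; intros; rewrite H; auto.
Qed.

Lemma ip_basis_r (x : hvec) i : ip x (hbasis i) = x i.
Proof.
  apply clim_unique with (1 := ip_lim _ _).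
  apply clim_loc with (fun _ => x i); [|apply clim_const].
  exists (S i). intros n Hn. symmetry.
  erewrite csum_ext. apply (csum_basis n i x); lia.
  intros; simpl; rewrite basis_conj; auto.
Qed.

Lemma ip_basis_l (x : hvec) i : ip (hbasis i) x = Cconj (x i).
Proof. rewrite <- ip_conj, ip_basis_r; auto. Qed.

Lemma hbasis_norm i : hnorm (hbasis i) <= 1.
Proof. apply norm_le_of_nrm; [apply coef_l2|lra|]. intros; apply nrm_trunc_basis. Qed.

Fixpoint hsum (n : nat) (f : nat -> hvec) : hvec :=
  match n with O => hzero | S m => hadd (hsum m f) (f m) end.

Lemma hsum_coef n f i : hsum n f i = csum n (fun k => f k i).
Proof. induction n; simpl; auto. rewrite IHn; auto. Qed.

Lemma ip_zero_l x : ip hzero x = RtoC 0.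
Proof. replace hzero with (hscal (RtoC 0) hzero) by hring. rewrite ip_scal_l; ring. Qed.

Lemma ip_hsum_l n f y : ip (hsum n f) y = csum n (fun k => ip (f k) y).
Proof. induction n; simpl. apply ip_zero_l. rewrite ip_add_l, IHn; auto. Qed.

Lemma ip_hsum_r n f y : ip y (hsum n f) = csum n (fun k => ip y (f k)).
Proof.
  rewrite <- ip_conj, ip_hsum_l, csum_conj. apply csum_ext; intros; apply ip_conj.
Qed.

Definition hfin (n : nat) (a : nat -> C) : hvec := hsum n (fun k => hscal (a k) (hbasis k)).

Lemma hfin_coef n a i : hfin n a i = if Nat.ltb i n then a i else RtoC 0.
Proof.
  unfold hfin. rewrite hsum_coef. cbn [coef hscal hbasis].
  destruct (Nat.ltb_spec i n).
  - rewrite <- (csum_basis n i a) by auto. apply csum_ext; intros k Hk.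
    unfold basis. rewrite (Nat.eqb_sym i k). auto.
  - apply csum_0. intros k Hk. unfold basis. rewrite (proj2 (Nat.eqb_neq i k)) by lia. ring.
Qed.

Lemma nrm_trunc n m a : nrm m (fun i => if Nat.ltb i n then a i else RtoC 0) <= nrm n a.
Proof.
  apply sqrt_le_1_alt. destruct (Nat.le_gt_cases m n).
  - apply Rle_trans with (sqs m a).
    + apply rsum_le; intros k Hk. rewrite (proj2 (Nat.ltb_lt k n)) by lia. lra.
    + apply rsum_mono; auto. intros; apply pow2_ge_0.
  - replace m with (n + (m - n))%nat by lia. unfold sqs; rewrite rsum_split.
    rewrite (rsum_0 (m - n)).
    + rewrite Rplus_0_r. apply rsum_le; intros k Hk. rewrite (proj2 (Nat.ltb_lt k n)) by lia. lra.
    + intros k Hk. rewrite (proj2 (Nat.ltb_ge (n + k) n)) by lia. rewrite Cmod_0; ring.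
Qed.

Lemma hfin_norm n a : hnorm (hfin n a) <= nrm n a.
Proof.
  apply norm_le_of_nrm; [apply coef_l2|apply nrm_pos|].
  intros m. eapply Rle_trans; [|apply (nrm_trunc n m a)].
  right; apply nrm_ext; intros; apply hfin_coef.
Qed.

(** The squared norm of the tail is what the partial sums of the squared norm
    of [x] leave out. *)
Lemma hfin_lim (x : hvec) : is_lim_seq (fun n => hnorm (hsub x (hfin n x))) 0.
Proof.
  assert (H : forall n, hnorm (hsub x (hfin n x)) ^ 2 <= hnorm x ^ 2 - sqs n x).
  { intros n.
    apply lim_le_const with (2 := sqs_lim (hsub x (hfin n x)) (coef_l2 _)).
    intros m.
    assert (E : sqs (n + m) (hsub x (hfin n x)) = sqs (n + m) x - sqs n x).
    { unfold sqs. rewrite !rsum_split. rewrite (rsum_0 n).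
      - ring_simplify. apply rsum_ext; intros k Hk.
        replace (hsub x (hfin n x) (n + k)%nat) with (x (n + k)%nat); auto.
        unfold hsub; cbn [coef hadd hscal]. rewrite hfin_coef, (proj2 (Nat.ltb_ge (n + k) n)) by lia. ring.
      - intros k Hk. unfold hsub; cbn [coef hadd hscal].
        rewrite hfin_coef, (proj2 (Nat.ltb_lt k n)) by lia.
        replace (x k + -(1) * x k)%C with (RtoC 0) by ring. rewrite Cmod_0; ring. }
    apply Rle_trans with (sqs (n + m) (hsub x (hfin n x))).
    - apply rsum_mono; [|lia]. intros; apply pow2_ge_0.
    - rewrite E. pose proof (sqs_le_norm x (n + m) (coef_l2 x)). unfold hnorm. lra. }
  apply is_lim_seq_ext with (fun n => sqrt (hnorm (hsub x (hfin n x)) ^ 2)).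
  { intros; rewrite sqrt_pow2; auto using hnorm_pos. }
  replace 0 with (sqrt 0) by apply sqrt_0.
  apply (is_lim_seq_continuous sqrt); [apply continuity_pt_sqrt; lra|].
  apply lim_squeeze0 with (fun n => hnorm x ^ 2 - sqs n x).
  - intros n; split; auto. apply pow2_ge_0.
  - replace 0 with (hnorm x ^ 2 - hnorm x ^ 2) by ring.
    apply is_lim_seq_minus'; [apply is_lim_seq_const|apply (sqs_lim x (coef_l2 x))].
Qed.

(** A norm bound survives a coordinatewise limit, because by duality it is a
    bound on finite linear combinations of the coordinates. *)
Lemma nrm_Fatou (u : nat -> nat -> C) x (v : nat -> R) (b : R) :
  (forall k, clim (fun n => u n k) (x k)) -> is_lim_seq v b -> (forall n m, nrm m (u n) <= v n) ->
  forall m, nrm m x <= b.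
Proof.
  intros Hu Hv H m.
  assert (Hb : 0 <= b).
  { apply (is_lim_seq_le (fun _ => 0) v 0 b); auto using is_lim_seq_const.
    intros n. eapply Rle_trans; [|apply (H n O)]. apply nrm_pos. }
  apply nrm_dual; auto. intros y.
  apply clim_Cmod_le_lim with (fun n => csum m (fun k => u n k * y k)%C) (fun n => v n * nrm m y).
  - clear - Hu. induction m; simpl. apply clim_const.
    apply clim_plus; auto.
    apply clim_ext with (fun n => y m * u n m)%C. intros; ring.
    replace (x m * y m)%C with (y m * x m)%C by ring. apply clim_scal; auto.
  - rewrite Rmult_comm. apply is_lim_seq_ext with (fun n => nrm m y * v n). intros; ring.
    apply is_lim_seq_scal_fin; auto.
  - intros n. eapply Rle_trans; [apply csum_CS|].
    apply Rmult_le_compat_r; auto using nrm_pos.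
Qed.

(** * Bounded operators and strong limits *)

Definition hlim (u : nat -> hvec) (z : hvec) : Prop := is_lim_seq (fun n => hnorm (hsub (u n) z)) 0.

Lemma hsub_norm_sym x y : hnorm (hsub x y) = hnorm (hsub y x).
Proof.
  replace (hsub x y) with (hscal (-(1))%C (hsub y x)) by hring.
  rewrite hnorm_scal, Cmod_m1; ring.
Qed.

Lemma hnorm_sub_tri x y z : hnorm (hsub x z) <= hnorm (hsub x y) + hnorm (hsub y z).
Proof. replace (hsub x z) with (hadd (hsub x y) (hsub y z)) by hring. apply hnorm_add. Qed.

Lemma hlim_unique u x y : hlim u x -> hlim u y -> x = y.
Proof.
  intros Hx Hy.
  assert (H : hnorm (hsub x y) = 0).
  { apply Rle_antisym; [|apply hnorm_pos].
    apply le_plus_lim0 with (2 := lim0_plus _ _ Hx Hy).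
    intros n. rewrite Rplus_0_l. rewrite (hsub_norm_sym (u n) x). apply hnorm_sub_tri. }
  apply hnorm_eq0 in H. replace x with (hadd (hsub x y) y) by hring. rewrite H; hring.
Qed.

Lemma hlim_add u v x y : hlim u x -> hlim v y -> hlim (fun n => hadd (u n) (v n)) (hadd x y).
Proof.
  intros Hx Hy. apply lim_squeeze0 with (2 := lim0_plus _ _ Hx Hy).
  intros n; split; [apply hnorm_pos|].
  replace (hsub (hadd (u n) (v n)) (hadd x y)) with (hadd (hsub (u n) x) (hsub (v n) y)) by hring.
  apply hnorm_add.
Qed.

Lemma hlim_scal c u x : hlim u x -> hlim (fun n => hscal c (u n)) (hscal c x).
Proof.
  intros Hx. apply lim_squeeze0 with (2 := lim0_scal (Cmod c) _ Hx).
  intros n; split; [apply hnorm_pos|].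
  replace (hsub (hscal c (u n)) (hscal c x)) with (hscal c (hsub (u n) x)) by hring.
  rewrite hnorm_scal; lra.
Qed.

Lemma hlim_ext u v x : (forall n, u n = v n) -> hlim u x -> hlim v x.
Proof. intros H Hu. apply is_lim_seq_ext with (2 := Hu). intros; rewrite H; auto. Qed.

Lemma hlim_const x : hlim (fun _ => x) x.
Proof.
  unfold hlim. replace (hsub x x) with hzero by hring. rewrite hnorm_zero. apply is_lim_seq_const.
Qed.

Lemma clim_ip_l u x y : hlim u x -> clim (fun n => ip (u n) y) (ip x y).
Proof.
  intros H. apply lim_squeeze0 with (2 := lim0_scal (hnorm y) _ H).
  intros n; split; [apply Cmod_ge_0|]. rewrite <- ip_sub_l, Rmult_comm. apply ip_CS.
Qed.

Lemma clim_ip_r u x y : hlim u x -> clim (fun n => ip y (u n)) (ip y x).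
Proof.
  intros H. apply lim_squeeze0 with (2 := lim0_scal (hnorm y) _ H).
  intros n; split; [apply Cmod_ge_0|]. rewrite <- ip_sub_r. apply ip_CS.
Qed.

Definition linop (T : hvec -> hvec) : Prop :=
  (forall x y, T (hadd x y) = hadd (T x) (T y)) /\ (forall c x, T (hscal c x) = hscal c (T x)).

Definition opnorm_le (T : hvec -> hvec) (M : R) : Prop := forall x, hnorm (T x) <= M * hnorm x.

Definition selfadj (T : hvec -> hvec) : Prop := forall x y, ip (T x) y = ip x (T y).

Definition pos_op (T : hvec -> hvec) : Prop := selfadj T /\ forall x, 0 <= Re (ip (T x) x).

Lemma linop_sub T x y : linop T -> T (hsub x y) = hsub (T x) (T y).
Proof. intros [A B]; unfold hsub; rewrite A, B; auto. Qed.

Lemma linop_zero T : linop T -> T hzero = hzero.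
Proof.
  intros [A B]. replace hzero with (hscal (RtoC 0) hzero) at 1 by hring. rewrite B. hring.
Qed.

Lemma linop_hsum T n f : linop T -> T (hsum n f) = hsum n (fun k => T (f k)).
Proof.
  intros HT; induction n; simpl; [apply linop_zero; auto|].
  rewrite (proj1 HT), IHn; auto.
Qed.

Lemma hsum_ext n f g : (forall k, (k < n)%nat -> f k = g k) -> hsum n f = hsum n g.
Proof. induction n; intros H; simpl; auto. rewrite IHn, H; auto. Qed.

Lemma linop_hfin T n a : linop T -> T (hfin n a) = hsum n (fun k => hscal (a k) (T (hbasis k))).
Proof.
  intros HT; unfold hfin; rewrite linop_hsum by auto. apply hsum_ext; intros.
  apply (proj2 HT).
Qed.

Lemma hlim_op T M u x : linop T -> opnorm_le T M -> hlim u x -> hlim (fun n => T (u n)) (T x).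
Proof.
  intros HT HM Hu. apply lim_squeeze0 with (2 := lim0_scal M _ Hu).
  intros n; split; [apply hnorm_pos|]. rewrite <- linop_sub; auto.
Qed.

Lemma Re_ip_le x y : Re (ip x y) <= hnorm x * hnorm y.
Proof.
  eapply Rle_trans; [|apply ip_CS]. eapply Rle_trans; [|apply re_le_Cmod]. apply Rle_abs.
Qed.

Lemma Re_ip_self x : Re (ip x x) = hnorm x ^ 2.
Proof. rewrite ip_self; auto. Qed.

Lemma Re_plus a b : Re (a + b)%C = Re a + Re b.
Proof. reflexivity. Qed.
Lemma Re_minus a b : Re (a - b)%C = Re a - Re b.
Proof. reflexivity. Qed.
Lemma Re_scal (r : R) b : Re (RtoC r * b)%C = r * Re b.
Proof. destruct b; unfold Re; simpl; ring. Qed.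

Lemma hnorm_sub_sqr x y : hnorm (hsub x y) ^ 2 = hnorm x ^ 2 - 2 * Re (ip x y) + hnorm y ^ 2.
Proof.
  rewrite <- !Re_ip_self, ip_sub_l, !ip_sub_r, !Re_minus.
  rewrite (ip_Re_sym y x). ring.
Qed.

Lemma hnorm_sqr_le x r : 0 <= r -> hnorm x ^ 2 <= r ^ 2 -> hnorm x <= r.
Proof. intros Hr H. apply Rsqr_incr_0_var; auto. rewrite !Rsqr_pow2; auto. Qed.

(** Expand [0 <= <A y, y>] for [y = x - A x / M]. *)
Lemma pos_op_sqr_le A M x : linop A -> pos_op A -> opnorm_le A M -> 0 < M ->
  hnorm (A x) ^ 2 <= M * Re (ip (A x) x).
Proof.
  intros HA [Hs Hp] HM M0.
  set (r := hnorm (A x) ^ 2). set (a := Re (ip (A x) x)).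
  assert (H := Hp (hsub x (hscal (RtoC (/ M)) (A x)))).
  rewrite linop_sub in H by auto. rewrite (proj2 HA) in H.
  rewrite ip_sub_l, !ip_sub_r, !ip_scal_l, !ip_scal_r, !Cconj_R in H.
  rewrite !Re_minus, !Re_scal in H.
  rewrite (Hs (A x) x) in H. rewrite Re_ip_self in H. fold r a in H.
  assert (Hb : Re (ip (A (A x)) (A x)) <= M * r).
  { eapply Rle_trans; [apply Re_ip_le|]. unfold r. pose proof (HM (A x)). pose proof (hnorm_pos (A x)). nra. }
  set (b := Re (ip (A (A x)) (A x))) in *.
  assert (Hi : 0 < / M) by (apply Rinv_0_lt_compat; auto).
  assert (/ M * (/ M * b) <= / M * r).
  { apply Rmult_le_compat_l; [lra|]. apply Rmult_le_reg_l with M; auto.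
    rewrite <- Rmult_assoc, Rinv_r, Rmult_1_l by lra. auto. }
  assert (/ M * r <= a) by lra.
  apply Rmult_le_reg_l with (/ M); auto. rewrite <- Rmult_assoc, Rinv_l, Rmult_1_l by lra. auto.
Qed.

(** The Cauchy condition is expressed by a convergent real sequence [v]
    that dominates the increments; this also gives the rate of convergence in
    [hvec_complete]. *)
Lemma C_complete (u : nat -> C) (v : nat -> R) (s : R) : is_lim_seq v s ->
  (forall n m, (n <= m)%nat -> Cmod (u m - u n)%C <= v m - v n) -> exists l, clim u l.
Proof.
  intros Hv H.
  assert (E : forall w : nat -> R, (forall n m, (n <= m)%nat -> Rabs (w m - w n) <= v m - v n) ->
              exists l : R, is_lim_seq w l).
  { intros w Hw. apply ex_lim_seq_cauchy_corr.
    assert (Cv : ex_finite_lim_seq v) by (exists s; auto). apply ex_lim_seq_cauchy_corr in Cv.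
    intros eps. destruct (Cv eps) as [N HN]. exists N. intros n m Hn Hm.
    destruct (Nat.le_ge_cases n m).
    - rewrite Rabs_minus_sym. eapply Rle_lt_trans; [apply Hw; auto|].
      eapply Rle_lt_trans; [apply Rle_abs|]. apply HN; auto.
    - eapply Rle_lt_trans; [apply Hw; auto|].
      eapply Rle_lt_trans; [apply Rle_abs|]. apply HN; auto. }
  destruct (E (fun n => Re (u n))) as [a Ha].
  { intros n m L. eapply Rle_trans; [|apply H, L]. rewrite <- Re_minus. apply re_le_Cmod. }
  destruct (E (fun n => Im (u n))) as [b Hb].
  { intros n m L. eapply Rle_trans; [|apply H, L].
    eapply Rle_trans; [|apply Rmax_Cmod]. eapply Rle_trans; [|apply Rmax_r]. right; auto. }
  exists (a, b). apply clim_Re_Im; auto.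
Qed.

Lemma clim_shift u l n : clim u l -> clim (fun m => u (n + m)%nat) l.
Proof.
  intros H. apply is_lim_seq_ext with (fun m => Cmod (u (m + n)%nat - l)%C).
  intros; rewrite Nat.add_comm; auto. apply (is_lim_seq_incr_n (fun m => Cmod (u m - l)%C) n 0); auto.
Qed.

(** The limit is taken in each coordinate; [nrm_Fatou] applied to the
    differences [u m - u n] gives both its summability and the rate. *)
Lemma hvec_complete (u : nat -> hvec) (v : nat -> R) (s : R) : is_lim_seq v s ->
  (forall n m, (n <= m)%nat -> hnorm (hsub (u m) (u n)) <= v m - v n) ->
  exists z, forall n, hnorm (hsub z (u n)) <= s - v n.
Proof.
  intros Hv H.
  assert (Hc : forall k, exists l, clim (fun n => u n k) l).
  { intros k. apply C_complete with v s; auto. intros n m L. eapply Rle_trans; [|apply H, L].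
    replace (u m k - u n k)%C with (hsub (u m) (u n) k) by (unfold hsub; simpl; ring). apply coord_le. }
  pose (zc := fun k => proj1_sig (constructive_indefinite_description _ (Hc k))).
  assert (Hz : forall k, clim (fun n => u n k) (zc k)).
  { intros k. unfold zc. destruct (constructive_indefinite_description _ (Hc k)); auto. }
  assert (F : forall n m, nrm m (fun k => zc k - u n k)%C <= s - v n).
  { intros n. apply nrm_Fatou with (fun m => coef (hsub (u (n + m)%nat) (u n))) (fun m => v (n + m)%nat - v n).
    - intros k. apply clim_ext with (fun m => u (n + m)%nat k + - u n k)%C.
      intros; unfold hsub; simpl; ring.
      replace (zc k - u n k)%C with (zc k + - u n k)%C by ring.
      apply clim_plus; [|apply clim_const]. apply clim_shift with (u := fun n => u n k); auto.
    - apply is_lim_seq_minus'; [|apply is_lim_seq_const].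
      apply is_lim_seq_ext with (fun m => v (m + n)%nat). intros; rewrite Nat.add_comm; auto.
      apply (is_lim_seq_incr_n v n s); auto.
    - intros j m. eapply Rle_trans; [apply nrm_le_norm, coef_l2|]. apply H; lia. }
  assert (L : l2 (fun k => zc k - u O k)%C) by (apply l2_of_nrm with (s - v O); auto).
  exists (hadd (Hvec _ L) (u O)). intros n.
  apply norm_le_of_nrm; [apply coef_l2| |].
  - eapply Rle_trans; [|apply (F n O)]. apply nrm_pos.
  - intros m. eapply Rle_trans; [|apply (F n m)]. right. apply nrm_ext; intros.
    unfold hsub; simpl; ring.
Qed.

(** * Square roots of positive operators *)

(** If [Y] is the limit of this iteration, then [2 Y = Q + Y^2], that is,
    [(1 - Y)^2 = 1 - Q]. *)
Fixpoint sqrt_iter (Q : hvec -> hvec) (n : nat) (x : hvec) : hvec :=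
  match n with
  | O => hzero
  | S m => hscal (RtoC (1/2)) (hadd (Q x) (sqrt_iter Q m (sqrt_iter Q m x)))
  end.

(** The same iteration for the number [1] in the place of [Q]; it majorizes
    the norms and the increments of [sqrt_iter] for every contraction [Q]. *)
Fixpoint sqrt_rate (n : nat) : R :=
  match n with O => 0 | S m => 1/2 * (1 + sqrt_rate m ^ 2) end.

Lemma sqrt_rate_bd n : 0 <= sqrt_rate n <= 1.
Proof. induction n; cbn [sqrt_rate]; nra. Qed.

Lemma sqrt_rate_incr n : sqrt_rate n <= sqrt_rate (S n).
Proof. cbn [sqrt_rate]. pose proof (sqrt_rate_bd n). nra. Qed.

Lemma sqrt_rate_lim : exists s : R, is_lim_seq sqrt_rate s /\ s <= 1.
Proof.
  destruct (ex_finite_lim_seq_incr sqrt_rate 1) as [s Hs].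
  - apply sqrt_rate_incr.
  - intros; apply sqrt_rate_bd.
  - exists s; split; auto. apply lim_le_const with (2 := Hs). intros; apply sqrt_rate_bd.
Qed.

Section SqrtIter.
Context (Q : hvec -> hvec) (HQ : linop Q) (HQs : selfadj Q) (HQ1 : opnorm_le Q 1).

Lemma sqrt_iter_lin n : linop (sqrt_iter Q n).
Proof.
  induction n as [|n [A B]]; split; intros; cbn [sqrt_iter].
  - hring.
  - hring.
  - rewrite (proj1 HQ), !A. hring.
  - rewrite (proj2 HQ), !B. hring.
Qed.

Lemma sqrt_iter_selfadj n : selfadj (sqrt_iter Q n).
Proof.
  induction n; intros x y; cbn [sqrt_iter].
  - rewrite <- (ip_conj hzero x), !ip_zero_l. rewrite Cconj_R; auto.
  - rewrite ip_scal_l, ip_add_l, ip_scal_r, ip_add_r, Cconj_R, HQs, !IHn; auto.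
Qed.

Lemma hnorm_half x : hnorm (hscal (RtoC (1/2)) x) = 1/2 * hnorm x.
Proof. rewrite hnorm_scal, Cmod_R, Rabs_pos_eq; lra. Qed.

Lemma sqrt_iter_norm n x : hnorm (sqrt_iter Q n x) <= sqrt_rate n * hnorm x.
Proof.
  revert x; induction n; intros x; cbn [sqrt_iter sqrt_rate].
  - rewrite hnorm_zero; lra.
  - rewrite hnorm_half.
    pose proof (hnorm_add (Q x) (sqrt_iter Q n (sqrt_iter Q n x))).
    pose proof (HQ1 x). pose proof (IHn x). pose proof (IHn (sqrt_iter Q n x)).
    pose proof (sqrt_rate_bd n).
    assert (sqrt_rate n * hnorm (sqrt_iter Q n x) <= sqrt_rate n * (sqrt_rate n * hnorm x))
      by (apply Rmult_le_compat_l; lra).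
    simpl. nra.
Qed.

(** With [Z = Y_(n+1)] and [Y = Y_n], the difference of squares is
    [Z Z - Y Y = (Z - Y) Z + Y (Z - Y)], so the increments obey the
    recursion of the increments of [sqrt_rate]. *)
Lemma sqrt_iter_step n x :
  hnorm (hsub (sqrt_iter Q (S n) x) (sqrt_iter Q n x)) <= (sqrt_rate (S n) - sqrt_rate n) * hnorm x.
Proof.
  revert x; induction n; intros x.
  - replace (hsub (sqrt_iter Q 1 x) (sqrt_iter Q 0 x)) with (hscal (RtoC (1/2)) (Q x))
      by (cbn [sqrt_iter]; hring).
    rewrite hnorm_half. pose proof (HQ1 x). simpl; lra.
  - set (Y := sqrt_iter Q n). set (Z := sqrt_iter Q (S n)).
    assert (E : hsub (sqrt_iter Q (S (S n)) x) (Z x) =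
                hscal (RtoC (1/2)) (hadd (hsub (Z (Z x)) (Y (Z x))) (Y (hsub (Z x) (Y x))))).
    { rewrite (linop_sub Y _ _ (sqrt_iter_lin n)).
      change (sqrt_iter Q (S (S n)) x) with (hscal (RtoC (1/2)) (hadd (Q x) (Z (Z x)))).
      generalize (Z (Z x)) (Y (Z x)); intros a b.
      change (Z x) with (hscal (RtoC (1/2)) (hadd (Q x) (Y (Y x)))). hring. }
    rewrite E, hnorm_half.
    pose proof (hnorm_add (hsub (Z (Z x)) (Y (Z x))) (Y (hsub (Z x) (Y x)))).
    assert (H1 := IHn (Z x)). assert (H2 := IHn x). fold Y Z in H1, H2.
    assert (H3 := sqrt_iter_norm n (hsub (Z x) (Y x))). fold Y in H3.
    assert (H4 := sqrt_iter_norm (S n) x). fold Z in H4.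
    pose proof (sqrt_rate_bd n) as B. pose proof (sqrt_rate_incr n) as I.
    pose proof (hnorm_pos x) as X.
    assert (H5 : (sqrt_rate (S n) - sqrt_rate n) * hnorm (Z x) <=
                 (sqrt_rate (S n) - sqrt_rate n) * (sqrt_rate (S n) * hnorm x))
      by (apply Rmult_le_compat_l; lra).
    assert (H6 : sqrt_rate n * hnorm (hsub (Z x) (Y x)) <=
                 sqrt_rate n * ((sqrt_rate (S n) - sqrt_rate n) * hnorm x))
      by (apply Rmult_le_compat_l; lra).
    replace ((sqrt_rate (S (S n)) - sqrt_rate (S n)) * hnorm x) with
      (1/2 * ((sqrt_rate (S n) - sqrt_rate n) * (sqrt_rate (S n) * hnorm x) +
              sqrt_rate n * ((sqrt_rate (S n) - sqrt_rate n) * hnorm x))).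
    + apply Rmult_le_compat_l; lra.
    + cbn [sqrt_rate]. field.
Qed.

Lemma sqrt_iter_cauchy n m x : (n <= m)%nat ->
  hnorm (hsub (sqrt_iter Q m x) (sqrt_iter Q n x)) <= hnorm x * sqrt_rate m - hnorm x * sqrt_rate n.
Proof.
  induction 1.
  - replace (hsub (sqrt_iter Q n x) (sqrt_iter Q n x)) with hzero by hring. rewrite hnorm_zero; lra.
  - eapply Rle_trans; [apply (hnorm_sub_tri _ (sqrt_iter Q m x))|].
    pose proof (sqrt_iter_step m x). lra.
Qed.

Lemma sqrt_iter_limit : exists Y, linop Y /\ selfadj Y /\ opnorm_le Y 1 /\
  forall x, hadd (Y x) (Y x) = hadd (Q x) (Y (Y x)).
Proof.
  destruct sqrt_rate_lim as [s [Hs Hs1]].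
  assert (E : forall x, exists z, forall n,
            hnorm (hsub z (sqrt_iter Q n x)) <= (s - sqrt_rate n) * hnorm x).
  { intros x. destruct (hvec_complete (fun n => sqrt_iter Q n x) (fun n => hnorm x * sqrt_rate n) (hnorm x * s))
      as [z Hz].
    - apply is_lim_seq_scal_fin; auto.
    - intros; apply sqrt_iter_cauchy; auto.
    - exists z; intros n. specialize (Hz n). simpl in Hz; lra. }
  pose (Y := fun x => proj1_sig (constructive_indefinite_description _ (E x))).
  assert (HY : forall x n, hnorm (hsub (Y x) (sqrt_iter Q n x)) <= (s - sqrt_rate n) * hnorm x).
  { intros x. unfold Y. destruct (constructive_indefinite_description _ (E x)); auto. }
  assert (R0 : is_lim_seq (fun n => s - sqrt_rate n) 0).
  { replace 0 with (s - s) by ring. apply is_lim_seq_minus'; auto using is_lim_seq_const. }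
  assert (HL : forall x, hlim (fun n => sqrt_iter Q n x) (Y x)).
  { intros x. apply lim_squeeze0 with (2 := lim0_scal (hnorm x) _ R0).
    intros n; split; [apply hnorm_pos|]. rewrite hsub_norm_sym, Rmult_comm; auto. }
  assert (LY : linop Y).
  { split; intros.
    - apply hlim_unique with (1 := HL _). eapply hlim_ext; [|apply hlim_add; apply HL].
      intros; simpl; rewrite (proj1 (sqrt_iter_lin n)); auto.
    - apply hlim_unique with (1 := HL _). eapply hlim_ext; [|apply hlim_scal; apply HL].
      intros; simpl; rewrite (proj2 (sqrt_iter_lin n)); auto. }
  assert (SY : selfadj Y).
  { intros x y. apply clim_unique with (1 := clim_ip_l _ _ y (HL x)).
    eapply clim_ext; [|apply (clim_ip_r _ _ x (HL y))]. intros; simpl; symmetry; apply sqrt_iter_selfadj. }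
  assert (NY : opnorm_le Y 1).
  { intros x. rewrite Rmult_1_l.
    apply le_plus_lim0 with (fun n => hnorm (hsub (Y x) (sqrt_iter Q n x))).
    - intros n. replace (Y x) with (hadd (sqrt_iter Q n x) (hsub (Y x) (sqrt_iter Q n x))) at 1 by hring.
      eapply Rle_trans; [apply hnorm_add|]. pose proof (sqrt_iter_norm n x).
      pose proof (sqrt_rate_bd n). pose proof (hnorm_pos x). nra.
    - eapply is_lim_seq_ext; [|apply (HL x)]. intros; apply hsub_norm_sym. }
  exists Y; repeat split; auto; try apply LY.
  intros x.
  apply hlim_unique with (fun n => hadd (sqrt_iter Q (S n) x) (sqrt_iter Q (S n) x)).
  - assert (T : hlim (fun n => sqrt_iter Q (S n) x) (Y x)).
    { apply is_lim_seq_incr_1 with (u := fun n => hnorm (hsub (sqrt_iter Q n x) (Y x))), HL. }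
    apply hlim_add; apply T.
  - apply hlim_ext with (fun n => hadd (Q x) (sqrt_iter Q n (sqrt_iter Q n x))).
    { intros n. apply hvec_ext; intros k; cbn [sqrt_iter coef hadd hscal].
      replace (RtoC (1/2)) with (/ RtoC 2)%C by (rewrite <- RtoC_inv; f_equal; lra). field. }
    apply hlim_add; [apply hlim_const|].
    apply lim_squeeze0 with (fun n => hnorm x * (s - sqrt_rate n) + hnorm (Y x) * (s - sqrt_rate n)).
    + intros n; split; [apply hnorm_pos|].
      eapply Rle_trans; [apply (hnorm_sub_tri _ (sqrt_iter Q n (Y x)))|].
      apply Rplus_le_compat.
      * rewrite <- (linop_sub _ _ _ (sqrt_iter_lin n)).
        eapply Rle_trans; [apply sqrt_iter_norm|].
        pose proof (HY x n). rewrite hsub_norm_sym in H. pose proof (sqrt_rate_bd n).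
        pose proof (hnorm_pos (hsub (sqrt_iter Q n x) (Y x))). nra.
      * rewrite hsub_norm_sym, Rmult_comm; apply HY.
    + apply lim0_plus; apply lim0_scal; auto.
Qed.

End SqrtIter.

(** For [Q = 1 - A / M], a contraction because [0 <= A <= M], the square root
    is [sqrt M (1 - Y)] with [(1 - Y)^2 = 1 - Q]. *)
Lemma pos_op_sqrt A M : linop A -> pos_op A -> opnorm_le A M -> 0 < M ->
  exists P, linop P /\ pos_op P /\ opnorm_le P (2 * sqrt M) /\ forall x, P (P x) = A x.
Proof.
  intros HA HP HM M0.
  pose (Q := fun x => hsub x (hscal (RtoC (/ M)) (A x))).
  assert (I0 : 0 < / M) by (apply Rinv_0_lt_compat; auto).
  assert (LQ : linop Q).
  { split; intros; unfold Q.
    - rewrite (proj1 HA). hring.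
    - rewrite (proj2 HA). hring. }
  assert (SQ : selfadj Q).
  { intros x y. unfold Q. rewrite ip_sub_l, ip_sub_r, ip_scal_l, ip_scal_r, Cconj_R, (proj1 HP); auto. }
  assert (NQ : opnorm_le Q 1).
  { intros x. rewrite Rmult_1_l. apply hnorm_sqr_le; [apply hnorm_pos|].
    unfold Q. rewrite hnorm_sub_sqr, ip_scal_r, Cconj_R, Re_scal, hnorm_scal, Rpow_mult_distr, Cmod_R.
    rewrite Rabs_pos_eq by lra.
    pose proof (pos_op_sqr_le A M x HA HP HM M0) as H. rewrite <- ip_Re_sym.
    pose proof (proj2 HP x) as H0.
    assert (/ M ^ 2 * hnorm (A x) ^ 2 <= / M * Re (ip (A x) x)).
    { replace (/ M * Re (ip (A x) x)) with (/ M ^ 2 * (M * Re (ip (A x) x))) by (field; lra).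
      apply Rmult_le_compat_l; auto. apply Rlt_le, Rinv_0_lt_compat, pow_lt; auto. }
    rewrite pow_inv. assert (0 <= / M * Re (ip (A x) x)) by (apply Rmult_le_pos; lra). lra. }
  destruct (sqrt_iter_limit Q LQ SQ NQ) as [Y [LY [SY [NY HY]]]].
  pose (c := RtoC (sqrt M)).
  exists (fun x => hscal c (hsub x (Y x))). split; [|split; [split|split]].
  - split; intros.
    + rewrite (proj1 LY). hring.
    + rewrite (proj2 LY). hring.
  - intros x y. unfold c. rewrite ip_scal_l, ip_scal_r, Cconj_R, ip_sub_l, ip_sub_r, SY; auto.
  - intros x. unfold c. rewrite ip_scal_l, Re_scal, ip_sub_l, Re_minus, Re_ip_self.
    apply Rmult_le_pos; [apply sqrt_pos|].
    pose proof (Re_ip_le (Y x) x). pose proof (NY x). pose proof (hnorm_pos x). nra.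
  - intros x. unfold c. rewrite hnorm_scal, Cmod_R, Rabs_pos_eq by apply sqrt_pos.
    pose proof (hnorm_sub x (Y x)). pose proof (NY x). pose proof (sqrt_pos M). nra.
  - intros x.
    assert (E : hsub (hsub x (Y x)) (Y (hsub x (Y x))) = hscal (RtoC (/ M)) (A x)).
    { rewrite linop_sub by auto.
      replace (hsub (hsub x (Y x)) (hsub (Y x) (Y (Y x)))) with (hsub (hadd x (Y (Y x))) (hadd (Y x) (Y x))) by hring.
      rewrite HY. unfold Q. hring. }
    rewrite (proj2 LY).
    replace (hsub (hscal c (hsub x (Y x))) (hscal c (Y (hsub x (Y x))))) with
      (hscal c (hsub (hsub x (Y x)) (Y (hsub x (Y x))))) by hring.
    rewrite E. apply hvec_ext; intros k; cbn [coef hscal].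
    rewrite !Cmult_assoc. unfold c. rewrite <- !RtoC_mult, sqrt_sqrt, Rinv_r by lra. ring.
Qed.

(** * Positive operators with sum one *)

Section Partition.
Context (p Q : hvec -> hvec) (Hp : linop p) (Pp : pos_op p)
  (HQ : forall x, Q x = hsub x (p x)) (PQ : forall x, 0 <= Re (ip (Q x) x)).

Definition pw (n : nat) (x : hvec) : hvec := Nat.iter n Q x.
(** A partial sum of the Neumann series of the inverse of [p = 1 - Q]. *)
Definition geo (n : nat) (x : hvec) : hvec := hsum n (fun k => pw k x).

Lemma Q_lin : linop Q.
Proof. split; intros; rewrite !HQ; [rewrite (proj1 Hp)|rewrite (proj2 Hp)]; hring. Qed.

Lemma Q_selfadj : selfadj Q.
Proof. intros x y. rewrite !HQ, ip_sub_l, ip_sub_r, (proj1 Pp); auto. Qed.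

Lemma p_Q x : p (Q x) = Q (p x).
Proof. rewrite !HQ, linop_sub by auto. auto. Qed.

Lemma pw_S n x : pw (S n) x = Q (pw n x).
Proof. reflexivity. Qed.

Lemma pw_add m n x : pw (m + n) x = pw m (pw n x).
Proof. unfold pw. rewrite Nat.iter_add; auto. Qed.

Lemma pw_lin n : linop (pw n).
Proof.
  induction n as [|n [A B]]; split; intros; auto; rewrite !pw_S.
  - rewrite A. apply (proj1 Q_lin).
  - rewrite B. apply (proj2 Q_lin).
Qed.

Lemma p_pw n x : p (pw n x) = pw n (p x).
Proof. induction n; auto. rewrite !pw_S, p_Q, IHn; auto. Qed.

Lemma pw_selfadj n : selfadj (pw n).
Proof.
  induction n; intros x y; auto. rewrite pw_S, Q_selfadj, IHn.
  f_equal. change (Q y) with (pw 1 y). rewrite <- pw_add, Nat.add_1_r. auto.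
Qed.

(** Since [p + Q = 1] and [p], [Q] commute, [p Q = p Q p + Q p Q]. *)
Lemma pQ_pos x : 0 <= Re (ip (p (Q x)) x).
Proof.
  assert (E : ip (p (Q x)) x = (ip (Q (p x)) (p x) + ip (p (Q x)) (Q x))%C).
  { rewrite p_Q, <- ip_add_r. f_equal. rewrite HQ. hring. }
  rewrite E, Re_plus. apply Rplus_le_le_0_compat; auto. apply Pp.
Qed.

(** For even [n = 2 m] the operator [A Q^n] is [Q^m A Q^m]; for odd [n] it is
    [Q^m (A Q) Q^m]. *)
Lemma sandwich_pos (A : hvec -> hvec) n x : (forall m y, A (pw m y) = pw m (A y)) ->
  (forall y, 0 <= Re (ip (A y) y)) -> (forall y, 0 <= Re (ip (A (Q y)) y)) ->
  0 <= Re (ip (A (pw n x)) x).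
Proof.
  intros HA A0 A1. destruct (Nat.Even_or_Odd n) as [[m ->]|[m ->]].
  - replace (2 * m)%nat with (m + m)%nat by lia. rewrite pw_add, HA, pw_selfadj. apply A0.
  - replace (2 * m + 1)%nat with (m + (1 + m))%nat by lia. rewrite pw_add, HA, pw_selfadj, pw_add.
    apply A1.
Qed.

Lemma pw_pos n x : 0 <= Re (ip (pw n x) x).
Proof.
  apply (sandwich_pos (fun y => y)); auto. intros; rewrite Re_ip_self; apply pow2_ge_0.
Qed.

Lemma p_pw_pos n x : 0 <= Re (ip (p (pw n x)) x).
Proof. apply sandwich_pos; auto using pQ_pos, p_pw. apply Pp. Qed.

Lemma pw_telescope n x : p (geo n x) = hsub x (pw n x).
Proof.
  unfold geo. rewrite linop_hsum by auto. induction n; simpl.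
  - unfold pw; simpl. hring.
  - rewrite IHn. unfold pw; simpl. fold (pw n x). rewrite (HQ (pw n x)). hring.
Qed.

Lemma p_pw_decr n x : Re (ip (p (pw (S n) x)) x) <= Re (ip (p (pw n x)) x).
Proof.
  assert (E : ip (p (pw n x)) x = (ip (p (pw (S n) x)) x + ip (pw n (p x)) (p x))%C).
  { rewrite pw_S, HQ, linop_sub, ip_sub_l by auto. rewrite <- (p_pw n x), (proj1 Pp (p (pw n x)) x). ring. }
  rewrite E, Re_plus. pose proof (pw_pos n (p x)). lra.
Qed.

(** The numbers [<p Q^k x, x>] decrease in [k], and for [k < n] they add up to
    [<(1 - Q^n) x, x> <= |x|^2]. *)
Lemma p_pw_le n x : INR n * Re (ip (p (pw n x)) x) <= hnorm x ^ 2.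
Proof.
  assert (H : INR n * Re (ip (p (pw n x)) x) <= hnorm x ^ 2 - Re (ip (pw n x) x)).
  { induction n.
    - change (pw 0 x) with x. rewrite Re_ip_self. simpl INR; lra.
    - rewrite S_INR. pose proof (p_pw_decr n x). pose proof (pos_INR n).
      assert (INR n * Re (ip (p (pw (S n) x)) x) <= INR n * Re (ip (p (pw n x)) x))
        by (apply Rmult_le_compat_l; auto).
      assert (Re (ip (pw (S n) x) x) = Re (ip (pw n x) x) - Re (ip (p (pw n x)) x)).
      { rewrite pw_S, HQ, ip_sub_l, Re_minus; auto. }
      lra. }
  pose proof (pw_pos n x). lra.
Qed.

(** Here [|p Q^n x|^2 = <p^2 Q^(2n) x, x>], and [p^2 = p - p Q]. *)
Lemma p_pw_norm n x : hnorm (p (pw n x)) ^ 2 <= Re (ip (p (pw (n + n) x)) x).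
Proof.
  rewrite <- Re_ip_self.
  assert (E : ip (p (pw n x)) (p (pw n x)) = (ip (p (pw (n + n) x)) x - ip (p (pw (S (n + n)) x)) x)%C).
  { rewrite pw_S, HQ, linop_sub, ip_sub_l by auto.
    rewrite (p_pw n x) at 2. rewrite <- pw_selfadj, <- (proj1 Pp), <- p_pw, <- pw_add. ring. }
  rewrite E, Re_minus. pose proof (p_pw_pos (S (n + n)) x). lra.
Qed.

Lemma p_pw_lim x : is_lim_seq (fun n => hnorm (p (pw n x))) 0.
Proof.
  apply is_lim_seq_ext with (fun n => sqrt (hnorm (p (pw n x)) ^ 2)).
  { intros; rewrite sqrt_pow2; auto using hnorm_pos. }
  replace 0 with (sqrt 0) by apply sqrt_0.
  apply (is_lim_seq_continuous sqrt); [apply continuity_pt_sqrt; lra|].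
  apply is_lim_seq_incr_1.
  apply lim_squeeze0 with (fun n => hnorm x ^ 2 * / INR (S n)).
  - intros n; split; [apply pow2_ge_0|]. eapply Rle_trans; [apply p_pw_norm|].
    pose proof (p_pw_le (S n + S n) x) as H. pose proof (p_pw_pos (S n + S n) x) as H0.
    rewrite plus_INR in H. pose proof (lt_0_INR (S n) ltac:(lia)) as H1.
    apply Rmult_le_reg_r with (INR (S n)); auto. rewrite Rmult_assoc, Rinv_l, Rmult_1_r by lra.
    nra.
  - apply lim0_scal. apply (is_lim_seq_incr_1 (fun n => / INR n)).
    apply (is_lim_seq_inv INR p_infty is_lim_seq_INR). discriminate.
Qed.

Lemma pw_decr_add n m x : Re (ip (pw (n + m) x) x) <= Re (ip (pw n x) x).
Proof.
  induction m.
  - rewrite Nat.add_0_r; lra.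
  - rewrite Nat.add_succ_r, pw_S, HQ, ip_sub_l, Re_minus. pose proof (p_pw_pos (n + m) x). lra.
Qed.

(** Expanding the square, this says [<Q^(2n) x, x> <= 2 <Q^n x, x>]. *)
Lemma one_minus_pw_norm n x : hnorm (hsub x (pw n x)) <= hnorm x.
Proof.
  apply hnorm_sqr_le; [apply hnorm_pos|]. rewrite hnorm_sub_sqr, (ip_Re_sym x).
  assert (E : hnorm (pw n x) ^ 2 = Re (ip (pw (n + n) x) x)).
  { rewrite <- Re_ip_self, pw_add, (pw_selfadj n (pw n x) x); auto. }
  rewrite E.
  pose proof (pw_decr_add n n x). pose proof (pw_pos n x). lra.
Qed.

Lemma geo_selfadj n : selfadj (geo n).
Proof.
  intros x y. unfold geo. rewrite ip_hsum_l, ip_hsum_r. apply csum_ext; intros; apply pw_selfadj.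
Qed.

Lemma geo_lin n : linop (geo n).
Proof.
  unfold geo; split; intros; induction n; cbn [hsum]; try hring.
  - rewrite IHn, (proj1 (pw_lin n)). hring.
  - rewrite IHn, (proj2 (pw_lin n)). hring.
Qed.

End Partition.

(** * Approximate polar decomposition *)

(** The polar decomposition [T = U P] without kernels and partial isometries.
    With [p = P / M] and [Q = 1 - p], the operator [U_n] is
    [T (1 + Q + ... + Q^(n-1)) / M], where the sum approximates the inverse of
    [p]; it is a contraction because [|T x| = |P x|] turns its norm into that
    of [1 - Q^n].  The errors are governed by [D_n = Q^n], and [P Q^n] tends
    strongly to zero. *)
Lemma polar_approx T S P M : linop T -> linop S -> (forall x y, ip (T x) y = ip x (S y)) ->
  linop P -> pos_op P -> opnorm_le P M -> 0 < M -> (forall x, P (P x) = S (T x)) ->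
  exists U V D : nat -> hvec -> hvec,
    (forall n, linop (U n)) /\
    (forall n, opnorm_le (U n) 1) /\
    (forall n x y, ip (U n x) y = ip x (V n y)) /\
    (forall n x, T x = hadd (U n (P x)) (T (D n x))) /\
    (forall n x y, ip (P x) y = (ip (T x) (U n y) + ip (P (D n x)) y)%C) /\
    (forall n x, hnorm (T (D n x)) = hnorm (P (D n x))) /\
    (forall x, is_lim_seq (fun n => hnorm (P (D n x))) 0).
Proof.
  intros HT HS Had HP PP NP M0 Habs.
  assert (I0 : 0 < / M) by (apply Rinv_0_lt_compat; auto).
  pose (c := RtoC (/ M)).
  assert (cc : Cconj c = c) by apply Cconj_R.
  pose (p := fun x => hscal c (P x)).
  pose (Q := fun x => hsub x (p x)).
  assert (Hp : linop p).
  { unfold p; split; intros; [rewrite (proj1 HP)|rewrite (proj2 HP)]; hring. }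
  assert (Pp : pos_op p).
  { split; [intros x y|intros x]; unfold p.
    - rewrite ip_scal_l, ip_scal_r, cc, (proj1 PP); auto.
    - rewrite ip_scal_l; unfold c; rewrite Re_scal. apply Rmult_le_pos; [lra|apply PP]. }
  assert (PQ : forall x, 0 <= Re (ip (Q x) x)).
  { intros x. unfold Q, p. rewrite ip_sub_l, ip_scal_l, Re_minus, Re_ip_self. unfold c; rewrite Re_scal.
    pose proof (Re_ip_le (P x) x). pose proof (NP x). pose proof (hnorm_pos x).
    assert (Re (ip (P x) x) <= M * hnorm x ^ 2) by nra.
    assert (/ M * Re (ip (P x) x) <= / M * (M * hnorm x ^ 2)) by (apply Rmult_le_compat_l; lra).
    rewrite <- Rmult_assoc, Rinv_l in H3 by lra. lra. }
  assert (HQ : forall x, Q x = hsub x (p x)) by reflexivity.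
  assert (NT : forall x, hnorm (T x) = hnorm (P x)).
  { intros x. assert (hnorm (T x) ^ 2 = hnorm (P x) ^ 2).
    { rewrite <- !Re_ip_self, Had, <- Habs, <- (proj1 PP). auto. }
    apply Rsqr_inj; auto using hnorm_pos. rewrite !Rsqr_pow2; auto. }
  assert (PD : forall n x, P (pw Q n x) = pw Q n (P x)).
  { induction n; intros x; auto. rewrite !pw_S, <- IHn. unfold Q, p.
    rewrite linop_sub, (proj2 HP) by auto. auto. }
  assert (geoP : forall n x, P (geo Q n x) = geo Q n (P x)).
  { intros n x. unfold geo. rewrite linop_hsum by auto. apply hsum_ext; auto. }
  pose (U := fun n x => hscal c (T (geo Q n x))).
  pose (V := fun n y => hscal c (geo Q n (S y))).
  assert (UV : forall n x y, ip (U n x) y = ip x (V n y)).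
  { intros n x y. unfold U, V. rewrite ip_scal_l, ip_scal_r, cc, Had, (geo_selfadj p Q Pp HQ n); auto. }
  assert (NU : forall n, opnorm_le (U n) 1).
  { intros n x. rewrite Rmult_1_l. unfold U. rewrite hnorm_scal, NT, <- hnorm_scal.
    change (hscal c (P (geo Q n x))) with (p (geo Q n x)).
    rewrite (pw_telescope p Q Hp HQ n x). apply (one_minus_pw_norm p Q Hp Pp HQ PQ). }
  exists U, V, (pw Q).
  split; [|split; [|split; [|split; [|split; [|split]]]]]; auto.
  - intros n. unfold U. pose proof (geo_lin p Q Hp HQ n) as [A B].
    split; intros; [rewrite A, (proj1 HT)|rewrite B, (proj2 HT)]; hring.
  - intros n x. unfold U. rewrite <- geoP, <- (proj2 HT).
    change (hscal c (P (geo Q n x))) with (p (geo Q n x)).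
    rewrite (pw_telescope p Q Hp HQ n x), linop_sub by auto. hring.
  - intros n x y. unfold U. rewrite <- (proj2 HT), Had, <- Habs, <- (proj1 PP), (proj2 HP).
    change (hscal c (P (geo Q n y))) with (p (geo Q n y)).
    rewrite (pw_telescope p Q Hp HQ n y), ip_sub_r, PD, (pw_selfadj p Q Pp HQ n). ring.
  - intros x. apply is_lim_seq_ext with (fun n => M * hnorm (p (pw Q n x))).
    + intros n. unfold p. rewrite hnorm_scal. unfold c. rewrite Cmod_R, Rabs_pos_eq by lra. field; lra.
    + apply lim0_scal, (p_pw_lim p Q Hp Pp HQ PQ).
Qed.

Lemma dual_trace_bound_scaled A kappa J G c : dual_trace_bound A kappa -> 0 <= c ->
  opbound J G c -> Cmod (pairing J A G) <= c * kappa.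
Proof.
  intros HA Hc HG. pose proof (dual_trace_bound_pos _ _ HA).
  apply Rle_plus_epsilon. intros eps He.
  assert (0 < eps / (kappa + 1)) by (apply Rdiv_lt_0_compat; lra).
  eapply Rle_trans; [apply (dual_trace_bound_scaled_pos A kappa J G (c + eps / (kappa + 1)))|]; auto.
  - lra.
  - apply opbound_mono with c; auto; lra.
  - assert (eps / (kappa + 1) * kappa <= eps).
    { apply Rmult_le_reg_r with (kappa + 1); [lra|]. field_simplify; nra. }
    nra.
Qed.

Lemma pairing_rank_one J x y u v : pairing J (fun i j => x i * y j)%C (fun i j => u i * v j)%C =
  (csum J (fun i => x i * u i) * csum J (fun j => y j * v j))%C.
Proof.
  unfold pairing. rewrite <- csum_scal_r. apply csum_ext; intros i _.
  rewrite <- csum_scal. apply csum_ext; intros; ring.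
Qed.

(** This makes the dual norm dominate the operator norm
    ([dual_trace_bound_opbound]). *)
Lemma opbound_rank_one J x y : opbound J (fun i j => x i * y j)%C (nrm J x * nrm J y).
Proof.
  intros u v. rewrite pairing_rank_one, Cmod_mult.
  replace (nrm J x * nrm J y * (nrm J u * nrm J v)) with
    ((nrm J x * nrm J u) * (nrm J y * nrm J v)) by ring.
  apply Rmult_le_compat; auto using Cmod_ge_0, csum_CS.
Qed.

Lemma dual_trace_bound_opbound A kappa J : dual_trace_bound A kappa -> opbound J A kappa.
Proof.
  intros HA x y. rewrite Rmult_comm. apply dual_trace_bound_scaled; auto.
  - apply Rmult_le_pos; apply nrm_pos.
  - apply opbound_rank_one.
Qed.

Lemma csum_trunc n J (f : nat -> C) : (n <= J)%nat ->
  csum J (fun k => if Nat.ltb k n then f k else RtoC 0) = csum n f.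
Proof.
  intros L. replace J with (n + (J - n))%nat by lia. rewrite csum_split, (csum_0 (J - n)).
  - rewrite Cplus_0_r. apply csum_ext; intros k Hk. rewrite (proj2 (Nat.ltb_lt k n)) by lia; auto.
  - intros k Hk. rewrite (proj2 (Nat.ltb_ge (n + k) n)) by lia; auto.
Qed.

(** * Trace class matrices by duality *)

(** A rectangle is completed to a square by zeros. *)
Lemma opbound_rect A kappa m n x y : 0 <= kappa -> (forall J, opbound J A kappa) ->
  Cmod (csum m (fun i => csum n (fun j => A i j * (x i * y j))))%C <= kappa * (nrm m x * nrm n y).
Proof.
  intros Hk HA. set (J := Nat.max m n).
  pose (x' := fun i => if Nat.ltb i m then x i else RtoC 0).
  pose (y' := fun i => if Nat.ltb i n then y i else RtoC 0).
  replace (csum m (fun i => csum n (fun j => A i j * (x i * y j))))%C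
    with (pairing J A (fun i j => x' i * y' j)%C).
  - eapply Rle_trans; [apply HA|]. apply Rmult_le_compat_l; auto.
    apply Rmult_le_compat; auto using nrm_pos; apply nrm_trunc.
  - unfold pairing. rewrite <- (csum_trunc m J) by lia. apply csum_ext; intros i _.
    unfold x'. destruct (Nat.ltb i m).
    + rewrite <- (csum_trunc n J) by lia. apply csum_ext; intros j _.
      unfold y'. destruct (Nat.ltb j n); ring.
    + apply csum_0; intros; ring.
Qed.

(** The operator acts by pairing with the rows; they are square-summable, and
    the image is, by the finite bounds and [nrm_Fatou]. *)
Lemma matrix_operator A kappa : 0 <= kappa -> (forall J, opbound J A kappa) ->
  exists T, linop T /\ opnorm_le T kappa /\
    (forall i j, T (hbasis j) i = A i j) /\
    (forall i, exists r : hvec, (forall j, r j = Cconj (A i j)) /\ forall x, T x i = ip x r).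
Proof.
  intros Hk HA.
  assert (Lr : forall i, l2 (fun j => Cconj (A i j))).
  { intros i. apply l2_of_nrm with kappa. intros n. rewrite (nrm_conj n (A i)).
    apply nrm_dual; auto. intros y.
    replace (csum n (fun k => A i k * y k)%C) with
      (csum (S i) (fun i0 => csum n (fun j => A i0 j * (basis i i0 * y j))))%C.
    - eapply Rle_trans; [apply (opbound_rect A kappa (S i) n (basis i) y Hk HA)|].
      apply Rmult_le_compat_l; auto. pose proof (nrm_trunc_basis (S i) i).
      pose proof (nrm_pos n y). nra.
    - rewrite <- (csum_basis (S i) i (fun i0 => csum n (fun k => A i0 k * y k)%C)) by lia.
      apply csum_ext; intros k _. rewrite <- csum_scal_r. apply csum_ext; intros; ring. }
  pose (row := fun i => Hvec _ (Lr i)).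
  assert (B : forall x m, nrm m (fun i => ip x (row i)) <= kappa * hnorm x).
  { intros x. apply nrm_Fatou with (fun n i => csum n (fun j => x j * A i j)%C) (fun _ => kappa * hnorm x).
    - intros i. eapply clim_ext; [|apply ip_lim]. intros n; simpl. apply csum_ext; intros.
      rewrite Cconj_conj; auto.
    - apply is_lim_seq_const.
    - intros n m. assert (H0 : 0 <= kappa * hnorm x) by (apply Rmult_le_pos; auto using hnorm_pos).
      apply nrm_dual; auto. intros y.
      replace (csum m (fun k => csum n (fun j => x j * A k j) * y k))%C with
        (csum m (fun i => csum n (fun j => A i j * (y i * x j))))%C.
      + eapply Rle_trans; [apply (opbound_rect A kappa m n y x Hk HA)|].
        pose proof (nrm_le_norm x n (coef_l2 x)). fold (hnorm x) in H.
        pose proof (nrm_pos m y). cbv beta. rewrite Rmult_assoc. apply Rmult_le_compat_l; auto. nra.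
      + apply csum_ext; intros i _. rewrite <- csum_scal_r. apply csum_ext; intros; ring. }
  pose (T := fun x => Hvec (fun i => ip x (row i)) (l2_of_nrm _ _ (B x))).
  exists T. split; [|split; [|split]].
  - split; intros; apply hvec_ext; intros i; simpl; [apply ip_add_l|apply ip_scal_l].
  - intros x. apply norm_le_of_nrm; [apply coef_l2| |apply B].
    apply Rmult_le_pos; auto using hnorm_pos.
  - intros i j. simpl. rewrite ip_basis_l. simpl. apply Cconj_conj.
  - intros i. exists (row i). split; auto.
Qed.

Lemma pairing_adj J A x y : pairing J (fun i j => Cconj (A j i)) (fun i j => x i * y j)%C =
  Cconj (pairing J A (fun i j => Cconj (y i) * Cconj (x j))%C).
Proof.
  unfold pairing. rewrite csum_conj, csum_swap. apply csum_ext; intros i _.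
  rewrite csum_conj. apply csum_ext; intros j _. rewrite !Cmult_conj, !Cconj_conj. ring.
Qed.

Lemma opbound_adj J A kappa : opbound J A kappa -> opbound J (fun i j => Cconj (A j i)) kappa.
Proof.
  intros HA x y. rewrite pairing_adj, Cmod_conj. eapply Rle_trans; [apply HA|].
  rewrite !nrm_conj. right; ring.
Qed.

(** The adjoint comes from the adjoint matrix.  The identity
    [<T x, y> = <x, S y>] holds for basis vectors [y], hence for their
    combinations, hence for all [y] by density. *)
Lemma matrix_operator_adj A kappa : 0 <= kappa -> (forall J, opbound J A kappa) ->
  exists T S, linop T /\ linop S /\ opnorm_le T kappa /\ opnorm_le S kappa /\
    (forall i j, ip (T (hbasis j)) (hbasis i) = A i j) /\
    (forall x y, ip (T x) y = ip x (S y)).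
Proof.
  intros Hk HA.
  destruct (matrix_operator A kappa Hk HA) as [T [LT [NT [ET RT]]]].
  destruct (matrix_operator _ kappa Hk (fun J => opbound_adj J A kappa (HA J))) as [S [LS [NS [ES RS]]]].
  exists T, S. do 4 (split; auto). split.
  - intros; rewrite ip_basis_r; auto.
  - intros x y.
    assert (E : forall i, ip (T x) (hbasis i) = ip x (S (hbasis i))).
    { intros i. rewrite ip_basis_r. destruct (RT i) as [r [Hr Hx]]. rewrite Hx. f_equal.
      apply hvec_ext; intros k. rewrite Hr, ES; auto. }
    assert (L : hlim (fun n => hfin n y) y).
    { eapply is_lim_seq_ext; [|apply (hfin_lim y)]. intros; apply hsub_norm_sym. }
    apply clim_unique with (1 := clim_ip_r _ _ (T x) L).
    eapply clim_ext; [|apply (clim_ip_r _ _ x (hlim_op S kappa _ _ LS NS L))].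
    intros n. simpl. rewrite linop_hfin by auto. unfold hfin. rewrite !ip_hsum_r.
    apply csum_ext; intros k _. rewrite !ip_scal_r, E; auto.
Qed.

Lemma rsum_sqs_lim J (h : nat -> hvec) :
  is_lim_seq (fun n => rsum J (fun j => sqs n (h j))) (rsum J (fun j => hnorm (h j) ^ 2)).
Proof.
  induction J; cbn [rsum]; [apply is_lim_seq_const|].
  apply is_lim_seq_plus_fin; auto. apply (sqs_lim (h J) (coef_l2 _)).
Qed.

(** The numbers on the left are the coordinates of the image of [z] under the
    transpose of [G]. *)
Lemma opbound_Bessel J G (z : hvec) : opbound J G 1 ->
  rsum J (fun j => Cmod (ip z (hfin J (fun i => Cconj (G i j)))) ^ 2) <= hnorm z ^ 2.
Proof.
  intros HG.
  apply Rle_trans with (sqs J (fun j => csum J (fun i => G i j * z i)%C)).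
  - right. apply rsum_ext; intros j _. f_equal. f_equal. unfold hfin. rewrite ip_hsum_r.
    apply csum_ext; intros i _. rewrite ip_scal_r, Cconj_conj, ip_basis_r; auto.
  - rewrite <- nrm_sqr. apply pow_incr; split; [apply nrm_pos|].
    eapply Rle_trans; [|apply (nrm_le_norm z J (coef_l2 z))].
    apply nrm_dual; [apply nrm_pos|]. intros y.
    replace (csum J (fun j => csum J (fun i => G i j * z i) * y j))%C with
      (pairing J G (fun i j => z i * y j)%C).
    + pose proof (HG z y). lra.
    + unfold pairing. rewrite csum_swap. apply csum_ext; intros j _.
      rewrite <- csum_scal_r. apply csum_ext; intros; ring.
Qed.

(** Let [W] be the square root of [P].  Up to an error that tends to zero, the
    pairing is [sum_j <U_n P e_j, g_j> = sum_j <W e_j, W V_n g_j>] where the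
    [g_j] are the conjugate columns of [G].  By Cauchy-Schwarz it is enough to
    bound two Hilbert-Schmidt norms.  That of [W] is the trace of [P]; in the
    other one, moving [W V_n] to the side of the basis vectors shows that the
    contractions [U_n] and [G] do not increase it. *)
Lemma trace_class_dual T S P M tau : linop T -> linop S -> (forall x y, ip (T x) y = ip x (S y)) ->
  linop P -> pos_op P -> opnorm_le P M -> 0 < M -> (forall x, P (P x) = S (T x)) ->
  (forall J, rsum J (fun j => Re (ip (P (hbasis j)) (hbasis j))) <= tau) ->
  dual_trace_bound (fun i j => ip (T (hbasis j)) (hbasis i)) tau.
Proof.
  intros LT LS Had LP PP NP M0 Habs Htr J G HG.
  destruct (polar_approx T S P M LT LS Had LP PP NP M0 Habs)
    as [U [V [D [_ [NU [UV [HT [_ [HD Hlim]]]]]]]]].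
  destruct (pos_op_sqrt P M LP PP NP M0) as [W [LW [PW [_ WW]]]].
  pose (g := fun j => hfin J (fun i => Cconj (G i j))).
  assert (tau0 : 0 <= tau) by apply (Htr O).
  assert (HW : forall J, rsum J (fun j => hnorm (W (hbasis j)) ^ 2) <= tau).
  { intros I. eapply Rle_trans; [|apply (Htr I)]. right; apply rsum_ext; intros j _.
    rewrite <- Re_ip_self, <- (proj1 PW), WW; auto. }
  assert (E : pairing J (fun i j => ip (T (hbasis j)) (hbasis i)) G = csum J (fun j => ip (T (hbasis j)) (g j))).
  { unfold pairing. rewrite csum_swap. apply csum_ext; intros j _. unfold g, hfin.
    rewrite ip_hsum_r. apply csum_ext; intros i _. rewrite ip_scal_r, Cconj_conj; ring. }
  rewrite E.
  apply le_plus_lim0 with (fun n => rsum J (fun j => hnorm (g j) * hnorm (P (D n (hbasis j))))).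
  - intros n.
    rewrite (csum_ext _ _ (fun j => ip (W (hbasis j)) (W (V n (g j))) + ip (T (D n (hbasis j))) (g j))%C).
    2:{ intros j _. rewrite (HT n) at 1. rewrite ip_add_l, UV, <- (proj1 PW), WW. auto. }
    rewrite csum_plus. eapply Rle_trans; [apply Cmod_triangle|]. apply Rplus_le_compat.
    + eapply Rle_trans; [apply csum_Cmod|].
      apply Rle_trans with (rsum J (fun j => hnorm (W (hbasis j)) * hnorm (W (V n (g j))))).
      { apply rsum_le; intros; apply ip_CS. }
      rewrite <- (sqrt_sqrt tau) by auto.
      apply rsum_CS_le; try (intros; apply hnorm_pos); try apply sqrt_pos;
        rewrite <- Rsqr_pow2, Rsqr_sqrt by auto; auto.
      apply lim_le_const with (2 := rsum_sqs_lim J (fun j => W (V n (g j)))).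
      intros I. unfold sqs. rewrite rsum_swap.
      eapply Rle_trans; [|apply (HW I)]. apply rsum_le; intros i _.
      apply Rle_trans with (hnorm (U n (W (hbasis i))) ^ 2).
      * eapply Rle_trans; [|apply (opbound_Bessel J G); auto].
        right; apply rsum_ext; intros j _. f_equal.
        rewrite <- ip_basis_r, (proj1 PW), <- ip_conj, Cmod_conj, <- UV. auto.
      * apply pow_incr; split; [apply hnorm_pos|]. pose proof (NU n (W (hbasis i))). lra.
    + eapply Rle_trans; [apply csum_Cmod|]. apply rsum_le; intros j _.
      eapply Rle_trans; [apply ip_CS|]. rewrite HD. right; ring.
  - clear E HG. induction J; cbn [rsum]; [apply is_lim_seq_const|].
    apply lim0_plus; [|apply lim0_scal; auto].
    assert (F : forall m, is_lim_seq (fun n => rsum m (fun j => hnorm (g j) * hnorm (P (D n (hbasis j))))) 0).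
    { induction m; cbn [rsum]; [apply is_lim_seq_const|]. apply lim0_plus; auto. apply lim0_scal; auto. }
    apply F.
Qed.

(** By [polar_approx] the trace of [P] is, up to an error that tends to zero,
    [sum_j <T e_j, U_n e_j>], a pairing of [A] with the conjugate of the matrix
    of the contraction [U_n]. *)
Lemma dual_trace_abs T S P M A kappa : linop T -> linop S -> (forall x y, ip (T x) y = ip x (S y)) ->
  linop P -> pos_op P -> opnorm_le P M -> 0 < M -> (forall x, P (P x) = S (T x)) ->
  (forall i j, ip (T (hbasis j)) (hbasis i) = A i j) -> dual_trace_bound A kappa ->
  forall J, rsum J (fun j => Re (ip (P (hbasis j)) (hbasis j))) <= kappa.
Proof.
  intros LT LS Had LP PP NP M0 Habs HA HK J.
  destruct (polar_approx T S P M LT LS Had LP PP NP M0 Habs)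
    as [U [V [D [LU [NU [_ [_ [HP [_ Hlim]]]]]]]]].
  apply le_plus_lim0 with (fun n => rsum J (fun j => hnorm (P (D n (hbasis j))))).
  - intros n.
    rewrite (rsum_ext _ _ (fun j => Re (ip (T (hbasis j)) (U n (hbasis j))) + Re (ip (P (D n (hbasis j))) (hbasis j)))).
    2:{ intros j _. rewrite (HP n). apply Re_plus. }
    rewrite rsum_plus. apply Rplus_le_compat.
    + rewrite <- Re_csum. eapply Rle_trans; [apply Rle_abs|]. eapply Rle_trans; [apply re_le_Cmod|].
      assert (L : clim (fun I => csum J (fun j => csum (J + I) (fun i => T (hbasis j) i * Cconj (U n (hbasis j) i))%C))
                   (csum J (fun j => ip (T (hbasis j)) (U n (hbasis j))))).
      { assert (F : forall m, clim (fun I => csum m (fun j => csum (J + I) (fun i => T (hbasis j) i * Cconj (U n (hbasis j) i))%C))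
                   (csum m (fun j => ip (T (hbasis j)) (U n (hbasis j))))).
        { induction m; cbn [csum]; [apply clim_const|]. apply clim_plus; auto.
          apply (clim_shift (fun I => csum I (fun i => T (hbasis m) i * Cconj (U n (hbasis m) i))%C)), ip_lim. }
        apply F. }
      apply clim_Cmod_le with (1 := L). intros I.
      pose (G := fun i j => if Nat.ltb j J then Cconj (U n (hbasis j) i) else RtoC 0).
      replace (csum J _) with (pairing (J + I) A G).
      * apply HK. intros x y. rewrite Rmult_1_l.
        pose (z := U n (hfin J (fun j => Cconj (y j)))).
        replace (pairing (J + I) G (fun i j => x i * y j)%C) with
          (csum (J + I) (fun i => x i * Cconj (z i))%C).
        -- eapply Rle_trans; [apply csum_CS|]. rewrite nrm_conj.
           apply Rmult_le_compat_l; [apply nrm_pos|].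
           eapply Rle_trans; [apply nrm_le_norm, coef_l2|]. fold (hnorm z).
           eapply Rle_trans; [apply NU|]. rewrite Rmult_1_l.
           eapply Rle_trans; [apply hfin_norm|]. rewrite nrm_conj.
           apply sqrt_le_1_alt, rsum_mono; [intros; apply pow2_ge_0|lia].
        -- unfold pairing. apply csum_ext; intros i _. unfold z. rewrite linop_hfin by auto.
           rewrite hsum_coef. rewrite csum_conj, <- csum_scal, <- (csum_trunc J (J + I)) by lia.
           apply csum_ext; intros j _. unfold G. destruct (Nat.ltb j J); cbn [coef hscal].
           ++ rewrite Cmult_conj, Cconj_conj; ring.
           ++ ring.
      * unfold pairing. rewrite csum_swap, <- (csum_trunc J (J + I)) by lia.
        apply csum_ext; intros j _. unfold G. destruct (Nat.ltb j J).
        -- apply csum_ext; intros i _. rewrite <- HA, ip_basis_r; auto.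
        -- apply csum_0; intros; ring.
    + apply rsum_le; intros j _. eapply Rle_trans; [apply Re_ip_le|].
      pose proof (hbasis_norm j). pose proof (hnorm_pos (P (D n (hbasis j)))). nra.
  - assert (F : forall m, is_lim_seq (fun n => rsum m (fun j => hnorm (P (D n (hbasis j))))) 0).
    { induction m; cbn [rsum]; [apply is_lim_seq_const|]. apply lim0_plus; auto. }
    apply F.
Qed.

Lemma bounded_operator_lift T : bounded_operator T -> exists T' : hvec -> hvec,
  (forall x, coef (T' x) = T (coef x)) /\ linop T' /\ exists M, 0 < M /\ opnorm_le T' M.
Proof.
  intros [H1 [H2 [M HM]]].
  exists (fun x : hvec => Hvec (T x) (H1 x (coef_l2 x))). split; [|split].
  - intros x; reflexivity.
  - split; intros; apply hvec_ext; intros n; cbn [coef hadd hscal].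
    + rewrite <- (Cmult_1_l (T x n)), <- (Cmult_1_l (T y n)). rewrite <- H2 by apply coef_l2.
      f_equal. f_equal. apply functional_extensionality; intros; ring.
    + replace (c * T x n)%C with (c * T x n + RtoC 0 * T x n)%C by ring.
      rewrite <- H2 by apply coef_l2.
      f_equal. f_equal. apply functional_extensionality; intros; ring.
  - exists (Rabs M + 1). split; [pose proof (Rabs_pos M); lra|].
    intros x. eapply Rle_trans; [apply (HM x (coef_l2 x))|]. fold (hnorm x).
    pose proof (hnorm_pos x). pose proof (Rle_abs M). nra.
Qed.

Definition lower (U : hvec -> hvec) (x : nat -> C) : nat -> C :=
  match excluded_middle_informative (l2 x) with
  | left h => coef (U (Hvec x h))
  | right _ => fun _ => RtoC 0
  end.

Lemma lower_coef U (x : hvec) : lower U x = coef (U x).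
Proof.
  unfold lower. destruct (excluded_middle_informative (l2 x)) as [h|h].
  - f_equal. f_equal. apply hvec_ext; auto.
  - destruct (h (coef_l2 x)).
Qed.

Lemma lower_bounded U M : linop U -> opnorm_le U M -> bounded_operator (lower U).
Proof.
  intros LU NU. split; [|split].
  - intros x hx. change (l2 (lower U (Hvec x hx))). rewrite lower_coef. apply coef_l2.
  - intros a b x y hx hy n.
    pose (X := Hvec x hx). pose (Y := Hvec y hy).
    change (lower U (hadd (hscal a X) (hscal b Y)) n = (a * lower U X n + b * lower U Y n)%C).
    rewrite !lower_coef, (proj1 LU), !(proj2 LU). reflexivity.
  - exists M. intros x hx. change (l2_norm (lower U (Hvec x hx)) <= M * hnorm (Hvec x hx)). rewrite lower_coef. apply NU.
Qed.

Lemma lower_inner U (x y : hvec) : inner (lower U x) y = ip (U x) y.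
Proof. rewrite lower_coef; auto. Qed.

(** Polarization: test the form at [x + y] and at [x + i y]. *)
Lemma pos_op_of_form P : linop P -> (forall x, Im (ip (P x) x) = 0 /\ 0 <= Re (ip (P x) x)) -> pos_op P.
Proof.
  intros LP H. split; [|intros; apply H].
  intros x y.
  assert (E1 := proj1 (H (hadd x y))). assert (E2 := proj1 (H (hadd x (hscal Ci y)))).
  assert (Ex := proj1 (H x)). assert (Ey := proj1 (H y)).
  rewrite (proj1 LP), ip_add_l, !ip_add_r in E1.
  rewrite (proj1 LP), (proj2 LP), ip_add_l, !ip_add_r, !ip_scal_l, !ip_scal_r in E2.
  rewrite <- (ip_conj (P y) x).
  destruct (ip (P x) x) as [a1 a2]. destruct (ip (P y) y) as [b1 b2].
  destruct (ip (P x) y) as [c1 c2]. destruct (ip (P y) x) as [d1 d2].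
  clear H. unfold Im, Re, Cconj, Ci, Cmult, Cplus in *; simpl in *. apply injective_projections; simpl; lra.
Qed.

(** The two directions are [trace_class_dual] and, after the construction of
    the operator and of its absolute value, [dual_trace_abs]. *)
Theorem S1_matrix_iff_dual A : S1_matrix A <-> exists kappa, dual_trace_bound A kappa.
Proof.
  split.
  - intros [T0 [[BT [P0 [[[BP PosP] [S0 [[BS Had]  Habs]]] Htr]]] HA]].
    destruct (bounded_operator_lift T0 BT) as [T [ET [LT _]]].
    destruct (bounded_operator_lift S0 BS) as [S [ES [LS _]]].
    destruct (bounded_operator_lift P0 BP) as [P [EP [LP [M [M0 NP]]]]].
    assert (PP : pos_op P).
    { apply pos_op_of_form; auto. intros x. unfold ip. rewrite EP. apply PosP, coef_l2. }
    exists (Series (fun n => Re (inner (P0 (basis n)) (basis n)))).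
    intros J G HG.
    erewrite pairing_ext; [apply (trace_class_dual T S P M) with (J := J) (G := G); auto|].
    + intros x y. unfold ip. rewrite ET, ES. apply Had; apply coef_l2.
    + intros x. apply hvec_ext; intros n. rewrite !ES, !ET, !EP. apply Habs, coef_l2.
    + intros I. rewrite (rsum_ext _ _ (fun n => Re (inner (P0 (basis n)) (basis n)))).
      * apply rsum_le_Series; auto. intros n. apply (PosP (basis n) (coef_l2 (hbasis n))).
      * intros j _. unfold ip. rewrite EP. auto.
    + intros i j _ _. simpl. rewrite HA. unfold ip. rewrite ET. auto.
  - intros [kappa HK]. pose proof (dual_trace_bound_pos _ _ HK) as K0.
    destruct (matrix_operator_adj A kappa K0 (fun J => dual_trace_bound_opbound A kappa J HK))
      as [T [S [LT [LS [NT [NS [EA Had]]]]]]].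
    assert (LST : linop (fun x => S (T x))).
    { split; intros; [rewrite (proj1 LT), (proj1 LS)|rewrite (proj2 LT), (proj2 LS)]; auto. }
    assert (PST : pos_op (fun x => S (T x))).
    { split.
      - intros x y. rewrite <- Had, <- (ip_conj y), <- Had, ip_conj; auto.
      - intros x. rewrite <- (ip_conj x), <- Had, re_conj, Re_ip_self. apply pow2_ge_0. }
    assert (NST : opnorm_le (fun x => S (T x)) (kappa * kappa + 1)).
    { intros x. eapply Rle_trans; [apply NS|]. pose proof (NT x). pose proof (hnorm_pos x). nra. }
    destruct (pos_op_sqrt _ (kappa * kappa + 1) LST PST NST ltac:(nra)) as [P [LP [PP [NP HP]]]].
    set (M := 2 * sqrt (kappa * kappa + 1)) in *.
    assert (M0 : 0 < M) by (apply Rmult_lt_0_compat; [lra|apply sqrt_lt_R0; nra]).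
    exists (lower T). split; [split|].
    + apply lower_bounded with kappa; auto.
    + exists (lower P). split; [split; [split|]|].
      * apply lower_bounded with M; auto.
      * intros x hx. pose (X := Hvec x hx). change x with (coef X). rewrite lower_inner.
        split; [|apply PP].
        assert (C := ip_conj (P X) X). rewrite <- (proj1 PP) in C.
        destruct (ip (P X) X) as [a b]. unfold Cconj in C; simpl in *. injection C; intros. lra.
      * exists (lower S). split; [split|].
        -- apply lower_bounded with kappa; auto.
        -- intros x y hx hy. pose (X := Hvec x hx). pose (Y := Hvec y hy).
           change (inner (lower T X) Y = inner X (lower S Y)). rewrite !lower_coef. apply Had.
        -- intros x hx n. pose (X := Hvec x hx).
           change (lower P (lower P X) n = lower S (lower T X) n). rewrite !lower_coef, HP; auto.
      * apply ex_series_bounded with kappa.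
        -- intros n. change (0 <= Re (inner (lower P (hbasis n)) (hbasis n))). rewrite lower_inner. apply PP.
        -- intros n. erewrite rsum_ext; [apply (dual_trace_abs T S P M A kappa); auto|].
           intros k _. change (basis k) with (coef (hbasis k)). rewrite lower_inner; auto.
    + intros i j. change (A i j = inner (lower T (hbasis j)) (hbasis i)). rewrite lower_inner; auto.
Qed.

(** * Continuous functions on the circle *)

Definition rcont (f : R -> R) : Prop := forall t : R, continuous f t.

Lemma rcont_const c : rcont (fun _ => c).
Proof. intros t; apply continuous_const. Qed.

Lemma rcont_plus f g : rcont f -> rcont g -> rcont (fun t => f t + g t).
Proof. intros Hf Hg t. apply (continuous_plus f g t); auto. Qed.

Lemma rcont_mult f g : rcont f -> rcont g -> rcont (fun t => f t * g t).
Proof. intros Hf Hg t. apply (continuous_mult f g t); auto. Qed.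

Lemma rcont_opp f : rcont f -> rcont (fun t => - f t).
Proof. intros Hf t. apply (continuous_opp f t); auto. Qed.

Lemma rcont_ext f g : (forall t, f t = g t) -> rcont f -> rcont g.
Proof. intros E H t. apply (continuous_ext f g t); auto. Qed.

Lemma rcont_shift f s : rcont f -> rcont (fun t => f (t + s)).
Proof.
  intros Hf t. apply (continuous_comp (fun t => t + s) f t); auto.
  apply (continuous_plus (fun t => t) (fun _ => s) t).
  apply continuous_id. apply continuous_const.
Qed.

Lemma rcont_rsum n f : (forall k, rcont (f k)) -> rcont (fun t => rsum n (fun k => f k t)).
Proof. intros H; induction n; simpl; auto using rcont_const, rcont_plus. Qed.

Lemma rcont_int f a b : rcont f -> ex_RInt f a b.
Proof. intros H. apply (ex_RInt_continuous (V := R_CompleteNormedModule) f a b); intros; apply H. Qed.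

Definition expi (t : R) : C := (cos t, sin t).

(** Continuity on the unit circle only, in the parametrization that
    [L1_torus_norm] integrates. *)
Definition tcont (f : C -> C) : Prop :=
  rcont (fun t => Re (f (expi t))) /\ rcont (fun t => Im (f (expi t))).

Lemma tcont_const c : tcont (fun _ => c).
Proof. split; apply rcont_const. Qed.

Lemma tcont_id : tcont (fun z => z).
Proof.
  split; intros t; simpl; [apply continuous_cos|apply continuous_sin].
Qed.

Lemma tcont_plus f g : tcont f -> tcont g -> tcont (fun z => f z + g z)%C.
Proof. intros [A B] [A' B']; split; simpl; apply rcont_plus; auto. Qed.

Lemma tcont_mult f g : tcont f -> tcont g -> tcont (fun z => f z * g z)%C.
Proof.
  intros [A B] [A' B']; split; simpl; unfold Rminus;
    repeat first [apply rcont_plus|apply rcont_opp|apply rcont_mult]; auto.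
Qed.

Lemma tcont_csum n f : (forall k, tcont (f k)) -> tcont (fun z => csum n (fun k => f k z)).
Proof. intros H; induction n; simpl; auto using tcont_const, tcont_plus. Qed.

Lemma tcont_pow n : tcont (fun z => Cpow z n).
Proof. induction n; simpl. apply tcont_const. apply tcont_mult; auto using tcont_id. Qed.

Lemma tcont_Cmod f : tcont f -> rcont (fun t => Cmod (f (expi t))).
Proof.
  intros [A B] t. unfold Cmod. apply continuous_sqrt_comp.
  apply (continuous_plus (fun t => fst (f (expi t)) ^ 2) (fun t => snd (f (expi t)) ^ 2) t).
  - apply (rcont_ext (fun t => Re (f (expi t)) * Re (f (expi t)))).
    + intros; unfold Re; ring.
    + apply rcont_mult; auto.
  - apply (rcont_ext (fun t => Im (f (expi t)) * Im (f (expi t)))).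
    + intros; unfold Im; ring.
    + apply rcont_mult; auto.
Qed.

Lemma twoPI_pos : 0 < 2 * PI.
Proof. pose proof PI_RGT_0; lra. Qed.

Lemma inv_twoPI_pos : 0 < / (2 * PI).
Proof. apply Rinv_0_lt_compat, twoPI_pos. Qed.

Lemma L1_pos f : tcont f -> 0 <= L1_torus_norm f.
Proof.
  intros H. apply Rmult_le_pos. apply Rlt_le, inv_twoPI_pos.
  apply RInt_ge_0.
  - apply Rlt_le, twoPI_pos.
  - apply rcont_int, (tcont_Cmod f H).
  - intros; apply Cmod_ge_0.
Qed.

Lemma L1_ext f g : (forall z, f z = g z) -> L1_torus_norm f = L1_torus_norm g.
Proof. intros H. unfold L1_torus_norm. f_equal. apply RInt_ext. intros; rewrite H; auto. Qed.

Lemma L1_add_le f g : tcont f -> tcont g ->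
  L1_torus_norm (fun z => f z + g z)%C <= L1_torus_norm f + L1_torus_norm g.
Proof.
  intros Hf Hg. unfold L1_torus_norm. rewrite <- Rmult_plus_distr_l.
  apply Rmult_le_compat_l. apply Rlt_le, inv_twoPI_pos.
  change (RInt (fun t => Cmod (f (expi t) + g (expi t))%C) 0 (2 * PI) <=
    plus (RInt (fun t => Cmod (f (expi t))) 0 (2 * PI)) (RInt (fun t => Cmod (g (expi t))) 0 (2 * PI))).
  rewrite <- RInt_plus by (apply rcont_int, tcont_Cmod; auto).
  apply RInt_le.
  - apply Rlt_le, twoPI_pos.
  - apply rcont_int, (tcont_Cmod (fun z => f z + g z)%C); apply tcont_plus; auto.
  - apply (rcont_int (fun t => Cmod (f (expi t)) + Cmod (g (expi t)))). apply rcont_plus; apply tcont_Cmod; auto.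
  - intros; apply Cmod_triangle.
Qed.

Lemma L1_scal c f : tcont f -> L1_torus_norm (fun z => c * f z)%C = Cmod c * L1_torus_norm f.
Proof.
  intros Hf. unfold L1_torus_norm.
  pose proof (RInt_scal (V := R_CompleteNormedModule) (fun t => Cmod (f (expi t))) 0 (2 * PI) (Cmod c)
    (rcont_int _ _ _ (tcont_Cmod f Hf))) as H.
  rewrite (RInt_ext _ (fun t => Cmod c * Cmod (f (expi t)))) by (intros; apply Cmod_mult).
  change (/ (2 * PI) * RInt (fun t => scal (Cmod c) (Cmod (f (expi t)) : R_CompleteNormedModule)) 0 (2 * PI) =
    Cmod c * (/ (2 * PI) * RInt (fun t => Cmod (f (expi t))) 0 (2 * PI))).
  rewrite H. unfold scal; simpl; unfold mult; simpl. ring.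
Qed.

(** * Averages over rotated roots of unity *)

Lemma RInt_shift F a b s : rcont F -> RInt (fun t => F (t + s)) a b = RInt F (a + s) (b + s).
Proof.
  intros HF. pose proof (RInt_comp_lin (V := R_CompleteNormedModule) F 1 s a b) as H.
  rewrite !Rmult_1_l in H. rewrite <- H by (apply rcont_int; auto).
  apply RInt_ext. intros; unfold scal; simpl; unfold mult; simpl. rewrite !Rmult_1_l; auto.
Qed.

Lemma RInt_periodic F s : rcont F -> (forall t, F (t + 2 * PI) = F t) ->
  RInt (fun t => F (t + s)) 0 (2 * PI) = RInt F 0 (2 * PI).
Proof.
  intros HF HP. rewrite RInt_shift by auto. rewrite Rplus_0_l.
  rewrite <- (RInt_Chasles F s 0) by (apply rcont_int; auto).
  rewrite <- (RInt_Chasles F 0 (2 * PI)) by (apply rcont_int; auto).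
  assert (E : RInt F (2 * PI) (2 * PI + s) = RInt F 0 s).
  { pose proof (RInt_shift F 0 s (2 * PI) HF) as H. rewrite Rplus_0_l, (Rplus_comm s) in H. rewrite <- H.
    apply RInt_ext; intros; apply HP. }
  rewrite E. rewrite <- (opp_RInt_swap F 0 s) by (apply rcont_int; auto).
  unfold plus, opp; simpl. ring.
Qed.

Lemma RInt_rsum n (f : nat -> R -> R) a b : (forall k, rcont (f k)) ->
  RInt (fun t => rsum n (fun k => f k t)) a b = rsum n (fun k => RInt (f k) a b).
Proof.
  intros H; induction n; simpl.
  - rewrite RInt_const. unfold scal; simpl; unfold mult; simpl; ring.
  - rewrite <- IHn. apply (RInt_plus (fun t => rsum n (fun k => f k t)) (f n)); apply rcont_int; auto using rcont_rsum.
Qed.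

Lemma expi_periodic t : expi (t + 2 * PI) = expi t.
Proof.
  unfold expi. replace (t + 2 * PI) with (t + 2 * INR 1 * PI) by (simpl; ring).
  rewrite cos_period, sin_period; auto.
Qed.

(** The [M]-th roots of unity, rotated by the angle [theta]. *)
Definition node (M : nat) (theta : R) (r : nat) : C := expi (theta + 2 * PI * INR r / INR M).

(** By periodicity each term of the average has the same integral. *)
Lemma average_integral M f : tcont f -> (0 < M)%nat ->
  RInt (fun t => rsum M (fun r => Cmod (f (node M t r)))) 0 (2 * PI) = INR M * (2 * PI) * L1_torus_norm f.
Proof.
  intros Hf HM. pose proof (tcont_Cmod f Hf) as Hc.
  unfold node. rewrite (RInt_rsum M (fun r t => Cmod (f (expi (t + 2 * PI * INR r / INR M))))).
  - rewrite (rsum_ext _ _ (fun _ => RInt (fun t => Cmod (f (expi t))) 0 (2 * PI))).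
    + rewrite rsum_const. unfold L1_torus_norm. change (fun t => Cmod (f (cos t, sin t))) with (fun t => Cmod (f (expi t))).
      match goal with |- ?a = ?b => change (@eq R a b) end.
      field. pose proof PI_RGT_0; lra.
    + intros r _. apply (RInt_periodic (fun t => Cmod (f (expi t)))); auto.
      intros; rewrite expi_periodic; auto.
  - intros r. apply (rcont_shift (fun t => Cmod (f (expi t)))); auto.
Qed.

Lemma average_cont M f : tcont f -> rcont (fun t => rsum M (fun r => Cmod (f (node M t r)))).
Proof.
  intros Hf. apply (rcont_rsum M (fun r t => Cmod (f (node M t r)))). intros r.
  apply (rcont_shift (fun t => Cmod (f (expi t)))), tcont_Cmod, Hf.
Qed.

(** Otherwise the mean over all rotations would exceed itself. *)
Lemma average_le M f : tcont f -> (0 < M)%nat ->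
  exists theta, rsum M (fun r => Cmod (f (node M theta r))) <= INR M * L1_torus_norm f.
Proof.
  intros Hf HM. apply NNPP. intros N.
  assert (H : forall t, INR M * L1_torus_norm f < rsum M (fun r => Cmod (f (node M t r)))).
  { intros t. apply Rnot_le_lt. intros H. apply N. exists t; auto. }
  assert (RInt (fun _ => INR M * L1_torus_norm f) 0 (2 * PI) < INR M * (2 * PI) * L1_torus_norm f).
  { rewrite <- average_integral by auto. apply RInt_lt; auto using twoPI_pos.
    - intros; apply average_cont; auto.
    - intros; apply continuous_const. }
  rewrite RInt_const in H0. unfold scal in H0; simpl in H0; unfold mult in H0; simpl in H0. lra.
Qed.

Lemma average_ge M f : tcont f -> (0 < M)%nat ->
  exists theta, INR M * L1_torus_norm f <= rsum M (fun r => Cmod (f (node M theta r))).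
Proof.
  intros Hf HM. apply NNPP. intros N.
  assert (H : forall t, rsum M (fun r => Cmod (f (node M t r))) < INR M * L1_torus_norm f).
  { intros t. apply Rnot_le_lt. intros H. apply N. exists t; auto. }
  assert (INR M * (2 * PI) * L1_torus_norm f < RInt (fun _ => INR M * L1_torus_norm f) 0 (2 * PI)).
  { rewrite <- average_integral by auto. apply RInt_lt; auto using twoPI_pos.
    - intros; apply continuous_const.
    - intros; apply average_cont; auto. }
  rewrite RInt_const in H0. unfold scal in H0; simpl in H0; unfold mult in H0; simpl in H0. lra.
Qed.

(** * Discrete Fourier analysis *)

Lemma expi_add s t : expi (s + t) = (expi s * expi t)%C.
Proof. unfold expi, Cmult; simpl. rewrite cos_plus, sin_plus. f_equal; ring. Qed.

Lemma expi_0 : expi 0 = RtoC 1.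
Proof. unfold expi. rewrite cos_0, sin_0; auto. Qed.

Lemma expi_conj t : Cconj (expi t) = expi (- t).
Proof. unfold expi, Cconj; simpl. rewrite cos_neg, sin_neg; auto. Qed.

Lemma Cmod_expi t : Cmod (expi t) = 1.
Proof.
  unfold Cmod, expi; simpl fst; simpl snd. rewrite <- sqrt_1. f_equal.
  pose proof (sin2_cos2 t). unfold Rsqr in H. lra.
Qed.

Lemma expi_pow t k : Cpow (expi t) k = expi (INR k * t).
Proof.
  induction k.
  - simpl. rewrite Rmult_0_l, expi_0; auto.
  - rewrite S_INR. simpl Cpow. rewrite IHk, <- expi_add. f_equal; ring.
Qed.

Lemma expi_2PI_nat k : expi (2 * PI * INR k) = RtoC 1.
Proof.
  unfold expi. replace (2 * PI * INR k) with (0 + 2 * INR k * PI) by ring.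
  rewrite cos_period, sin_period, cos_0, sin_0; auto.
Qed.

Lemma expi_neq_1 x : 0 < x < 2 * PI -> expi x <> RtoC 1.
Proof.
  intros Hx E. unfold expi in E. injection E; intros _ E1.
  assert (S : 0 < sin (x / 2)) by (apply sin_gt_0; lra).
  replace x with (2 * (x / 2)) in E1 by field. rewrite cos_2a_sin in E1. nra.
Qed.

Lemma csum_geom z n : ((z - 1) * csum n (fun k => Cpow z k) = Cpow z n - 1)%C.
Proof. induction n; simpl; [ring|]. rewrite Cmult_plus_distr_l, IHn. ring. Qed.

Lemma csum_geom_0 z n : z <> RtoC 1 -> Cpow z n = RtoC 1 -> csum n (fun k => Cpow z k) = RtoC 0.
Proof.
  intros Hz Hn. pose proof (csum_geom z n) as H. rewrite Hn in H.
  assert (Z : (z - 1)%C <> RtoC 0).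
  { intros E. apply Hz. replace z with ((z - 1) + 1)%C by ring. rewrite E; ring. }
  replace (csum n (fun k => Cpow z k)) with (/ (z - 1) * ((z - 1) * csum n (fun k => Cpow z k)))%C by (field; auto).
  rewrite H. ring.
Qed.

Lemma Cmod_node M t r : Cmod (node M t r) = 1.
Proof. apply Cmod_expi. Qed.

Lemma node_orth_lt M t j k : (j < M)%nat -> (k < j)%nat ->
  csum M (fun r => Cpow (node M t r) j * Cconj (Cpow (node M t r) k))%C = RtoC 0.
Proof.
  intros Hj Hk. pose proof (lt_0_INR M ltac:(lia)) as HM.
  pose (x := 2 * PI * INR (j - k) / INR M).
  rewrite (csum_ext _ _ (fun r => expi (INR (j - k) * t) * Cpow (expi x) r)%C).
  - rewrite csum_scal, csum_geom_0; [ring| |].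
    + apply expi_neq_1. unfold x. pose proof PI_RGT_0.
      pose proof (lt_0_INR (j - k) ltac:(lia)). pose proof (lt_INR (j - k) M ltac:(lia)).
      split.
      * apply Rdiv_lt_0_compat; auto. apply Rmult_lt_0_compat; lra.
      * apply Rmult_lt_reg_r with (INR M); auto. unfold Rdiv. rewrite Rmult_assoc, Rinv_l, Rmult_1_r by lra.
        apply Rmult_lt_compat_l; lra.
    + rewrite expi_pow. unfold x. replace (INR M * (2 * PI * INR (j - k) / INR M)) with (2 * PI * INR (j - k)) by (field; lra).
      apply expi_2PI_nat.
  - intros r _. unfold node. rewrite !expi_pow, expi_conj, <- !expi_add. f_equal.
    unfold x. rewrite minus_INR by lia. field; lra.
Qed.

Lemma node_orth M t j k : (j < M)%nat -> (k < M)%nat ->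
  csum M (fun r => Cpow (node M t r) j * Cconj (Cpow (node M t r) k))%C =
  (INR M * basis j k)%C.
Proof.
  intros Hj Hk. unfold basis. destruct (Nat.eqb_spec k j) as [->|N].
  - rewrite (csum_ext _ _ (fun _ => RtoC 1)).
    + rewrite csum_RtoC, rsum_const, RtoC_mult; auto.
    + intros r _. rewrite <- Cmod2_conj, Cmod_pow, Cmod_node, pow1. f_equal; ring.
  - destruct (Nat.lt_trichotomy j k) as [L|[L|L]]; [|lia|].
    + rewrite <- (Cconj_conj (csum M _)), csum_conj.
      rewrite (csum_ext _ _ (fun r => Cpow (node M t r) k * Cconj (Cpow (node M t r) j))%C).
      * rewrite node_orth_lt by auto. rewrite Cconj_R. ring.
      * intros; rewrite Cmult_conj, Cconj_conj; ring.
    + rewrite node_orth_lt by auto. ring.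
Qed.

Lemma basis_sym j k : basis j k = basis k j.
Proof. unfold basis; rewrite Nat.eqb_sym; auto. Qed.

(** Fourier inversion on the cyclic group of order [M]. *)
Lemma node_inversion M t c k : (k < M)%nat ->
  csum M (fun r => csum M (fun i => c i * Cpow (node M t r) i) * Cconj (Cpow (node M t r) k))%C =
  (INR M * c k)%C.
Proof.
  intros Hk.
  rewrite (csum_ext _ _ (fun r => csum M (fun i => c i * (Cpow (node M t r) i * Cconj (Cpow (node M t r) k))))%C).
  - rewrite csum_swap. rewrite <- (csum_basis M k (fun i => INR M * c i)%C) by auto.
    apply csum_ext; intros i Hi. rewrite csum_scal, node_orth, basis_sym by auto. ring.
  - intros r _. rewrite <- csum_scal_r. apply csum_ext; intros; ring.
Qed.

Lemma node_Parseval M t x :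
  sqs M (fun r => csum M (fun i => x i * Cpow (node M t r) i))%C = INR M * sqs M x.
Proof.
  apply RtoC_inj. rewrite <- csum_self, RtoC_mult, <- csum_self.
  rewrite (csum_ext _ _ (fun r => csum M (fun k => csum M (fun i => x i * Cpow (node M t r) i) * Cconj (Cpow (node M t r) k) * Cconj (x k)))%C).
  - rewrite csum_swap, <- csum_scal. apply csum_ext; intros k Hk.
    rewrite csum_scal_r, node_inversion by auto. ring.
  - intros r _. rewrite csum_conj, <- csum_scal. apply csum_ext; intros k _.
    rewrite Cmult_conj. ring.
Qed.

(** * From Besov regularity to trace class *)

Definition polyval (m : nat) (h : nat -> C) (z : C) : C := csum m (fun k => h k * Cpow z k)%C.

Lemma tcont_poly m h : tcont (polyval m h).
Proof. apply tcont_csum. intros k. apply tcont_mult; [apply tcont_const|apply tcont_pow]. Qed.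

Lemma nrm_support J m x alpha : 0 <= alpha -> (forall i, Cmod (x i) <= alpha) ->
  (forall i, (m <= i)%nat -> x i = RtoC 0) -> nrm J x <= sqrt (INR m) * alpha.
Proof.
  intros Ha Hx H0.
  rewrite <- (sqrt_pow2 alpha) by auto.
  rewrite <- sqrt_mult by (try apply pow2_ge_0; apply pos_INR).
  apply sqrt_le_1_alt. rewrite <- rsum_const.
  assert (H1 : forall n, sqs n x <= rsum n (fun _ => alpha ^ 2)).
  { intros n. apply rsum_le; intros. apply pow_incr; split; auto using Cmod_ge_0. }
  destruct (Nat.le_gt_cases J m).
  - eapply Rle_trans; [apply H1|]. apply rsum_mono; auto. intros; apply pow2_ge_0.
  - replace J with (m + (J - m))%nat by lia. unfold sqs. rewrite rsum_split.
    rewrite (rsum_0 (J - m)).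
    + rewrite Rplus_0_r. apply H1.
    + intros k _. rewrite H0 by lia. rewrite Cmod_0; ring.
Qed.

(** Write [1 + i + j = (1 + i) + j]: each factor of the weight splits a rank one
    matrix into two, in which one vector has been multiplied by at most [m].
    A vector with [m] coordinates of modulus at most [alpha] has norm at most
    [sqrt m alpha]. *)
Lemma weighted_rank_one p m J G : opbound J G 1 -> forall x y alpha beta,
  0 <= alpha -> 0 <= beta -> (forall i, Cmod (x i) <= alpha) -> (forall i, Cmod (y i) <= beta) ->
  (forall i, (m <= i)%nat -> x i = RtoC 0) -> (forall i, (m <= i)%nat -> y i = RtoC 0) ->
  Cmod (pairing J (fun i j => RtoC (INR (1 + i + j) ^ p) * (x i * y j))%C G)
    <= (2 * INR m) ^ p * (INR m * (alpha * beta)).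
Proof.
  intros HG. induction p; intros x y alpha beta Ha Hb Hx Hy Sx Sy.
  - rewrite (pairing_ext _ _ _ G (fun i j => x i * y j)%C) by (intros; simpl; ring).
    eapply Rle_trans; [apply HG|].
    pose proof (nrm_support J m x alpha Ha Hx Sx). pose proof (nrm_support J m y beta Hb Hy Sy).
    rewrite pow_O, !Rmult_1_l. rewrite <- (sqrt_sqrt (INR m)) by apply pos_INR.
    replace (sqrt (INR m) * sqrt (INR m) * (alpha * beta)) with ((sqrt (INR m) * alpha) * (sqrt (INR m) * beta)) by ring.
    apply Rmult_le_compat; auto using nrm_pos.
  - pose (x' := fun i => (RtoC (INR (1 + i)) * x i)%C).
    pose (y' := fun j => (RtoC (INR j) * y j)%C).
    pose proof (pos_INR m) as M0.
    assert (B : forall i (z : C) (k : nat) c, (k <= i + 1)%nat -> 0 <= c -> Cmod z <= c -> ((m <= i)%nat -> z = RtoC 0) ->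
      Cmod (RtoC (INR k) * z)%C <= INR m * c).
    { intros i z k c Hk Hc Hz Z0. destruct (Nat.le_gt_cases m i).
      - rewrite Z0 by auto. rewrite Cmult_0_r, Cmod_0. apply Rmult_le_pos; auto.
      - rewrite Cmod_mult, Cmod_R, Rabs_pos_eq by apply pos_INR.
        apply Rmult_le_compat; auto using pos_INR, Cmod_ge_0. apply le_INR; lia. }
    rewrite (pairing_ext _ _ _ (fun i j => RtoC (INR (1 + i + j) ^ p) * (x' i * y j) +
      RtoC (INR (1 + i + j) ^ p) * (x i * y' j))%C G).
    + rewrite (pairing_plus_l J G). eapply Rle_trans; [apply Cmod_triangle|].
      eapply Rle_trans; [apply Rplus_le_compat; [apply (IHp x' y (INR m * alpha) beta)|apply (IHp x y' alpha (INR m * beta))]|].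
      all: auto; try (apply Rmult_le_pos; auto).
      * intros i. apply (B i); auto; lia.
      * intros i Hi. unfold x'. rewrite Sx by auto. ring.
      * intros i. apply (B i); auto; lia.
      * intros i Hi. unfold y'. rewrite Sy by auto. ring.
      * right. simpl. ring.
    + intros i j _ _. unfold x', y'. rewrite (plus_INR (1 + i) j), <- tech_pow_Rmult, RtoC_mult, RtoC_plus. ring.
Qed.

Lemma Cmod_conj_pow M t r i : Cmod (Cconj (Cpow (node M t r) i)) = 1.
Proof. rewrite Cmod_conj, Cmod_pow, Cmod_node, pow1; auto. Qed.

(** By discrete Fourier inversion, [h (i + j + K)] is the average over the nodes
    [z] of [h(z) z^(-K)] times the rank one matrix [z^(-i) z^(-j)].  As [h]
    vanishes from [m] on, the indices may be cut at [m]. *)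
Lemma poly_trace_bound p m K h : (forall k, (m <= k)%nat -> h k = RtoC 0) ->
  dual_trace_bound (fun i j => RtoC (INR (1 + i + j) ^ p) * h (i + j + K)%nat)%C
    ((2 * INR m) ^ p * INR m * L1_torus_norm (polyval m h)).
Proof.
  intros Hh J G HG.
  (* More nodes than the degree and than every index [i + j + K]. *)
  set (M := (2 * J + K + m + 1)%nat).
  pose proof (lt_0_INR M ltac:(unfold M; lia)) as HM.
  assert (HM' : RtoC (INR M) <> RtoC 0) by (intros E; apply RtoC_inj in E; lra).
  destruct (average_le M (polyval m h) (tcont_poly m h) ltac:(unfold M; lia)) as [t Ht].
  pose (x := fun r i => if Nat.ltb i m then Cconj (Cpow (node M t r) i) else RtoC 0).
  assert (Inv : forall k, (k < M)%nat ->
    h k = csum M (fun r => / INR M * polyval m h (node M t r) * Cconj (Cpow (node M t r) k))%C).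
  { intros k Hk. rewrite (csum_ext _ _ (fun r => / INR M * (csum M (fun i => h i * Cpow (node M t r) i) * Cconj (Cpow (node M t r) k)))%C).
    - rewrite csum_scal, node_inversion by auto. field. auto.
    - intros r _. unfold polyval. rewrite <- (csum_trunc m M) by (unfold M; lia).
      rewrite Cmult_assoc. do 2 f_equal. apply csum_ext; intros i _.
      destruct (Nat.ltb_spec i m); auto. rewrite Hh by auto. ring. }
  pose (c := fun r => (/ INR M * polyval m h (node M t r) * Cconj (Cpow (node M t r) K))%C).
  rewrite (pairing_ext _ _ _ (fun i j => csum M (fun r => c r * (RtoC (INR (1 + i + j) ^ p) * (x r i * x r j)))%C) G).
  - rewrite (pairing_csum_l J M (fun r i j => c r * (RtoC (INR (1 + i + j) ^ p) * (x r i * x r j)))%C).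
    eapply Rle_trans; [apply csum_Cmod|].
    apply Rle_trans with (rsum M (fun r => ((2 * INR m) ^ p * INR m * / INR M) * Cmod (polyval m h (node M t r)))).
    + apply rsum_le; intros r _. rewrite pairing_scal_l, Cmod_mult.
      unfold c. rewrite !Cmod_mult, Cmod_conj_pow, Cmod_inv, Cmod_R, Rabs_pos_eq by (auto; lra).
      pose proof (weighted_rank_one p m J G HG (x r) (x r) 1 1) as W.
      rewrite !Rmult_1_r in W.
      assert (Hx : forall i, Cmod (x r i) <= 1).
      { intros i. unfold x. destruct (Nat.ltb i m). rewrite Cmod_conj_pow; lra. rewrite Cmod_0; lra. }
      assert (Sx : forall i, (m <= i)%nat -> x r i = RtoC 0).
      { intros i Hi. unfold x. rewrite (proj2 (Nat.ltb_ge i m)) by auto. auto. }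
      specialize (W ltac:(lra) ltac:(lra) Hx Hx Sx Sx).
      apply Rmult_le_compat_l with (r := / INR M * Cmod (polyval m h (node M t r))) in W.
      2:{ apply Rmult_le_pos; [apply Rlt_le, Rinv_0_lt_compat; auto|apply Cmod_ge_0]. }
      lra.
    + rewrite rsum_scal.
      assert (Q : 0 <= (2 * INR m) ^ p * INR m * / INR M).
      { apply Rmult_le_pos; [|apply Rlt_le, Rinv_0_lt_compat; auto]. pose proof (pos_INR m).
        apply Rmult_le_pos; auto. apply pow_le; lra. }
      apply Rmult_le_compat_l with (1 := Q) in Ht. eapply Rle_trans; [apply Ht|].
      right. field. lra.
  - intros i j Hi Hj. f_equal.
    destruct (Nat.ltb_spec i m); [destruct (Nat.ltb_spec j m)|].
    + rewrite (Inv (i + j + K)%nat) by (unfold M; lia). rewrite <- csum_scal. apply csum_ext; intros r _.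
      unfold c, x. rewrite (proj2 (Nat.ltb_lt i m)), (proj2 (Nat.ltb_lt j m)) by auto.
      rewrite !Cpow_add_r, !Cmult_conj. ring.
    + rewrite Hh by lia. rewrite csum_0; [ring|]. intros r _. unfold x.
      rewrite (proj2 (Nat.ltb_ge j m)) by auto. ring.
    + rewrite Hh by lia. rewrite csum_0; [ring|]. intros r _. unfold x.
      rewrite (proj2 (Nat.ltb_ge i m)) by auto. ring.
Qed.

Lemma INR_pow2 n : INR (2 ^ n) = 2 ^ n.
Proof. rewrite pow_INR. auto. Qed.

Lemma two_pow_pos n : 0 < 2 ^ n.
Proof. apply pow_lt; lra. Qed.

Lemma two_pow_S n : 2 ^ S n = 2 * 2 ^ n.
Proof. reflexivity. Qed.

Lemma W_coeff_high n k : (2 ^ (n + 1) < k)%nat -> W_coeff n k = 0.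
Proof.
  intros H. assert (2 ^ n <= 2 ^ (n + 1))%nat by (apply Nat.pow_le_mono_r; lia).
  destruct n; cbn [W_coeff].
  - rewrite (proj2 (Nat.leb_nle k 1)); auto. simpl in H; lia.
  - rewrite (proj2 (Nat.leb_nle k (2 ^ S n))), (proj2 (Nat.leb_nle k (2 ^ (S n + 1)))) by lia.
    rewrite !Bool.andb_false_r. auto.
Qed.

(** The partial sums are trapezoids: the rising side of [W_(n+1)] fills the
    falling side of [W_n]. *)
Lemma W_partial n k : rsum (S n) (fun m => W_coeff m k) =
  if Nat.leb k (2 ^ n) then 1 else if Nat.leb k (2 ^ (n + 1)) then (2 ^ (n + 1) - INR k) / 2 ^ n else 0.
Proof.
  induction n.
  - simpl. destruct k as [|[|[|k]]]; simpl; try ring. field.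
  - change (rsum (S (S n)) (fun m => W_coeff m k)) with (rsum (S n) (fun m => W_coeff m k) + W_coeff (S n) k).
    rewrite IHn. cbn [W_coeff].
    replace (S n + 1)%nat with (S (S n)) by lia. replace (n + 1)%nat with (S n) by lia.
    assert (E : (2 ^ S n = 2 * 2 ^ n)%nat) by reflexivity.
    assert (E2 : (2 ^ S (S n) = 2 * 2 ^ S n)%nat) by reflexivity.
    assert (P : (0 < 2 ^ n)%nat) by (apply Nat.neq_0_lt_0, Nat.pow_nonzero; lia).
    pose proof (two_pow_pos n). rewrite !two_pow_S.
    destruct (Nat.leb_spec k (2 ^ n)); destruct (Nat.leb_spec k (2 ^ S n));
    destruct (Nat.leb_spec k (2 ^ S (S n))); destruct (Nat.leb_spec (2 ^ n) k);
    destruct (Nat.leb_spec (2 ^ S n) k); try lia; cbn [andb]; try (field; lra).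
    replace k with (2 ^ n)%nat by lia. rewrite INR_pow2. field; lra.
Qed.

Lemma W_partition n k : (k <= 2 ^ n)%nat -> rsum (S n) (fun m => W_coeff m k) = 1.
Proof. intros H. rewrite W_partial, (proj2 (Nat.leb_le _ _)); auto. Qed.

Lemma W_conv_poly n a z : W_conv n a z = polyval (S (2 ^ (n + 1))) (fun k => RtoC (W_coeff n k) * a k)%C z.
Proof. unfold W_conv. rewrite sum_n_csum. reflexivity. Qed.

Lemma tcont_W_conv n a : tcont (W_conv n a).
Proof.
  destruct (tcont_poly (S (2 ^ (n + 1))) (fun k => RtoC (W_coeff n k) * a k)%C) as [A B].
  split; [eapply rcont_ext; [|apply A]|eapply rcont_ext; [|apply B]]; intros; cbv beta; rewrite W_conv_poly; auto.
Qed.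

Lemma besov_weight n N : Rpower 2 (INR n * INR N) = (2 ^ n) ^ N.
Proof. rewrite <- mult_INR, Rpower_pow by lra. rewrite pow_mult; auto. Qed.

Lemma dual_trace_bound_csum J n (A : nat -> nat -> nat -> C) (kappa : nat -> R) G :
  opbound J G 1 -> (forall m, dual_trace_bound (A m) (kappa m)) ->
  Cmod (pairing J (fun i j => csum n (fun m => A m i j)) G) <= rsum n kappa.
Proof.
  intros HG H. rewrite pairing_csum_l. eapply Rle_trans; [apply csum_Cmod|].
  apply rsum_le; intros; apply H; auto.
Qed.

(** Apply [poly_trace_bound] to each [W_n * F], whose degree is at most
    [2^(n+1)]. *)
Lemma besov_dual_trace p K F : besov (INR (S p)) F ->
  exists kappa, dual_trace_bound (fun i j => RtoC (INR (1 + i + j) ^ p) * F (i + j + K)%nat)%C kappa.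
Proof.
  intros HB. unfold besov in HB.
  set (b := fun n => Rpower 2 (INR n * INR (S p)) * L1_torus_norm (W_conv n F)) in *.
  assert (L0 : forall n, 0 <= L1_torus_norm (W_conv n F)) by (intros; apply L1_pos, tcont_W_conv).
  assert (Hb : forall n, 0 <= b n).
  { intros n. unfold b. apply Rmult_le_pos; auto. rewrite besov_weight. apply pow_le, Rlt_le, two_pow_pos. }
  pose (cst := 2 ^ p * 4 ^ S p).
  assert (c0 : 0 <= cst) by (apply Rmult_le_pos; apply pow_le; lra).
  exists (cst * Series b). intros J G HG.
  (* All the indices [i + j + K] are below [2^n1], where [W_0, ..., W_n1] add up to one. *)
  pose (n1 := (2 * J + K)%nat).
  rewrite (pairing_ext _ _ _ (fun i j => csum (S n1) (fun n => RtoC (INR (1 + i + j) ^ p) * (RtoC (W_coeff n (i + j + K)) * F (i + j + K)%nat)))%C G).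
  - apply Rle_trans with (rsum (S n1) (fun n => cst * b n)).
    2:{ rewrite rsum_scal. apply Rmult_le_compat_l; auto. apply rsum_le_Series; auto. }
    apply (dual_trace_bound_csum J (S n1) (fun n i j => RtoC (INR (1 + i + j) ^ p) * (RtoC (W_coeff n (i + j + K)) * F (i + j + K)%nat))%C); auto.
    intros n J' G' HG'.
    set (m := S (2 ^ (n + 1))).
    eapply Rle_trans; [apply (poly_trace_bound p m K (fun k => RtoC (W_coeff n k) * F k)%C)|]; auto.
    + intros k Hk. rewrite W_coeff_high by (unfold m in Hk; lia). ring.
    + rewrite (L1_ext _ (W_conv n F)) by (intros; symmetry; apply W_conv_poly).
      unfold b. rewrite besov_weight, <- Rmult_assoc. apply Rmult_le_compat_r; auto.
      assert (Hm : INR m <= 4 * 2 ^ n).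
      { unfold m. rewrite S_INR, INR_pow2, pow_add. pose proof (pow_R1_Rle 2 n ltac:(lra)). lra. }
      pose proof (pos_INR m).
      unfold cst. replace (2 ^ p * 4 ^ S p * (2 ^ n) ^ S p) with (2 ^ p * (4 * 2 ^ n) ^ S p) by (rewrite Rpow_mult_distr; ring).
      rewrite Rpow_mult_distr, Rmult_assoc. apply Rmult_le_compat_l; [apply pow_le; lra|].
      replace (INR m ^ p * INR m) with (INR m ^ S p) by (simpl; ring). apply pow_incr; lra.
  - intros i j Hi Hj. f_equal. rewrite csum_scal, csum_scal_r, csum_RtoC, W_partition.
    + ring.
    + pose proof (Nat.pow_gt_lin_r 2 n1 ltac:(lia)). unfold n1 in *. lia.
Qed.

(** * From trace class to Besov regularity *)

Lemma win_cases a L i : ((a <= i < a + L)%nat /\ win a L i = 1) \/ (~ (a <= i < a + L)%nat /\ win a L i = 0).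
Proof.
  unfold win. destruct (Nat.leb_spec a i), (Nat.ltb_spec i (a + L)); cbn [andb]; [left|right|right|right]; split; auto; lia.
Qed.

Lemma win_sqr a L i : win a L i * win a L i = win a L i.
Proof. destruct (win_cases a L i) as [[_ ->]|[_ ->]]; ring. Qed.

Lemma win_bd a L i : 0 <= win a L i <= 1.
Proof. destruct (win_cases a L i) as [[_ ->]|[_ ->]]; lra. Qed.

(** By induction, the sum is at most the number of true statements among
    [i < a n] and [i < a (n + 1)]; a new window contains [i] only if the first
    of them fails. *)
Lemma win_overlap (a L : nat -> nat) i n : (forall m, (a m + L m <= a (m + 2))%nat) ->
  rsum n (fun m => win (a m) (L m) i) <= 2.
Proof.
  intros H.
  assert (B : rsum n (fun m => win (a m) (L m) i) <=
    (if Nat.ltb i (a n) then 1 else 0) + (if Nat.ltb i (a (n + 1)%nat) then 1 else 0)).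
  { induction n; cbn [rsum].
    - destruct (Nat.ltb i (a O)), (Nat.ltb i (a (0 + 1)%nat)); lra.
    - specialize (H n). replace (n + 2)%nat with (S n + 1)%nat in H by lia.
      replace (n + 1)%nat with (S n) in IHn by lia.
      destruct (win_cases (a n) (L n) i) as [[W ->]|[W ->]];
      destruct (Nat.ltb_spec i (a n)); destruct (Nat.ltb_spec i (a (S n)));
      destruct (Nat.ltb_spec i (a (S n + 1)%nat)); try lia; try lra. }
  destruct (Nat.ltb i (a n)), (Nat.ltb i (a (n + 1)%nat)); lra.
Qed.

Definition cut (a L : nat) (x : nat -> C) : nat -> C := fun i => (RtoC (win a L i) * x i)%C.

Lemma cut_overlap (a L : nat -> nat) J x n : (forall m, (a m + L m <= a (m + 2))%nat) ->
  rsum n (fun m => nrm J (cut (a m) (L m) x) ^ 2) <= 2 * sqs J x.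
Proof.
  intros H. rewrite (rsum_ext _ _ (fun m => rsum J (fun i => win (a m) (L m) i * Cmod (x i) ^ 2))).
  - rewrite rsum_swap. unfold sqs. rewrite <- rsum_scal. apply rsum_le; intros i _.
    rewrite (rsum_ext _ _ (fun m => Cmod (x i) ^ 2 * win (a m) (L m) i)) by (intros; ring).
    rewrite rsum_scal, Rmult_comm. apply Rmult_le_compat_r; [apply pow2_ge_0|]. apply win_overlap; auto.
  - intros m _. rewrite nrm_sqr. apply rsum_ext; intros i _. unfold cut.
    rewrite Cmod_mult, Cmod_R, Rabs_pos_eq by apply win_bd. rewrite Rpow_mult_distr.
    rewrite <- (win_sqr _ _ i) at 2. ring.
Qed.

(** The sum of the moduli of all entries is such a bound. *)
Lemma opbound_exists J G : exists c, 1 <= c /\ opbound J G c.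
Proof.
  pose (c := rsum J (fun i => rsum J (fun j => Cmod (G i j)))).
  assert (c0 : 0 <= c) by (apply rsum_nonneg; intros; apply rsum_nonneg; intros; apply Cmod_ge_0).
  exists (c + 1). split; [lra|]. apply opbound_mono with c; [lra|].
  intros x y. unfold pairing. eapply Rle_trans; [apply csum_Cmod|].
  unfold c. rewrite Rmult_comm, <- rsum_scal. apply rsum_le; intros i Hi.
  eapply Rle_trans; [apply csum_Cmod|]. rewrite <- rsum_scal. apply rsum_le; intros j Hj.
  rewrite !Cmod_mult, Rmult_comm. apply Rmult_le_compat_r; [apply Cmod_ge_0|].
  assert (E : forall (z : nat -> C) k, (k < J)%nat -> Cmod (z k) <= nrm J z).
  { intros z k Hk. rewrite <- (sqrt_pow2 (Cmod (z k))) by apply Cmod_ge_0. apply sqrt_le_1_alt.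
    apply Rle_trans with (sqs (S k) z).
    - unfold sqs; cbn [rsum]. pose proof (sqs_nonneg k z) as H. unfold sqs in H. lra.
    - apply rsum_mono; [intros; apply pow2_ge_0|lia]. }
  apply Rmult_le_compat; auto using Cmod_ge_0.
Qed.

(** The equation says that [G] vanishes outside the block with rows [[a, a + L)]
    and columns [[b, b + L)]. *)
Definition supported (a b L : nat) (G : nat -> nat -> C) : Prop :=
  forall i j, G i j = (RtoC (win a L i * win b L j) * G i j)%C.

Lemma supported_cut J a b L G x y : supported a b L G ->
  pairing J G (fun i j => x i * y j)%C = pairing J G (fun i j => cut a L x i * cut b L y j)%C.
Proof.
  intros H. apply pairing_ext; intros i j _ _. unfold cut. rewrite (H i j) at 1. rewrite RtoC_mult. ring.
Qed.

Definition schur (a b : nat) (G : nat -> nat -> C) : nat -> nat -> C :=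
  fun i j => (RtoC (INR (1 + a + b) / INR (1 + i + j)) * G i j)%C.

(** With [H = schur a b G], [s = 1 + a + b] and [S = 2 (J + 1)],
    [S H_ij = s G_ij + (S / 2 - 1 - i) H_ij + H_ij (S / 2 - j)].  On the support
    the two multipliers are at most [S / 2 - 1 - a] and [S / 2 - b], which add
    up to [S - s], so a bound [kappa] for [H] improves to
    [(s + kappa (S - s)) / S]. *)
Lemma schur_step J a b L G kappa : (a + L <= J)%nat -> (b + L <= J)%nat ->
  supported a b L G -> opbound J G 1 -> 0 <= kappa -> opbound J (schur a b G) kappa ->
  opbound J (schur a b G) (1 + (kappa - 1) * (1 - INR (1 + a + b) / (2 * INR (J + 1)))).
Proof.
  intros Ha Hb HS HG Hk HK x y.
  set (S := 2 * INR (J + 1)). set (s := INR (1 + a + b)).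
  assert (S0 : 0 < S) by (unfold S; pose proof (lt_0_INR (J + 1) ltac:(lia)); lra).
  assert (Hlin : forall k, (k <= J)%nat -> INR k <= S / 2).
  { intros k Hk'. unfold S. pose proof (le_INR k (J + 1) ltac:(lia)). lra. }
  pose (x' := fun i => (RtoC (win a L i * (S / 2 - INR (1 + i))) * x i)%C).
  pose (y' := fun j => (RtoC (win b L j * (S / 2 - INR j)) * y j)%C).
  assert (HS' : supported a b L (schur a b G)).
  { intros i j. unfold schur. rewrite (HS i j) at 1. ring. }
  assert (E : (RtoC S * pairing J (schur a b G) (fun i j => x i * y j) =
     RtoC s * pairing J G (fun i j => x i * y j) +
     (pairing J (schur a b G) (fun i j => x' i * y j) + pairing J (schur a b G) (fun i j => x i * y' j)))%C).
  { rewrite <- !pairing_scal_l, <- pairing_plus_r.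
    unfold pairing. rewrite <- csum_plus. apply csum_ext; intros i _.
    rewrite <- csum_plus. apply csum_ext; intros j _.
    assert (Hn : INR (1 + i + j) <> 0) by (apply not_0_INR; lia).
    unfold x', y'.
    assert (W : forall u : C, (RtoC (win a L i) * (schur a b G i j * u) = schur a b G i j * u)%C /\
                          (RtoC (win b L j) * (schur a b G i j * u) = schur a b G i j * u)%C).
    { assert (w1 : (RtoC (win a L i) * RtoC (win a L i) = RtoC (win a L i))%C) by (rewrite <- RtoC_mult, win_sqr; auto).
      assert (w2 : (RtoC (win b L j) * RtoC (win b L j) = RtoC (win b L j))%C) by (rewrite <- RtoC_mult, win_sqr; auto).
      intros u. rewrite (HS' i j), RtoC_mult. split.
      - transitivity (RtoC (win a L i) * RtoC (win a L i) * (RtoC (win b L j) * schur a b G i j * u))%C; [ring|rewrite w1; ring].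
      - transitivity (RtoC (win b L j) * RtoC (win b L j) * (RtoC (win a L i) * schur a b G i j * u))%C; [ring|rewrite w2; ring]. }
    replace (schur a b G i j * (RtoC (win a L i * (S / 2 - INR (1 + i))) * x i * y j +
                                x i * (RtoC (win b L j * (S / 2 - INR j)) * y j)))%C
      with (RtoC (win a L i) * (schur a b G i j * (RtoC (S / 2 - INR (1 + i)) * x i * y j)) +
            RtoC (win b L j) * (schur a b G i j * (RtoC (S / 2 - INR j) * x i * y j)))%C
      by (rewrite !RtoC_mult; ring).
    rewrite (proj1 (W _)), (proj2 (W _)).
    transitivity ((RtoC (INR (1 + i + j)) * schur a b G i j + RtoC (S - INR (1 + i + j)) * schur a b G i j) * (x i * y j))%C.
    - rewrite RtoC_minus. ring.
    - replace (RtoC (INR (1 + i + j)) * schur a b G i j)%C with (RtoC s * G i j)%C.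
      + replace (S - INR (1 + i + j)) with ((S / 2 - INR (1 + i)) + (S / 2 - INR j)) by (rewrite (plus_INR (1 + i) j); field).
        rewrite RtoC_plus. ring.
      + unfold schur. fold s. rewrite Cmult_assoc, <- RtoC_mult. do 2 f_equal. field; auto. }
  assert (Nx : nrm J x' <= (S / 2 - INR (1 + a)) * nrm J x).
  { assert (H : 0 <= S / 2 - INR (1 + a)).
    { unfold S. pose proof (le_INR (1 + a) (J + 1) ltac:(lia)). lra. }
    rewrite <- (Rabs_pos_eq (S / 2 - INR (1 + a))), <- Cmod_R, <- nrm_scal by auto.
    apply nrm_le. intros k Hk'. unfold x'. rewrite !Cmod_mult. apply Rmult_le_compat_r; [apply Cmod_ge_0|].
    rewrite !Cmod_R, (Rabs_pos_eq (S / 2 - INR (1 + a))) by auto.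
    destruct (win_cases a L k) as [[W ->]|[W ->]]; rewrite ?Rmult_1_l, ?Rmult_0_l, ?Rabs_R0; auto.
    pose proof (le_INR (1 + k) (J + 1) ltac:(lia)). pose proof (le_INR (1 + a) (1 + k) ltac:(lia)).
    rewrite Rabs_pos_eq; unfold S; lra. }
  assert (Ny : nrm J y' <= (S / 2 - INR b) * nrm J y).
  { assert (H : 0 <= S / 2 - INR b).
    { unfold S. pose proof (le_INR b (J + 1) ltac:(lia)). lra. }
    rewrite <- (Rabs_pos_eq (S / 2 - INR b)), <- Cmod_R, <- nrm_scal by auto.
    apply nrm_le. intros k Hk'. unfold y'. rewrite !Cmod_mult. apply Rmult_le_compat_r; [apply Cmod_ge_0|].
    rewrite !Cmod_R, (Rabs_pos_eq (S / 2 - INR b)) by auto.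
    destruct (win_cases b L k) as [[W ->]|[W ->]]; rewrite ?Rmult_1_l, ?Rmult_0_l, ?Rabs_R0; auto.
    pose proof (le_INR k (J + 1) ltac:(lia)). pose proof (le_INR b k ltac:(lia)).
    rewrite Rabs_pos_eq; unfold S; lra. }
  apply Rmult_le_reg_l with S; auto.
  apply Rle_trans with (Cmod (RtoC S * pairing J (schur a b G) (fun i j => x i * y j))%C).
  { rewrite Cmod_mult, Cmod_R, Rabs_pos_eq; lra. }
  rewrite E.
  eapply Rle_trans; [apply Cmod_triangle|]. rewrite Cmod_mult, Cmod_R, (Rabs_pos_eq s) by apply pos_INR.
  eapply Rle_trans; [apply Rplus_le_compat_l, Cmod_triangle|].
  pose proof (HG x y) as H1. pose proof (HK x' y) as H2. pose proof (HK x y') as H3.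
  pose proof (nrm_pos J x) as Px. pose proof (nrm_pos J y) as Py.
  rewrite Rmult_1_l in H1.
  assert (H4 : kappa * (nrm J x' * nrm J y) <= kappa * ((S / 2 - INR (1 + a)) * nrm J x * nrm J y)).
  { apply Rmult_le_compat_l; auto. apply Rmult_le_compat_r; auto. }
  assert (H5 : kappa * (nrm J x * nrm J y') <= kappa * (nrm J x * ((S / 2 - INR b) * nrm J y))).
  { apply Rmult_le_compat_l; auto. apply Rmult_le_compat_l; auto. }
  apply Rmult_le_compat_l with (r := s) in H1; [|apply pos_INR].
  assert (Es : s = INR (1 + a) + INR b) by (unfold s; apply plus_INR).
  replace (S * ((1 + (kappa - 1) * (1 - s / S)) * (nrm J x * nrm J y))) with
    (s * (nrm J x * nrm J y) + (kappa * ((S / 2 - INR (1 + a)) * nrm J x * nrm J y) + kappa * (nrm J x * ((S / 2 - INR b) * nrm J y)))).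
  - lra.
  - rewrite Es. field. lra.
Qed.

(** Some bound exists because the matrix is finite, and iterating
    [schur_step] brings it down to [1] geometrically. *)
Lemma schur_contraction J a b L G : (a + L <= J)%nat -> (b + L <= J)%nat ->
  supported a b L G -> opbound J G 1 -> opbound J (schur a b G) 1.
Proof.
  intros Ha Hb HS HG.
  destruct (opbound_exists J (schur a b G)) as [k0 [Hk0 HK]].
  set (q := 1 - INR (1 + a + b) / (2 * INR (J + 1))).
  assert (Hq : 0 <= q < 1).
  { unfold q. pose proof (le_INR (1 + a + b) (2 * (J + 1)) ltac:(lia)) as H.
    rewrite mult_INR in H. change (INR 2) with 2 in H.
    pose proof (lt_0_INR (1 + a + b) ltac:(lia)). pose proof (lt_0_INR (J + 1) ltac:(lia)).
    assert (0 < INR (1 + a + b) / (2 * INR (J + 1))) by (apply Rdiv_lt_0_compat; lra).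
    assert (INR (1 + a + b) / (2 * INR (J + 1)) <= 1).
    { apply Rmult_le_reg_r with (2 * INR (J + 1)); [lra|]. unfold Rdiv. rewrite Rmult_assoc, Rinv_l by lra. lra. }
    lra. }
  assert (It : forall n, opbound J (schur a b G) (1 + (k0 - 1) * q ^ n)).
  { induction n.
    - apply opbound_mono with k0; auto. simpl; lra.
    - pose proof (pow_le q n (proj1 Hq)).
      replace (1 + (k0 - 1) * q ^ S n) with (1 + ((1 + (k0 - 1) * q ^ n) - 1) * q) by (simpl; ring).
      apply schur_step with L; auto. nra. }
  intros x y.
  apply le_plus_lim0 with (fun n => ((k0 - 1) * (nrm J x * nrm J y)) * q ^ n).
  - intros n. pose proof (It n x y). lra.
  - apply lim0_scal, is_lim_seq_geom. rewrite Rabs_pos_eq; lra.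
Qed.

Lemma schur_pow_contraction J a b L G p : (a + L <= J)%nat -> (b + L <= J)%nat ->
  supported a b L G -> opbound J G 1 ->
  opbound J (fun i j => RtoC ((INR (1 + a + b) / INR (1 + i + j)) ^ p) * G i j)%C 1.
Proof.
  intros Ha Hb HS HG.
  induction p.
  - apply opbound_ext with (2 := HG). intros; simpl; ring.
  - apply opbound_ext with (schur a b (fun i j => RtoC ((INR (1 + a + b) / INR (1 + i + j)) ^ p) * G i j)%C).
    + intros i j _ _. unfold schur. rewrite Cmult_assoc, <- RtoC_mult. auto.
    + apply schur_contraction with L; auto.
      intros i j. rewrite (HS i j) at 1. ring.
Qed.

(** The form is the average over the nodes of [eps_r] times the product of two
    polynomials with coefficients [x] and [y]; use Cauchy-Schwarz and
    [node_Parseval]. *)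
Lemma hankel_contraction M t K (eps : nat -> C) : (0 < M)%nat -> (forall r, Cmod (eps r) <= 1) ->
  opbound M (fun i j => / INR M * csum M (fun r => eps r * Cpow (node M t r) (i + j + K)))%C 1.
Proof.
  intros HM He x y. pose proof (lt_0_INR M HM) as M0.
  pose (X := fun r => csum M (fun i => x i * Cpow (node M t r) i)%C).
  pose (Y := fun r => csum M (fun i => y i * Cpow (node M t r) i)%C).
  assert (E : pairing M (fun i j => / INR M * csum M (fun r => eps r * Cpow (node M t r) (i + j + K)))%C
      (fun i j => x i * y j)%C = (/ INR M * csum M (fun r => eps r * Cpow (node M t r) K * (X r * Y r)))%C).
  { rewrite pairing_scal_l, (pairing_csum_l M M (fun r i j => eps r * Cpow (node M t r) (i + j + K))%C). f_equal.
    apply csum_ext; intros r _. unfold X, Y. rewrite <- pairing_rank_one, <- pairing_scal_l.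
    unfold pairing. apply csum_ext; intros i _. apply csum_ext; intros j _. rewrite !Cpow_add_r.
    ring. }
  rewrite E, Cmod_mult, Cmod_inv, Cmod_R, Rabs_pos_eq by (try lra; intros H; apply RtoC_inj in H; lra).
  apply Rmult_le_reg_l with (INR M); auto. rewrite <- Rmult_assoc, Rinv_r, Rmult_1_l, Rmult_1_l by lra.
  eapply Rle_trans; [apply csum_Cmod|].
  apply Rle_trans with (rsum M (fun r => Cmod (X r) * Cmod (Y r))).
  - apply rsum_le; intros r _. rewrite !Cmod_mult, Cmod_pow, Cmod_node, pow1.
    pose proof (He r). pose proof (Cmod_ge_0 (X r)). pose proof (Cmod_ge_0 (Y r)).
    pose proof (Cmod_ge_0 (eps r)). assert (0 <= Cmod (X r) * Cmod (Y r)) by (apply Rmult_le_pos; auto). nra.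
  - replace (INR M * (nrm M x * nrm M y)) with ((sqrt (INR M) * nrm M x) * (sqrt (INR M) * nrm M y)).
    + apply rsum_CS_le; try (intros; apply Cmod_ge_0);
        try (apply Rmult_le_pos; [apply sqrt_pos|apply nrm_pos]).
      * rewrite Rpow_mult_distr, pow2_sqrt, nrm_sqr by lra. right. apply (node_Parseval M t x).
      * rewrite Rpow_mult_distr, pow2_sqrt, nrm_sqr by lra. right. apply (node_Parseval M t y).
    + rewrite <- (sqrt_sqrt (INR M)) at 3 by lra. ring.
Qed.

(** At [z = 0] the numerator vanishes, so the value is [0]. *)
Definition phase (z : C) : C := (Cconj z / RtoC (Cmod z))%C.

Lemma phase_spec z : Cmod (phase z) <= 1 /\ (phase z * z)%C = RtoC (Cmod z).
Proof.
  unfold phase. destruct (Req_dec (Cmod z) 0) as [E|E].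
  - apply Cmod_eq_0 in E. subst. rewrite Cmod_0, Cconj_R. split.
    + replace (RtoC 0 / RtoC 0)%C with (RtoC 0) by (unfold Cdiv; ring). rewrite Cmod_0; lra.
    + unfold Cdiv; ring.
  - assert (E' : RtoC (Cmod z) <> RtoC 0) by (intros H; apply RtoC_inj in H; auto).
    split.
    + rewrite Cmod_div, Cmod_conj, Cmod_R, Rabs_pos_eq by (auto using Cmod_ge_0).
      right; field; auto.
    + replace (Cconj z / Cmod z * z)%C with (z * Cconj z / Cmod z)%C by (field; auto).
      rewrite <- Cmod2_conj. simpl. rewrite Rmult_1_r, RtoC_mult. field; auto.
Qed.

(** The part of the series [F] seen by a square block of a Hankel matrix: the
    coefficient of index [s + k] is that of [F] times the number of pairs
    [i, j < L] with [i + j = k]. *)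
Definition block_poly (F : nat -> C) (s L : nat) (z : C) : C :=
  csum L (fun i => csum L (fun j => F (s + i + j)%nat * Cpow z (s + i + j)))%C.

Lemma tcont_block F s L : tcont (block_poly F s L).
Proof.
  apply tcont_csum; intros i. apply tcont_csum; intros j.
  apply tcont_mult; [apply tcont_const|apply tcont_pow].
Qed.

(** The test matrix is the Hankel matrix of the phases of the block polynomial
    at nodes where its average is at least its [L^1] norm, cut to the block and
    multiplied by [((1 + a + b) / (1 + i + j))^p] to undo the weight. *)
Lemma single_block F p K J a b L : (a + L <= J)%nat -> (b + L <= J)%nat -> (0 < J)%nat ->
  exists G v, opbound J G 1 /\ supported a b L G /\
    pairing J (fun i j => RtoC (INR (1 + i + j) ^ p) * F (i + j + K)%nat)%C G = RtoC v /\
    INR (1 + a + b) ^ p * L1_torus_norm (block_poly F (a + b + K) L) <= v.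
Proof.
  intros Ha Hb HJ. pose proof (lt_0_INR J HJ) as J0.
  set (g := block_poly F (a + b + K) L).
  destruct (average_ge J g (tcont_block _ _ _) HJ) as [t Ht].
  pose (y := fun k => (/ INR J * csum J (fun r => phase (g (node J t r)) * Cpow (node J t r) k))%C).
  pose (H := fun i j => (RtoC (win a L i * win b L j) * y (i + j + K)%nat)%C).
  assert (HS : supported a b L H).
  { intros i j. unfold H. rewrite Cmult_assoc, <- RtoC_mult. do 2 f_equal.
    rewrite <- (win_sqr a L i), <- (win_sqr b L j) at 1. ring. }
  assert (HH : opbound J H 1).
  { intros u v.
    replace (pairing J H (fun i j => u i * v j)%C) with
      (pairing J (fun i j => y (i + j + K)%nat) (fun i j => cut a L u i * cut b L v j)%C).
    - eapply Rle_trans; [apply (hankel_contraction J t K (fun r => phase (g (node J t r))))|]; auto.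
      + intros; apply phase_spec.
      + assert (C : forall a' w, nrm J (cut a' L w) <= nrm J w).
        { intros a' w. apply nrm_le; intros k _. unfold cut. rewrite Cmod_mult, Cmod_R, Rabs_pos_eq by apply win_bd.
          pose proof (win_bd a' L k). pose proof (Cmod_ge_0 (w k)). nra. }
        apply Rmult_le_compat_l; [lra|]. apply Rmult_le_compat; auto using nrm_pos.
    - apply pairing_ext; intros i j _ _. unfold H, cut. rewrite RtoC_mult. ring. }
  exists (fun i j => RtoC ((INR (1 + a + b) / INR (1 + i + j)) ^ p) * H i j)%C.
  exists (INR (1 + a + b) ^ p * (/ INR J * rsum J (fun r => Cmod (g (node J t r))))).
  split; [apply schur_pow_contraction with L; auto|]. split; [|split].
  - intros i j. rewrite (HS i j) at 1. ring.
  - rewrite (pairing_ext _ _ _ (fun i j => RtoC (win a L i) * (RtoC (win b L j) * F (i + j + K)%nat))%C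
       (fun i j => RtoC (INR (1 + a + b) ^ p) * y (i + j + K)%nat)%C).
    + rewrite pairing_scal_r, RtoC_mult. f_equal.
      transitivity (csum L (fun i => csum L (fun j => F (a + b + K + i + j)%nat * y (a + b + K + i + j)%nat)))%C.
      * unfold pairing.
        rewrite (csum_ext J _ (fun i => RtoC (win a L i) * csum L (fun j => F (i + (b + j) + K)%nat * y (i + (b + j) + K)%nat))%C).
        -- rewrite csum_win by auto. apply csum_ext; intros i _. apply csum_ext; intros j _.
           replace (a + i + (b + j) + K)%nat with (a + b + K + i + j)%nat by lia. auto.
        -- intros i _. rewrite <- (csum_win J b L (fun j => F (i + j + K)%nat * y (i + j + K)%nat)%C) by auto.
           rewrite <- csum_scal. apply csum_ext; intros j _. ring.
      * rewrite RtoC_mult, <- csum_RtoC.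
        rewrite (csum_ext J _ (fun r => phase (g (node J t r)) * g (node J t r))%C) by (intros; symmetry; apply phase_spec).
        unfold g at 2, block_poly.
        set (s := (a + b + K)%nat).
        transitivity (csum J (fun r => / INR J * (phase (g (node J t r)) *
          csum L (fun i => csum L (fun j => F (s + i + j)%nat * Cpow (node J t r) (s + i + j))))))%C.
        -- rewrite (csum_ext J _ (fun r => csum L (fun i => csum L (fun j =>
             / INR J * (phase (g (node J t r)) * (F (s + i + j)%nat * Cpow (node J t r) (s + i + j))))))%C).
           ++ rewrite (csum_swap J L). apply csum_ext; intros i _. rewrite (csum_swap J L). apply csum_ext; intros j _.
              unfold y. rewrite <- !csum_scal. apply csum_ext; intros r _. ring.
           ++ intros r _. rewrite <- !csum_scal. apply csum_ext; intros i _. rewrite <- !csum_scal. auto.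
        -- rewrite csum_scal, RtoC_inv by lra. auto.
    + intros i j _ _. unfold H. rewrite RtoC_mult.
      assert (Hn : INR (1 + i + j) <> 0) by (apply not_0_INR; lia).
      transitivity (RtoC (INR (1 + i + j) ^ p * (INR (1 + a + b) / INR (1 + i + j)) ^ p) *
        (F (i + j + K)%nat * (RtoC (win a L i) * RtoC (win b L j) * y (i + j + K)%nat)))%C.
      * rewrite RtoC_mult. ring.
      * rewrite <- Rpow_mult_distr.
        replace (INR (1 + i + j) * (INR (1 + a + b) / INR (1 + i + j))) with (INR (1 + a + b)) by (field; auto). ring.
  - apply Rmult_le_compat_l; [apply pow_le, pos_INR|].
    apply Rmult_le_reg_l with (INR J); auto. rewrite <- Rmult_assoc, Rinv_r, Rmult_1_l by lra. auto.
Qed.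

(** Add up the test matrices of the single blocks.  Their rows and columns
    overlap at most twice, so by Cauchy-Schwarz the sum has norm at most [2]. *)
Lemma block_sum F p K kappa (a b L : nat -> nat) n :
  dual_trace_bound (fun i j => RtoC (INR (1 + i + j) ^ p) * F (i + j + K)%nat)%C kappa ->
  (forall m, (a m + L m <= a (m + 2))%nat) -> (forall m, (b m + L m <= b (m + 2))%nat) ->
  rsum n (fun m => INR (1 + a m + b m) ^ p * L1_torus_norm (block_poly F (a m + b m + K) (L m))) <= 2 * kappa.
Proof.
  intros HA Ha Hb.
  assert (HJ : exists J, (0 < J)%nat /\ forall m, (m < n)%nat -> (a m + L m <= J)%nat /\ (b m + L m <= J)%nat).
  { clear. induction n as [|n [J [J0 IH]]]; [exists 1%nat; split; lia|].
    exists (J + (a n + L n) + (b n + L n))%nat. split; [lia|]. intros m Hm.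
    destruct (Nat.eq_dec m n) as [->|]; [lia|]. specialize (IH m ltac:(lia)). lia. }
  destruct HJ as [J [J0 HJ]].
  assert (H : exists (G : nat -> nat -> C) (v : R),
    (forall x y, Cmod (pairing J G (fun i j => x i * y j)%C) <=
       rsum n (fun m => nrm J (cut (a m) (L m) x) * nrm J (cut (b m) (L m) y))) /\
    pairing J (fun i j => RtoC (INR (1 + i + j) ^ p) * F (i + j + K)%nat)%C G = RtoC v /\
    rsum n (fun m => INR (1 + a m + b m) ^ p * L1_torus_norm (block_poly F (a m + b m + K) (L m))) <= v).
  { clear HA. induction n as [|n IH].
    - exists (fun _ _ => RtoC 0), 0. split; [|split].
      + intros x y. unfold pairing. rewrite csum_0. rewrite Cmod_0; simpl; lra.
        intros; apply csum_0; intros; ring.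
      + unfold pairing. apply csum_0; intros; apply csum_0; intros; ring.
      + simpl; lra.
    - destruct IH as [G [v [HG [Hv Hl]]]]; [intros; apply HJ; lia|].
      destruct (HJ n ltac:(lia)) as [Ja Jb].
      destruct (single_block F p K J (a n) (b n) (L n) Ja Jb J0) as [G' [v' [HG' [HS' [Hv' Hl']]]]].
      exists (fun i j => G i j + G' i j)%C, (v + v'). split; [|split].
      + intros x y. rewrite pairing_plus_l. eapply Rle_trans; [apply Cmod_triangle|].
        cbn [rsum]. apply Rplus_le_compat; auto.
        rewrite (supported_cut J (a n) (b n) (L n)) by auto. eapply Rle_trans; [apply HG'|]. lra.
      + rewrite pairing_plus_r, Hv, Hv', RtoC_plus. auto.
      + cbn [rsum]. lra. }
  destruct H as [G [v [HG [Hv Hl]]]].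
  eapply Rle_trans; [apply Hl|].
  assert (HG2 : opbound J G 2).
  { intros x y. eapply Rle_trans; [apply HG|].
    replace (2 * (nrm J x * nrm J y)) with ((sqrt 2 * nrm J x) * (sqrt 2 * nrm J y)).
    - apply rsum_CS_le; try (intros; apply nrm_pos);
        try (apply Rmult_le_pos; [apply sqrt_pos|apply nrm_pos]);
        rewrite Rpow_mult_distr, pow2_sqrt, nrm_sqr by lra; apply cut_overlap; auto.
    - rewrite <- (sqrt_sqrt 2) at 3 by lra. ring. }
  apply (dual_trace_bound_scaled _ _ J G 2 HA ltac:(lra)) in HG2.
  rewrite Hv, Cmod_R in HG2. pose proof (Rle_abs v). lra.
Qed.

(** The number of pairs [i, j < L] with [i + j = k], for [k < 2 L]. *)
Definition tri (L k : nat) : nat := if Nat.ltb k L then k + 1 else 2 * L - 1 - k.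

Lemma win_count L k : (k < 2 * L)%nat -> rsum L (fun i => win i L k) = INR (tri L k).
Proof.
  intros Hk. unfold tri. destruct (Nat.ltb_spec k L).
  - replace L with ((k + 1) + (L - (k + 1)))%nat at 1 by lia. rewrite rsum_split.
    rewrite (rsum_ext (k + 1) _ (fun _ => 1)), (rsum_0 (L - (k + 1))).
    + rewrite rsum_const; ring.
    + intros i Hi. destruct (win_cases (k + 1 + i) L k) as [[W ->]|[W ->]]; auto; lia.
    + intros i Hi. destruct (win_cases i L k) as [[W ->]|[W ->]]; auto; lia.
  - replace L with ((k + 1 - L) + (2 * L - 1 - k))%nat at 1 by lia. rewrite rsum_split.
    rewrite rsum_0, (rsum_ext (2 * L - 1 - k) _ (fun _ => 1)).
    + rewrite rsum_const; ring.
    + intros i Hi. destruct (win_cases (k + 1 - L + i) L k) as [[W ->]|[W ->]]; auto; lia.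
    + intros i Hi. destruct (win_cases i L k) as [[W ->]|[W ->]]; auto; lia.
Qed.

Lemma double_sum_tri L h : csum L (fun i => csum L (fun j => h (i + j)%nat)) =
  csum (2 * L) (fun k => RtoC (INR (tri L k)) * h k)%C.
Proof.
  rewrite (csum_ext L _ (fun i => csum (2 * L) (fun k => RtoC (win i L k) * h k)%C)).
  - rewrite csum_swap. apply csum_ext; intros k Hk.
    rewrite csum_scal_r, csum_RtoC, win_count by auto. auto.
  - intros i Hi. rewrite csum_win by lia. auto.
Qed.

(** [W_(n+1)] is piecewise linear with nodes [L, 2 L, 4 L].  It is the hat of
    height [1] on [[L, 3 L]] plus the hat of height [1/2] on [[2 L, 4 L]]; a
    square block of size [L] produces a hat of height [L]. *)
Lemma W_hats n k : let L := (2 ^ n)%nat in (k <= 4 * L)%nat ->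
  W_coeff (S n) k =
    / INR L * (win (L + 1) (2 * L) k * INR (tri L (k - (L + 1)))) +
    / (2 * INR L) * (win (2 * L + 1) (2 * L) k * INR (tri L (k - (2 * L + 1)))).
Proof.
  intros L HL.
  assert (P : (0 < L)%nat) by (apply Nat.neq_0_lt_0, Nat.pow_nonzero; lia).
  assert (P' : 0 < INR L) by (apply lt_0_INR; auto).
  assert (E1 : (2 ^ S n = 2 * L)%nat) by reflexivity.
  assert (E2 : (2 ^ (S n + 1) = 4 * L)%nat) by (rewrite Nat.pow_add_r, E1; simpl; lia).
  assert (F0 : 2 ^ n = INR L) by (unfold L; rewrite INR_pow2; auto).
  assert (F1 : 2 ^ S n = 2 * INR L) by (simpl; rewrite F0; auto).
  assert (F2 : 2 ^ (S n + 1) = 4 * INR L) by (rewrite pow_add, F1; simpl; ring).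
  cbn [W_coeff]. rewrite F2, F1, F0, E2, E1. fold L.
  destruct (win_cases (L + 1) (2 * L) k) as [[W1 ->]|[W1 ->]];
  destruct (win_cases (2 * L + 1) (2 * L) k) as [[W2 ->]|[W2 ->]];
  unfold tri; destruct (Nat.ltb_spec (k - (L + 1)) L); destruct (Nat.ltb_spec (k - (2 * L + 1)) L);
  destruct (Nat.leb_spec L k); destruct (Nat.leb_spec k (2 * L));
  destruct (Nat.leb_spec (2 * L) k); destruct (Nat.leb_spec k (4 * L)); try lia; cbn [andb];
  rewrite ?Rmult_0_l, ?plus_INR, ?minus_INR, ?plus_INR, ?mult_INR by lia;
  change (INR 2) with 2; change (INR 1) with 1; try (field; lra).
  all: replace k with L by lia; field; lra.
Qed.

Lemma W_conv_blocks n F z : let L := (2 ^ n)%nat in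
  W_conv (S n) F z =
    (RtoC (/ INR L) * block_poly F (L + 1) L z + RtoC (/ (2 * INR L)) * block_poly F (2 * L + 1) L z)%C.
Proof.
  intros L. rewrite W_conv_poly. unfold polyval, block_poly.
  assert (E2 : (2 ^ (S n + 1) = 4 * L)%nat) by (rewrite Nat.pow_add_r; unfold L; simpl; lia).
  rewrite E2.
  assert (B : forall s, (s + 2 * L <= S (4 * L))%nat ->
    csum L (fun i => csum L (fun j => F (s + i + j)%nat * Cpow z (s + i + j)))%C =
    csum (S (4 * L)) (fun k => RtoC (win s (2 * L) k) * (RtoC (INR (tri L (k - s))) * (F k * Cpow z k)))%C).
  { intros s Hs. rewrite csum_win by auto.
    transitivity (csum L (fun i => csum L (fun j => F (s + (i + j))%nat * Cpow z (s + (i + j))))%C).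
    - apply csum_ext; intros i _; apply csum_ext; intros j _. rewrite Nat.add_assoc; auto.
    - rewrite (double_sum_tri L (fun k => F (s + k)%nat * Cpow z (s + k)%nat)%C).
      apply csum_ext; intros k Hk. replace (s + k - s)%nat with k by lia. auto. }
  rewrite !B by lia. rewrite <- !csum_scal, <- csum_plus. apply csum_ext; intros k Hk.
  rewrite (W_hats n k) by lia. fold L. rewrite !RtoC_plus, !RtoC_mult. ring.
Qed.

(** Put [l = 2^(m+q)], so that [W_(m+q+2)] is made of the blocks of size [2 l]
    that start at the coefficients [2 l + 1] and [4 l + 1].  The rows of the
    blocks start at [l] and [2 l], and the columns at the indices that produce
    these coefficients after the shift by [K]; in both families a window ends
    before the second next one begins, and [1 + a + b >= l]. *)
Lemma dual_trace_besov p K F kappa :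
  dual_trace_bound (fun i j => RtoC (INR (1 + i + j) ^ p) * F (i + j + K)%nat)%C kappa ->
  besov (INR (S p)) F.
Proof.
  intros HA.
  (* With this [q] the subtraction of [K] below is never truncated. *)
  pose (q := S K).
  pose (l := fun m => (2 ^ (m + q))%nat).
  assert (HK : forall m, (K + 1 <= l m)%nat).
  { intros m. pose proof (Nat.pow_gt_lin_r 2 (m + q) ltac:(lia)). unfold l, q in *. lia. }
  assert (L1 : forall m, l (m + 2)%nat = (4 * l m)%nat).
  { intros m. unfold l. replace (m + 2 + q)%nat with (S (S (m + q))) by lia. simpl; lia. }
  assert (L0 : forall m, 0 < INR (l m)) by (intros m; apply lt_0_INR; specialize (HK m); lia).
  pose (g1 := fun m => L1_torus_norm (block_poly F (2 * l m + 1) (2 * l m))).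
  pose (g2 := fun m => L1_torus_norm (block_poly F (4 * l m + 1) (2 * l m))).
  assert (g1p : forall m, 0 <= g1 m) by (intros; apply L1_pos, tcont_block).
  assert (g2p : forall m, 0 <= g2 m) by (intros; apply L1_pos, tcont_block).
  assert (B1 : forall n, rsum n (fun m => INR (l m) ^ p * g1 m) <= 2 * kappa).
  { intros n. eapply Rle_trans; [|apply (block_sum F p K kappa l (fun m => l m + 1 - K)%nat (fun m => 2 * l m)%nat n HA)].
    - apply rsum_le; intros m _. pose proof (HK m).
      replace (l m + (l m + 1 - K) + K)%nat with (2 * l m + 1)%nat by lia.
      apply Rmult_le_compat_r; [apply g1p|]. apply pow_incr; split; [apply pos_INR|]. apply le_INR. lia.
    - intros m. rewrite L1. lia.
    - intros m. rewrite L1. pose proof (HK m). lia. }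
  assert (B2 : forall n, rsum n (fun m => INR (l m) ^ p * g2 m) <= 2 * kappa).
  { intros n. eapply Rle_trans; [|apply (block_sum F p K kappa (fun m => 2 * l m)%nat (fun m => 2 * l m + 1 - K)%nat (fun m => 2 * l m)%nat n HA)].
    - apply rsum_le; intros m _. pose proof (HK m).
      replace (2 * l m + (2 * l m + 1 - K) + K)%nat with (4 * l m + 1)%nat by lia.
      apply Rmult_le_compat_r; [apply g2p|]. apply pow_incr; split; [apply pos_INR|]. apply le_INR. lia.
    - intros m. rewrite L1. lia.
    - intros m. rewrite L1. pose proof (HK m). lia. }
  unfold besov.
  set (b := fun n => Rpower 2 (INR n * INR (S p)) * L1_torus_norm (W_conv n F)).
  assert (Hb : forall n, 0 <= b n).
  { intros n. unfold b. apply Rmult_le_pos; [|apply L1_pos, tcont_W_conv].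
    rewrite besov_weight. apply pow_le, Rlt_le, two_pow_pos. }
  apply (ex_series_incr_n b (S (S q))).
  apply ex_series_bounded with (4 ^ S p * (2 * kappa + 2 * kappa)); auto.
  intros n.
  apply Rle_trans with (rsum n (fun m => 4 ^ S p * (INR (l m) ^ p * g1 m + INR (l m) ^ p * g2 m))).
  - apply rsum_le; intros m _.
    replace (S (S q) + m)%nat with (S (S (m + q))) by lia.
    unfold b. rewrite besov_weight.
    assert (E : 2 ^ S (S (m + q)) = 4 * INR (l m)).
    { unfold l. rewrite INR_pow2. simpl; ring. }
    rewrite E, Rpow_mult_distr, Rmult_assoc. apply Rmult_le_compat_l; [apply pow_le; lra|].
    assert (EL : (2 ^ S (m + q) = 2 * l m)%nat) by reflexivity.
    rewrite (L1_ext _ _ (fun z => W_conv_blocks (S (m + q)) F z)). rewrite EL.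
    replace (2 * (2 * l m) + 1)%nat with (4 * l m + 1)%nat by lia.
    eapply Rle_trans.
    { apply Rmult_le_compat_l; [apply pow_le, pos_INR|]. apply L1_add_le; apply tcont_mult; auto using tcont_const, tcont_block. }
    rewrite !L1_scal by apply tcont_block. fold (g1 m) (g2 m). rewrite !Cmod_R.
    rewrite mult_INR. change (INR 2) with 2.
    specialize (L0 m). specialize (g1p m). specialize (g2p m).
    rewrite !Rabs_pos_eq by (apply Rlt_le, Rinv_0_lt_compat; lra).
    replace (INR (l m) ^ S p * (/ (2 * INR (l m)) * g1 m + / (2 * (2 * INR (l m))) * g2 m))
      with (INR (l m) ^ p * (g1 m / 2 + g2 m / 4)) by (simpl; field; lra).
    rewrite <- Rmult_plus_distr_l. apply Rmult_le_compat_l; [apply pow_le; lra|lra].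
  - rewrite rsum_scal, rsum_plus. apply Rmult_le_compat_l; [apply pow_le; lra|].
    apply Rplus_le_compat; auto.
Qed.

Lemma S1_weighted_hankel_iff_besov p K F f : (forall n, f n = F (n + K)%nat) ->
  S1_matrix (weighted_hankel (S p) f) <-> besov (INR (S p)) F.
Proof.
  intros E.
  assert (A : weighted_hankel (S p) f = fun i j => (RtoC (INR (1 + i + j) ^ p) * F (i + j + K)%nat)%C).
  { apply functional_extensionality; intros i. apply functional_extensionality; intros j.
    unfold weighted_hankel. rewrite E. simpl (S p - 1)%nat. rewrite Nat.sub_0_r. auto. }
  rewrite A, S1_matrix_iff_dual. split.
  - intros [kappa H]. apply dual_trace_besov with (1 := H).
  - apply besov_dual_trace.
Qed.

(** * Products of power series *)

Lemma fps_mul_csum a b n : fps_mul a b n = csum (S n) (fun k => a k * b (n - k)%nat)%C.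
Proof. unfold fps_mul. apply sum_n_csum. Qed.

Lemma fps_mul_sub_l a b c n : fps_mul (fps_sub a b) c n = (fps_mul a c n - fps_mul b c n)%C.
Proof.
  rewrite !fps_mul_csum. replace (csum (S n) (fun k => a k * c (n - k)%nat) - csum (S n) (fun k => b k * c (n - k)%nat))%C
    with (csum (S n) (fun k => a k * c (n - k)%nat) + (-(1)) * csum (S n) (fun k => b k * c (n - k)%nat))%C by ring.
  rewrite <- csum_scal, <- csum_plus. apply csum_ext; intros; unfold fps_sub; ring.
Qed.

(** [basis i] is the coefficient sequence of the monomial of degree [i]. *)
Lemma fps_basis_mul i b n : (i <= n)%nat -> fps_mul (basis i) b n = b (n - i)%nat.
Proof.
  intros H. rewrite fps_mul_csum.
  rewrite (csum_ext _ _ (fun k => b (n - k)%nat * basis i k)%C) by (intros; ring).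
  apply (csum_basis (S n) i (fun k => b (n - k)%nat)). lia.
Qed.

Lemma fps_basis_mul_low i b n : (n < i)%nat -> fps_mul (basis i) b n = RtoC 0.
Proof.
  intros H. rewrite fps_mul_csum. apply csum_0; intros k Hk. unfold basis.
  rewrite (proj2 (Nat.eqb_neq k i)) by lia. ring.
Qed.

Lemma fps_basis_mul_assoc d b c n :
  fps_mul (fps_mul (basis d) b) c n = fps_mul (basis d) (fps_mul b c) n.
Proof.
  destruct (Nat.le_gt_cases d n).
  - rewrite fps_basis_mul by auto. rewrite !fps_mul_csum.
    replace (S n) with (d + S (n - d))%nat by lia. rewrite csum_split, csum_0.
    + rewrite Cplus_0_l. apply csum_ext; intros k Hk. rewrite fps_basis_mul by lia.
      do 2 f_equal; lia.
    + intros k Hk. rewrite fps_basis_mul_low by lia. ring.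
  - rewrite fps_basis_mul_low by auto. rewrite fps_mul_csum. apply csum_0; intros k Hk.
    rewrite fps_basis_mul_low by lia. ring.
Qed.

Lemma fps_diff_mul d b n : fps_mul (fps_sub (basis d) fps_one) b (n + d)%nat = diff d b n.
Proof.
  rewrite fps_mul_sub_l, fps_basis_mul by lia. change fps_one with (basis 0). rewrite fps_basis_mul by lia.
  unfold diff. rewrite Nat.sub_0_r. do 2 f_equal. lia.
Qed.

Lemma fps_diff_mul_assoc d b c : fps_mul (fps_mul (fps_sub (basis d) fps_one) b) c =
  fps_mul (fps_sub (basis d) fps_one) (fps_mul b c).
Proof.
  apply functional_extensionality; intros n.
  replace (fps_mul (fps_sub (basis d) fps_one) b) with (fps_sub (fps_mul (basis d) b) (fps_mul (basis 0) b)).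
  - change fps_one with (basis 0). rewrite !fps_mul_sub_l, !fps_basis_mul_assoc. auto.
  - apply functional_extensionality; intros m. rewrite fps_mul_sub_l. auto.
Qed.

(** Multiplication by [z^d - 1] is the difference operator followed by a shift
    by [d]. *)
Lemma fps_diff_pow_mul d N phi n :
  fps_mul (fps_pow (fps_sub (basis d) fps_one) N) phi (n + d * N)%nat = diff_iter d N phi n.
Proof.
  revert n; induction N; intros n.
  - change (fps_mul (basis 0) phi (n + d * 0)%nat = phi n). rewrite fps_basis_mul by lia. f_equal; lia.
  - change (fps_pow (fps_sub (basis d) fps_one) (S N)) with
      (fps_mul (fps_sub (basis d) fps_one) (fps_pow (fps_sub (basis d) fps_one) N)).
    rewrite fps_diff_mul_assoc. replace (n + d * S N)%nat with (n + d * N + d)%nat by lia.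
    rewrite fps_diff_mul. unfold diff. replace (n + d * N + d)%nat with (n + d + d * N)%nat by lia.
    rewrite !IHN. reflexivity.
Qed.

Lemma fps_X_pow_2 : fps_pow fps_X 2 = basis 2.
Proof.
  apply functional_extensionality; intros n.
  change (fps_mul (basis 1) (fps_mul (basis 1) (basis 0)) n = basis 2 n).
  destruct n as [|[|n]].
  - rewrite fps_basis_mul_low by lia. auto.
  - rewrite fps_basis_mul, fps_basis_mul_low by lia. auto.
  - rewrite !fps_basis_mul by lia. unfold basis. simpl. rewrite Nat.sub_0_r. auto.
Qed.

Theorem lemma7p4 (N : nat) (phi : nat -> C) (hN : (1 <= N)%nat)
    (hphi : bounded_seq phi) :
  (class_A N phi <->
     besov (INR N) (fps_mul (fps_pow (fps_sub (fps_pow fps_X 2) fps_one) N) phi)) /\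
  (class_B N phi <->
     besov (INR N) (fps_mul (fps_pow (fps_sub fps_X fps_one) N) phi)) /\
  (class_C N phi <->
     besov (INR N) (fps_mul (fps_sub (fps_pow fps_X 2) fps_one) phi)).
Proof.
  destruct N as [|p]; [lia|].
  rewrite fps_X_pow_2. change fps_X with (basis 1).
  assert (H : forall K F f, (forall n, f n = F (n + K)%nat) ->
    ((bounded_seq phi /\ S1_matrix (weighted_hankel (S p) f)) <-> besov (INR (S p)) F)).
  { intros K F f E. rewrite <- (S1_weighted_hankel_iff_besov p K F f E). tauto. }
  split; [|split].
  - apply (H (2 * S p)%nat). intros n. symmetry; apply fps_diff_pow_mul.
  - apply (H (1 * S p)%nat). intros n. symmetry; apply fps_diff_pow_mul.
  - apply (H 2%nat). intros n. symmetry; apply fps_diff_mul.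
Qed.
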